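(* Let $X$ be a nilpotent complex algebraic variety such that $\pi_2(X)$ is a free abelian group of rank $r$, identified with $\mathbb{Z}^r$ by a choice of basis, and let $x_0\in X$. Assume that there is a positive cone $C\subset \mathbb{Z}^r$ and natural numbers $k_{\mathbf n}$ $(\mathbf n\in C)$ such that for every $\mathbf n\in C$ the inclusion map $$\mathrm{Hol}^{\mathbf n}_{x_0}(\mathbb{C}\mathbb{P}^1,X)\subset F^{\mathbf n}_{x_0}(\mathbb{C}\mathbb{P}^1,X)$$ induces a rational homotopy equivalence up to dimension $k_{\mathbf n}$, where $k_{\mathbf n}\to\infty$ as $\mathbf n$ moves to infinity in $C$. Then for every $\mathbf n\in C$ and every integer $d\ge 1$ the map $$g_{\mathbf n,d\mathbf n}:\mathrm{Hol}^{\mathbf n}_{x_0}(\mathbb{C}\mathbb{P}^1,X)\to \mathrm{Hol}^{d\mathbf n}_{x_0}(\mathbb{C}\mathbb{P}^1,X),\qquad g_{\mathbf n,d\mathbf n}(f)(z)=f(z^d),$$ induces a rational homotopy equivalence up to dimension $\min\{k_{\mathbf n},k_{d\mathbf n}\}$.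
   Context: $X$ carries its classical (analytic) topology and is nilpotent as a topological space. The base point of $\mathbb{C}\mathbb{P}^1=\mathbb{C}\cup\{\infty\}$ is $\infty$, which is fixed by $z\mapsto z^d$. For $\mathbf n\in\mathbb{Z}^r\cong\pi_2(X)=\pi_2(X,x_0)$, $F^{\mathbf n}_{x_0}(\mathbb{C}\mathbb{P}^1,X)$ is the space (compact-open topology) of continuous maps $f:\mathbb{C}\mathbb{P}^1\to X$ with $f(\infty)=x_0$ whose homotopy class in $\pi_2(X,x_0)$ is $\mathbf n$ (maps of multiple degree $\mathbf n$), and $\mathrm{Hol}^{\mathbf n}_{x_0}(\mathbb{C}\mathbb{P}^1,X)$ is its subspace of holomorphic maps. Precomposition with $z\mapsto z^d$ multiplies the degree by $d$. A positive cone is a subset $C\subset\mathbb{Z}_{\ge 0}^r$ (with respect to the chosen basis) with $m\mathbf n\in C$ for all $\mathbf n\in C$ and integers $m\ge 1$; ''$\mathbf n$ moves to infinity in $C$'' means that $\mathbf n\in C$ and all coordinates of $\mathbf n$ tend to infinity. A continuous map $\phi:P\to Q$ is (induces) a rational homotopy equivalence up to dimension $k$ if it induces a bijection on path components and, for every base point $p\in P$ and every $1\le i\le k$, an isomorphism $\pi_i(P,p)\otimes\mathbb{Q}\to\pi_i(Q,\phi(p))\otimes\mathbb{Q}$ (for $i=1$, $\pi_1\otimes\mathbb{Q}$ denotes the rational (Malcev) completion). *)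

(* Defs.v *)
From HB Require Import structures.
From mathcomp Require Import all_boot all_order all_algebra finmap.
From mathcomp Require Import all_classical all_reals all_analysis.
From mathcomp Require Import complex.
From mathcomp Require Import -(notations) mpoly monalg.
From mathcomp Require Import lra.

Set Implicit Arguments.
Unset Strict Implicit.
Unset Printing Implicit Defensive.

Import Order.TTheory GRing.Theory Num.Theory.
Import numFieldNormedType.Exports.

Local Open Scope classical_set_scope.
Local Open Scope ring_scope.
Local Open Scope quotient_scope.

Section Cubes.
Context {R : realType}.

Definition cube n : set 'rV[R]_n := [set x | forall i, 0 <= x 0 i <= 1].

Definition cube_boundary n : set 'rV[R]_n :=
  [set x | cube x /\ exists i, x 0 i = 0 \/ x 0 i = 1].

Definition unit_interval : set R := [set t | 0 <= t <= 1].

(* Maps of pairs (I^n, dI^n) -> (P, p).  The values of [cube_fun] outside the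
   cube are irrelevant: [homotopic] does not see them. *)
Record cube_map n (P : topologicalType) (p : P) := CubeMap {
  cube_fun :> 'rV[R]_n -> P;
  cube_fun_continuous : {within @cube n, continuous cube_fun};
  cube_fun_boundary : forall x, cube_boundary x -> cube_fun x = p }.

Definition homotopic n (P : topologicalType) (p : P) (f g : cube_map n p) :=
  exists H : R * 'rV[R]_n -> P,
    [/\ {within unit_interval `*` @cube n, continuous H},
        forall x, cube x -> H (0, x) = f x,
        forall x, cube x -> H (1, x) = g x &
        forall t x, unit_interval t -> cube_boundary x -> H (t, x) = p].

End Cubes.
Arguments cube_map R n {P} p.
Arguments cube R n : clear implicits.

Section Aux.
Context {R : realType}.

Lemma continuous_paste (T S : topologicalType) (h : T -> R) (c : R)
    (F G : T -> S) : continuous h -> continuous F -> continuous G ->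
  (forall x, h x = c -> F x = G x) ->
  continuous (fun x => if h x <= c then F x else G x).
Proof.
move=> ch cF cG FG x U; set K := fun x => _.
suff : nbhs (K x) U -> nbhs x (K @^-1` U) by [].
have nF : nbhs (F x) U -> nbhs x (F @^-1` U) by exact: cF.
have nG : nbhs (G x) U -> nbhs x (G @^-1` U) by exact: cG.
rewrite {1}/K; case: (ltgtP (h x) c) => hx nU.
- have nh : nbhs x (h @^-1` [set s | s < c]) by exact: (ch x _ (lt_nbhsl hx)).
  apply: (filterS _ (filterI nh (nF nU))) => y [/= hy].
  by rewrite /K /= (ltW hy).
- have nh : nbhs x (h @^-1` [set s | c < s]) by exact: (ch x _ (lt_nbhsr hx)).
  apply: (filterS _ (filterI nh (nG nU))) => y [/= hy].
  by rewrite /K /= leNgt hy.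
- have FU := nF nU; rewrite (FG x hx) in nU.
  apply: (filterS _ (filterI FU (nG nU))) => y [].
  by rewrite /K /=; case: ifP.
Qed.

Lemma continuous_row (T : topologicalType) n (F : 'I_n -> T -> R) :
  (forall i, continuous (F i)) -> continuous (fun x => \row_i F i x).
Proof.
move=> cF x U /= -[B nB BU]; rewrite /= nbhs_simpl /=.
have : \forall y \near x, forall i, B 0 i (F i y).
  apply: filter_forall => i; have := nB 0 i; rewrite mxE => nBi.
  exact: (cF i x _ nBi).
apply: filterS => y By; apply: BU => i j; rewrite (ord1 i) mxE; exact: By.
Qed.

Lemma within_comp (T S Q : topologicalType) (A : set S) (f : S -> Q)
    (c : T -> S) : {within A, continuous f} -> continuous c ->
  (forall x, A (c x)) -> continuous (f \o c).
Proof.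
move=> /subspace_continuousP cf cc Ac x; apply: cvg_comp; last exact: cf.
move=> V /=; rewrite /nbhs /= /within /= => nV.
move: (cc x _ nV); rewrite /nbhs/=; apply: filterS => y /=; apply; exact: Ac.
Qed.

Definition clamp (s : R) := Num.max 0 (Num.min 1 s).
Definition clampv n (x : 'rV[R]_n) : 'rV[R]_n := \row_i clamp (x 0 i).

Lemma clamp_itv s : 0 <= clamp s <= 1.
Proof. by rewrite /clamp le_max lexx /= ge_max ler01 ge_min lexx. Qed.
Lemma clampK s : 0 <= s <= 1 -> clamp s = s.
Proof. by case/andP=> s0 s1; rewrite /clamp min_r // max_r. Qed.
Lemma clamp_le0 s : s <= 0 -> clamp s = 0.
Proof.
by move=> s0; rewrite /clamp min_r ?max_l // (le_trans s0).
Qed.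
Lemma clamp_ge1 s : 1 <= s -> clamp s = 1.
Proof. by move=> s1; rewrite /clamp min_l // max_r. Qed.
Lemma clamp_continuous : continuous clamp.
Proof.
move=> s; apply: continuous_max; first exact: cvg_cst.
by apply: continuous_min; [exact: cvg_cst | exact: cvg_id].
Qed.
Lemma coord_cont n (i : 'I_n) : continuous (fun x : 'rV[R]_n => x 0 i).
Proof. exact: coord_continuous. Qed.
Lemma clampv_continuous n : continuous (@clampv n).
Proof.
apply: continuous_row => i x.
by apply: (continuous_comp (@coord_cont n i x)); exact: clamp_continuous.
Qed.
Lemma clampv_cube n x : cube R n (clampv x).
Proof. by move=> i; rewrite mxE clamp_itv. Qed.
Lemma clampvK n x : cube R n x -> clampv x = x.
Proof. by move=> cx; apply/rowP => i; rewrite mxE clampK. Qed.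
Lemma clampv_boundary n (x : 'rV[R]_n) :
  (exists i, x 0 i <= 0 \/ 1 <= x 0 i) -> cube_boundary (clampv x).
Proof.
case=> i xi; split; first exact: clampv_cube.
exists i; rewrite mxE; case: xi => ?; [left; exact: clamp_le0|right].
exact: clamp_ge1.
Qed.
End Aux.

Section HomotopyGroups.
Context {R : realType}.
Local Notation half := (2^-1 : R).

Definition bdext n (x : 'rV[R]_n) := exists i, x 0 i <= 0 \/ 1 <= x 0 i.

Lemma boundary_bdext n (x : 'rV[R]_n) : cube_boundary x -> bdext x.
Proof. by case=> _ [i xi]; exists i; case: xi => ->; [left|right]. Qed.

(* A cube map extended to the whole space by clamping: continuous everywhere and
   equal to p outside the open cube. *)
Definition extend n (P : Type) (f : 'rV[R]_n -> P) := f \o @clampv R n.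

Lemma fst_cont (S T : topologicalType) : continuous (@fst S T).
Proof. by move=> z; exact: cvg_fst. Qed.
Lemma snd_cont (S T : topologicalType) : continuous (@snd S T).
Proof. by move=> z; exact: cvg_snd. Qed.
Lemma comp_cont (S T Q : topologicalType) (f : S -> T) (g : T -> Q) :
  continuous f -> continuous g -> continuous (g \o f).
Proof. by move=> cf cg x; apply: continuous_comp; [exact: cf|exact: cg]. Qed.
Lemma pair_cont (S T Q : topologicalType) (f : S -> T) (g : S -> Q) :
  continuous f -> continuous g -> continuous (fun x => (f x, g x)).
Proof. by move=> cf cg x; apply: cvg_pair; [exact: cf|exact: cg]. Qed.
Lemma affine_cont (T : topologicalType) (f : T -> R) (a b : R) :
  continuous f -> continuous (fun x => a * f x + b).
Proof.
move=> cf x; apply: cvgD; last exact: cvg_cst.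
by apply: cvgM; [exact: cvg_cst | exact: cf].
Qed.

Lemma scale_cont (T : topologicalType) (f : T -> R) (a : R) :
  continuous f -> continuous (fun x => a * f x).
Proof. by move=> cf x; apply: cvgM; [exact: cvg_cst | exact: cf]. Qed.
Lemma onem_cont (T : topologicalType) (f : T -> R) :
  continuous f -> continuous (fun x => 1 - f x).
Proof. by move=> cf x; apply: cvgB; [exact: cvg_cst | exact: cf]. Qed.

Section OnSpace.
Context {P : topologicalType} {p : P}.

Lemma extend_continuous n (f : cube_map R n p) : continuous (extend f).
Proof.
apply: within_comp; [exact: cube_fun_continuous|exact: clampv_continuous|].
exact: clampv_cube.
Qed.

Lemma extend_bd n (f : cube_map R n p) x : bdext x -> extend f x = p.
Proof. by move=> /clampv_boundary bx; apply: cube_fun_boundary. Qed.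

Lemma extendE n (f : cube_map R n p) x : cube R n x -> extend f x = f x.
Proof. by move=> cx; rewrite /extend /= clampvK. Qed.

Lemma within_eq (T S : topologicalType) (A : set T) (f g : T -> S) :
  (forall x, A x -> g x = f x) -> continuous g -> {within A, continuous f}.
Proof.
move=> gf cg.
apply: (@subspace_eq_continuous _ A _ g) => [x|]; first by rewrite inE => /gf.
exact: continuous_subspaceT.
Qed.

Lemma homotopicI n (f g : cube_map R n p) (H : R * 'rV[R]_n -> P) :
  continuous H -> (forall x, cube R n x -> H (0, x) = f x) ->
  (forall x, cube R n x -> H (1, x) = g x) ->
  (forall t x, 0 <= t <= 1 -> cube_boundary x -> H (t, x) = p) ->
  homotopic f g.
Proof.
by move=> cH H0 H1 Hb; exists H; split=> //; exact: continuous_subspaceT.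
Qed.

Lemma homotopicE n (f g : cube_map R n p) : homotopic f g ->
  exists H : R * 'rV[R]_n -> P,
  [/\ continuous H, forall x, H (0, x) = extend f x,
      forall x, H (1, x) = extend g x &
      forall t x, bdext x -> H (t, x) = p].
Proof.
case=> H [cH H0 H1 Hb]; exists (H \o (fun z => (clamp z.1, clampv z.2))); split.
- apply: within_comp cH _ _; last first.
    by move=> z; split; [exact: clamp_itv | exact: clampv_cube].
  apply: pair_cont.
    by apply: (comp_cont (@fst_cont _ _)); exact: clamp_continuous.
  by apply: (comp_cont (@snd_cont _ _)); exact: clampv_continuous.
- by move=> x /=; rewrite clamp_le0 // H0 //; exact: clampv_cube.
- by move=> x /=; rewrite clamp_ge1 // H1 //; exact: clampv_cube.
- by move=> t x bx; apply: Hb; [exact: clamp_itv | exact: clampv_boundary].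
Qed.

Lemma homotopic_refl n (f : cube_map R n p) : homotopic f f.
Proof.
apply: (@homotopicI _ _ _ (extend f \o snd)).
- by apply: comp_cont; [exact: snd_cont|exact: extend_continuous].
- by move=> x; exact: extendE.
- by move=> x; exact: extendE.
- by move=> t x _ /boundary_bdext bx; exact: extend_bd.
Qed.

Lemma homotopic_eq n (f g : cube_map R n p) :
  (forall x, cube R n x -> f x = g x) -> homotopic f g.
Proof.
move=> fg; have [H [cH H0 H1 Hb]] := homotopic_refl f.
by exists H; split=> // x cx; rewrite H1 ?fg.
Qed.

Lemma homotopic_sym n (f g : cube_map R n p) : homotopic f g -> homotopic g f.
Proof.
move=> /homotopicE[H [cH H0 H1 Hb]].
apply: (@homotopicI _ _ _ (H \o (fun z => (-1 * z.1 + 1, z.2)))).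
- apply: comp_cont cH; apply: pair_cont; last exact: snd_cont.
  by apply: affine_cont; exact: fst_cont.
- by move=> x cx /=; rewrite mulr0 add0r H1 extendE.
- by move=> x cx /=; rewrite mulr1 addNr H0 extendE.
- by move=> t x _ /boundary_bdext bx; exact: Hb.
Qed.

Lemma homotopic_trans n (g f h : cube_map R n p) :
  homotopic f g -> homotopic g h -> homotopic f h.
Proof.
move=> /homotopicE[H [cH H0 H1 Hb]] /homotopicE[K [cK K0 K1 Kb]].
apply: (@homotopicI _ _ _ (fun z => if z.1 <= half then H (2 * z.1 + 0, z.2)
                                   else K (2 * z.1 + -1, z.2))).
- apply: continuous_paste.
  + exact: fst_cont.
  + apply: (comp_cont _ cH); apply: pair_cont; last exact: snd_cont.
    by apply: affine_cont; exact: fst_cont.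
  + apply: (comp_cont _ cK); apply: pair_cont; last exact: snd_cont.
    by apply: affine_cont; exact: fst_cont.
  + move=> [t x] /= ->; rewrite (_ : 2 * half + 0 = 1); last by lra.
    by rewrite (_ : 2 * half + -1 = 0) ?H1 ?K0 //; lra.
- move=> x cx /=; rewrite ifT; last by lra.
  by rewrite mulr0 addr0 H0 extendE.
- move=> x cx /=; rewrite ifF; last by apply/negP; lra.
  by rewrite (_ : 2 * 1 + -1 = 1) ?K1 ?extendE //; lra.
- by move=> t x _ /boundary_bdext bx /=; case: ifP => _; [exact: Hb|exact: Kb].
Qed.

End OnSpace.

Section Concat.
Context {P : topologicalType} {p : P} {n : nat}.
Implicit Types (f g h : cube_map R n.+1 p) (x : 'rV[R]_n.+1).

Definition upd (s : R) x : 'rV[R]_n.+1 :=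
  \row_j if j == ord0 then s else x 0 j.

Lemma upd0 s x : upd s x 0 ord0 = s. Proof. by rewrite mxE eqxx. Qed.
Lemma updN s x j : j != ord0 -> upd s x 0 j = x 0 j.
Proof. by rewrite mxE => /negbTE->. Qed.
Lemma upd_upd s t x : upd s (upd t x) = upd s x.
Proof. by apply/rowP => j; rewrite !mxE; case: ifP => // ->. Qed.
Lemma upd_id x : upd (x 0 ord0) x = x.
Proof. by apply/rowP => j; rewrite !mxE; case: eqP => // ->. Qed.

Lemma upd_cont (T : topologicalType) (s : T -> R) (y : T -> 'rV[R]_n.+1) :
  continuous s -> continuous y -> continuous (fun z => upd (s z) (y z)).
Proof.
move=> cs cy; apply: continuous_row => j; case: (j == ord0); first exact: cs.
exact: (comp_cont cy (@coord_cont _ _ j)).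
Qed.

Lemma upd_cube s x : 0 <= s <= 1 -> cube R n.+1 x -> cube R n.+1 (upd s x).
Proof. by move=> s01 cx j; rewrite mxE; case: ifP. Qed.

Lemma upd_bdext s x : bdext x ->
  (x 0 ord0 <= 0 \/ 1 <= x 0 ord0 -> s <= 0 \/ 1 <= s) -> bdext (upd s x).
Proof.
case=> i; have [->|i0] := eqVneq i ord0.
  by move=> xi /(_ xi) s01; exists ord0; rewrite upd0.
by move=> xi _; exists i; rewrite updN.
Qed.

(* Concatenation in the first coordinate. *)
Definition conc (Q : Type) (f g : 'rV[R]_n.+1 -> Q) x : Q :=
  if x 0 ord0 <= half then f (upd (2 * x 0 ord0) x)
  else g (upd (2 * x 0 ord0 - 1) x).

Lemma conc_cont (T : topologicalType) (F G : T * 'rV[R]_n.+1 -> P) :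
  continuous F -> continuous G ->
  (forall t x, bdext x -> F (t, x) = p) ->
  (forall t x, bdext x -> G (t, x) = p) ->
  continuous (fun z => conc (fun y => F (z.1, y)) (fun y => G (z.1, y)) z.2).
Proof.
move=> cF cG Fb Gb.
have cc : continuous (fun z : T * 'rV[R]_n.+1 => z.2 0 ord0).
  exact: (comp_cont (@snd_cont _ _) (@coord_cont _ _ ord0)).
apply: continuous_paste => //.
- apply: (comp_cont _ cF); apply: pair_cont; first exact: fst_cont.
  apply: upd_cont; last exact: snd_cont.
  exact: scale_cont.
- apply: (comp_cont _ cG); apply: pair_cont; first exact: fst_cont.
  apply: upd_cont; last exact: snd_cont.
  exact: affine_cont.
- move=> [t x] /= ->; rewrite Fb ?Gb //; exists ord0; rewrite upd0; lra.
Qed.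

Lemma conc_bd (F G : 'rV[R]_n.+1 -> P) : (forall x, bdext x -> F x = p) ->
  (forall x, bdext x -> G x = p) -> forall x, bdext x -> conc F G x = p.
Proof.
move=> Fb Gb x bx; rewrite /conc; case: ifP => x2.
  by apply: Fb; apply: upd_bdext => //; lra.
by move/negbT: x2; rewrite -ltNge => x2; apply: Gb; apply: upd_bdext => //; lra.
Qed.

Lemma eq_conc (F G F' G' : 'rV[R]_n.+1 -> P) :
  {in cube R n.+1, F =1 F'} -> {in cube R n.+1, G =1 G'} ->
  {in cube R n.+1, conc F G =1 conc F' G'}.
Proof.
move=> FF GG x; rewrite inE => cx; rewrite /conc; have := cx ord0.
case: ifP => x2 x01.
  by apply: FF; rewrite inE; apply: upd_cube => //; lra.
move/negbT: x2; rewrite -ltNge => x2.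
by apply: GG; rewrite inE; apply: upd_cube => //; lra.
Qed.

Lemma extend_in f : {in cube R n.+1, extend f =1 f}.
Proof. by move=> x; rewrite inE => cx; rewrite extendE. Qed.

Lemma conc_cont1 (F G : 'rV[R]_n.+1 -> P) :
  continuous F -> continuous G -> (forall x, bdext x -> F x = p) ->
  (forall x, bdext x -> G x = p) -> continuous (conc F G).
Proof.
move=> cF cG Fb Gb.
pose F' (z : R * 'rV[R]_n.+1) := F z.2; pose G' (z : R * 'rV[R]_n.+1) := G z.2.
have cF' : continuous F' by apply: comp_cont cF; exact: snd_cont.
have cG' : continuous G' by apply: comp_cont cG; exact: snd_cont.
have := conc_cont cF' cG' (fun=> Fb) (fun=> Gb).
apply: (@comp_cont _ _ _ (fun x => (0 : R, x))).
by apply: pair_cont; [exact: cst_continuous | move=> x; exact: cvg_id].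
Qed.

Fact concat_continuous f g : {within cube R n.+1, continuous (conc f g)}.
Proof.
apply: (@within_eq _ _ _ _ (conc (extend f) (extend g))).
  move=> x cx; apply: eq_conc; [ | | by rewrite inE].
    by idtac; exact: extend_in.
  exact: extend_in.
by apply: conc_cont1;
  [exact: extend_continuous|exact: extend_continuous
  |exact: extend_bd|exact: extend_bd].
Qed.

Fact concat_boundary f g x : cube_boundary x -> conc f g x = p.
Proof.
move=> bx; have fgE : conc (extend f) (extend g) x = conc f g x.
  apply: eq_conc; [exact: extend_in|exact: extend_in|].
  by rewrite inE; case: bx.
rewrite -fgE; apply: conc_bd (boundary_bdext bx); exact: extend_bd.
Qed.

Definition concat f g : cube_map R n.+1 p :=
  CubeMap (@concat_continuous f g) (@concat_boundary f g).

Fact const_continuous m : {within cube R m, continuous (fun=> p)}.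
Proof. by apply: continuous_subspaceT; exact: cst_continuous. Qed.

Definition const_cube m : cube_map R m p :=
  CubeMap (@const_continuous m) (fun _ _ => erefl).

Definition rev_first x := upd (1 - x 0 ord0) x.

Fact reverse_continuous f :
  {within cube R n.+1, continuous (f \o rev_first)}.
Proof.
apply: (@within_eq _ _ _ _ (extend f \o rev_first)).
  move=> x cx; rewrite /= extendE //; apply: upd_cube => //.
  by have := cx ord0; lra.
apply: comp_cont; last exact: extend_continuous.
apply: upd_cont; last by move=> x; exact: cvg_id.
exact: (onem_cont (@coord_cont _ _ (ord0 : 'I_n.+1))).
Qed.

Fact reverse_boundary f x : cube_boundary x -> f (rev_first x) = p.
Proof.
move=> bx; have [cx _] := bx; rewrite -extendE.
  by apply: extend_bd; apply: upd_bdext; [exact: boundary_bdext|lra].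
by apply: upd_cube => //; have := cx ord0; lra.
Qed.

Definition reverse f : cube_map R n.+1 p :=
  CubeMap (@reverse_continuous f) (@reverse_boundary f).

Lemma homotopic_concat f f' g g' : homotopic f f' -> homotopic g g' ->
  homotopic (concat f g) (concat f' g').
Proof.
move=> /homotopicE[H [cH H0 H1 Hb]] /homotopicE[K [cK K0 K1 Kb]].
apply: (homotopicI (conc_cont cH cK Hb Kb)).
- move=> x cx /=; apply: eq_conc; last by rewrite inE.
    by move=> y yc /=; rewrite H0 extend_in.
  by move=> y yc /=; rewrite K0 extend_in.
- move=> x cx /=; apply: eq_conc; last by rewrite inE.
    by move=> y yc /=; rewrite H1 extend_in.
  by move=> y yc /=; rewrite K1 extend_in.
- by move=> t x _ /boundary_bdext bx /=; apply: conc_bd bx => y; auto.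
Qed.

Lemma homotopic_reverse f g : homotopic f g ->
  homotopic (reverse f) (reverse g).
Proof.
move=> /homotopicE[H [cH H0 H1 Hb]].
have rc x : cube R n.+1 x -> cube R n.+1 (rev_first x).
  by move=> cx; apply: upd_cube => //; have := cx ord0; lra.
apply: (@homotopicI _ _ _ _ _ (H \o (fun z => (z.1, rev_first z.2)))).
- apply: (comp_cont _ cH); apply: pair_cont; first exact: fst_cont.
  apply: upd_cont; last exact: snd_cont.
  have cc : continuous (fun z : R * 'rV[R]_n.+1 => z.2 0 ord0).
    exact: (comp_cont (@snd_cont _ _) (@coord_cont _ _ ord0)).
  exact: onem_cont.
- by move=> x cx /=; rewrite H0 extendE //; exact: rc.
- by move=> x cx /=; rewrite H1 extendE //; exact: rc.
- move=> t x _ /boundary_bdext bx /=; apply: Hb.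
  by apply: upd_bdext => //; lra.
Qed.

Lemma homotopic_reparam f g h (u v : R -> R) :
  continuous u -> continuous v ->
  (u 0 <= 0 /\ v 0 <= 0) \/ (1 <= u 0 /\ 1 <= v 0) ->
  (u 1 <= 0 /\ v 1 <= 0) \/ (1 <= u 1 /\ 1 <= v 1) ->
  (forall x, cube R n.+1 x -> g x = extend f (upd (u (x 0 ord0)) x)) ->
  (forall x, cube R n.+1 x -> h x = extend f (upd (v (x 0 ord0)) x)) ->
  homotopic g h.
Proof.
move=> cu cv uv0 uv1 gE hE.
apply: (@homotopicI _ _ _ _ _ (fun z => extend f
  (upd (u (z.2 0 ord0) + z.1 * (v (z.2 0 ord0) - u (z.2 0 ord0))) z.2))).
- apply: comp_cont (@extend_continuous _ _ _ f).
  have cc : continuous (fun z : R * 'rV[R]_n.+1 => z.2 0 ord0).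
    exact: (comp_cont (@snd_cont _ _) (@coord_cont _ _ ord0)).
  have cuc := comp_cont cc cu; have cvc := comp_cont cc cv.
  apply: upd_cont; last exact: snd_cont.
  move=> z; apply: cvgD; first exact: cuc.
  by apply: cvgM; [exact: fst_cont | apply: cvgB; [exact: cvc|exact: cuc]].
- by move=> x cx /=; rewrite mul0r addr0 gE.
- by move=> x cx /=; rewrite mul1r addrC subrK hE.
- move=> t x t01 [cx [j]]; have [->|j0] := eqVneq j ord0.
    move=> xi; apply: extend_bd; exists ord0; rewrite upd0.
    have cvx a b : (a <= 0 /\ b <= 0) \/ (1 <= a /\ 1 <= b) ->
        a + t * (b - a) <= 0 \/ 1 <= a + t * (b - a).
      by case=> -[a0 b0]; [left|right]; nra.
    by case: xi => /= ->; apply: cvx.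
  move=> xi; apply: extend_bd; exists j; rewrite updN //.
  by case: xi => ->; [left|right].
Qed.

Lemma id_cont (T : topologicalType) : continuous (@idfun T).
Proof. by move=> x; exact: cvg_id. Qed.

Lemma extend_upd f s x : cube R n.+1 x -> 0 <= s <= 1 ->
  extend f (upd s x) = f (upd s x).
Proof. by move=> cx s01; apply: extendE; exact: upd_cube. Qed.

Lemma extend_upd_bd f s x : s <= 0 \/ 1 <= s -> extend f (upd s x) = p.
Proof. by move=> s01; apply: extend_bd; exists ord0; rewrite upd0. Qed.

Lemma homotopic_concat1 f : homotopic (concat f (const_cube _)) f.
Proof.
apply: (@homotopic_reparam f _ _ (fun s => 2 * s + 0) idfun); try lra.
- by apply: affine_cont; exact: id_cont.
- exact: id_cont.
- move=> x cx; have := cx ord0; rewrite /= /conc addr0; case: ifP => x2 x01.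
    by rewrite extend_upd //; lra.
  by rewrite extend_upd_bd //; right; move/negbT: x2; lra.
- by move=> x cx; rewrite /= upd_id extendE.
Qed.

Lemma homotopic_1concat f : homotopic (concat (const_cube _) f) f.
Proof.
apply: (@homotopic_reparam f _ _ (fun s => 2 * s + -1) idfun); try lra.
- by apply: affine_cont; exact: id_cont.
- exact: id_cont.
- move=> x cx; have := cx ord0; rewrite /= /conc; case: ifP => x2 x01.
    by rewrite extend_upd_bd //; left; lra.
  by move/negbT: x2 => x2; rewrite extend_upd //; lra.
- by move=> x cx; rewrite /= upd_id extendE.
Qed.

Lemma homotopic_concatV f : homotopic (concat f (reverse f)) (const_cube _).
Proof.
apply: (@homotopic_reparam f _ _
  (fun s => if s <= half then 2 * s + 0 else (-2) * s + 2) (fun=> 0)).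
- apply: continuous_paste; try exact: id_cont.
  + by apply: affine_cont; exact: id_cont.
  + by apply: affine_cont; exact: id_cont.
  + by move=> s ->; lra.
- by exact: cst_continuous.
- by left; rewrite ifT; lra.
- by left; rewrite ifF; [lra|apply/negP; lra].
- move=> x cx; have := cx ord0; rewrite /= /conc; case: ifP => x2 x01.
    by rewrite addr0 extend_upd //; lra.
  move/negbT: x2 => x2; rewrite /= /rev_first upd0 upd_upd.
  rewrite extend_upd //; last lra.
  by congr (f (upd _ _)); lra.
- by move=> x cx /=; rewrite extend_upd_bd //; left.
Qed.

Lemma homotopic_Vconcat f : homotopic (concat (reverse f) f) (const_cube _).
Proof.
apply: (@homotopic_reparam f _ _
  (fun s => if s <= half then (-2) * s + 1 else 2 * s + -1) (fun=> 1)).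
- apply: continuous_paste; try exact: id_cont.
  + by apply: affine_cont; exact: id_cont.
  + by apply: affine_cont; exact: id_cont.
  + by move=> s ->; lra.
- by exact: cst_continuous.
- by right; rewrite ifT; lra.
- by right; rewrite ifF; [lra|apply/negP; lra].
- move=> x cx; have := cx ord0; rewrite /= /conc; case: ifP => x2 x01.
    rewrite /= /rev_first upd0 upd_upd extend_upd //; last lra.
    by congr (f (upd _ _)); lra.
  by move/negbT: x2 => x2; rewrite extend_upd //; lra.
- by move=> x cx /=; rewrite extend_upd_bd //; right.
Qed.

Lemma homotopic_concatA f g h :
  homotopic (concat f (concat g h)) (concat (concat f g) h).
Proof.
apply: (@homotopic_reparam (concat (concat f g) h) _ _
  (fun s => if s <= half then half * s + 0 else
            if s <= 3 / 4 then 1 * s + - (1 / 4) else 2 * s + -1) idfun).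
- apply: continuous_paste; try exact: id_cont.
  + by apply: affine_cont; exact: id_cont.
  + apply: continuous_paste; try exact: id_cont.
    * by apply: affine_cont; exact: id_cont.
    * by apply: affine_cont; exact: id_cont.
    * by move=> s ->; lra.
  + by move=> s ->; rewrite ifT; lra.
- exact: id_cont.
- by left; rewrite /= ifT; lra.
- by right; rewrite /= !ifF; [lra|apply/negP; lra|apply/negP; lra].
- move=> x cx; have := cx ord0 => x01; rewrite extend_upd //; last first.
    by case: ifP => x2; [lra|case: ifP => x3; move/negbT: x2; lra].
  move: x01; set s := x 0 ord0 => x01.
  rewrite /= /conc -/s; case: ifP => [x2|/negbT x2].
    have e1 : half * s + 0 <= half by lra.
    have e2 : 2 * (half * s + 0) <= half by lra.
    by rewrite !(upd0, upd_upd) e1 e2; congr (f (upd _ _)); lra.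
  have [x3|x3] := leP s (3 / 4).
    have e1 : 1 * s + - (1 / 4) <= half by lra.
    have e2 : 2 * (1 * s + - (1 / 4)) <= half = false by apply/negP; lra.
    have e3 : 2 * s - 1 <= half by lra.
    by rewrite !(upd0, upd_upd) e1 e2 e3; congr (g (upd _ _)); lra.
  have e1 : 2 * s + -1 <= half = false by apply/negP; lra.
  have e3 : 2 * s - 1 <= half = false by apply/negP; lra.
  by rewrite !(upd0, upd_upd) e1.
- by move=> x cx; rewrite (upd_id x) extendE.
Qed.

End Concat.
End HomotopyGroups.

Section HomotopyGroupType.
Context {R : realType}.

HB.instance Definition _ n (P : topologicalType) (p : P) :=
  gen_eqMixin (cube_map R n p).
HB.instance Definition _ n (P : topologicalType) (p : P) :=
  gen_choiceMixin (cube_map R n p).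

Definition homotopicb n (P : topologicalType) (p : P) : rel (cube_map R n p) :=
  fun f g => `[< homotopic f g >].

Fact homotopicb_equiv n (P : topologicalType) (p : P) :
  equiv_class_of (@homotopicb n P p).
Proof.
split=> [f|f g|f g h]; first by apply/asboolP; exact: homotopic_refl.
  by apply/asboolP/asboolP; exact: homotopic_sym.
by move=> /asboolP gf /asboolP fh; apply/asboolP; exact: homotopic_trans gf fh.
Qed.

Canonical homotopicb_equiv_rel n (P : topologicalType) (p : P) :=
  EquivRelPack (@homotopicb_equiv n P p).

(* The homotopy set pi_n(P, p); a (multiplicative) group in degrees n.+1. *)
Definition homotopy_group n (P : topologicalType) (p : P) :=
  {eq_quot (@homotopicb n P p)}.

HB.instance Definition _ n (P : topologicalType) (p : P) :=
  Choice.on (@homotopy_group n P p).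
HB.instance Definition _ n (P : topologicalType) (p : P) :=
  EqQuotient.on (@homotopy_group n P p).

Definition homotopy_class n (P : topologicalType) (p : P) (f : cube_map R n p) :
  homotopy_group n p := \pi f.

Section Theory.
Context {P : topologicalType} {p : P}.

Lemma homotopy_classP n (f g : cube_map R n p) :
  homotopy_class f = homotopy_class g <-> homotopic f g.
Proof.
split; first by move/eqmodP/asboolP.
by move=> fg; apply/eqmodP/asboolP.
Qed.

Lemma homotopy_class_repr n (a : homotopy_group n p) :
  homotopy_class (repr a) = a.
Proof. exact: reprK. Qed.

Lemma pi_ind n (Q : homotopy_group n p -> Prop) :
  (forall f, Q (homotopy_class f)) -> forall a, Q a.
Proof. by move=> Qf a; rewrite -(homotopy_class_repr a). Qed.

Context {n : nat}.
Definition pi_mul (a b : homotopy_group n.+1 p) : homotopy_group n.+1 p :=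
  homotopy_class (concat (repr a) (repr b)).
Definition pi_inv (a : homotopy_group n.+1 p) : homotopy_group n.+1 p :=
  homotopy_class (reverse (repr a)).
Definition pi_one : homotopy_group n.+1 p := homotopy_class (const_cube n.+1).

Lemma pi_mulE (f g : cube_map R n.+1 p) :
  pi_mul (homotopy_class f) (homotopy_class g) = homotopy_class (concat f g).
Proof.
by apply/homotopy_classP; apply: homotopic_concat; apply/homotopy_classP;
  rewrite homotopy_class_repr.
Qed.

Lemma pi_invE (f : cube_map R n.+1 p) :
  pi_inv (homotopy_class f) = homotopy_class (reverse f).
Proof.
by apply/homotopy_classP; apply: homotopic_reverse; apply/homotopy_classP;
  rewrite homotopy_class_repr.
Qed.

Fact pi_mulA : associative pi_mul.
Proof.
elim/pi_ind=> f; elim/pi_ind=> g; elim/pi_ind=> h; rewrite !pi_mulE.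
by apply/homotopy_classP; exact: homotopic_concatA.
Qed.
Fact pi_mul1 : left_id pi_one pi_mul.
Proof.
elim/pi_ind=> f; rewrite pi_mulE.
by apply/homotopy_classP; exact: homotopic_1concat.
Qed.
Fact pi_mulr1 : right_id pi_one pi_mul.
Proof.
elim/pi_ind=> f; rewrite pi_mulE.
by apply/homotopy_classP; exact: homotopic_concat1.
Qed.
Fact pi_mulV : left_inverse pi_one pi_inv pi_mul.
Proof.
elim/pi_ind=> f; rewrite pi_invE pi_mulE.
by apply/homotopy_classP; exact: homotopic_Vconcat.
Qed.
Fact pi_mulrV : right_inverse pi_one pi_inv pi_mul.
Proof.
elim/pi_ind=> f; rewrite pi_invE pi_mulE.
by apply/homotopy_classP; exact: homotopic_concatV.
Qed.

HB.instance Definition _ := isGroup.Build (homotopy_group n.+1 p)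
  pi_mulA pi_mul1 pi_mulr1 pi_mulV pi_mulrV.
End Theory.

Section Functor.
Context {P Q : topologicalType} (phi : P -> Q) (phi_cont : continuous phi).

Fact cube_map_comp_continuous n (p : P) (f : cube_map R n p) :
  {within cube R n, continuous (phi \o f)}.
Proof.
move=> x; apply: (@continuous_comp (subspace (cube R n)) P Q f phi).
  exact: (@cube_fun_continuous _ _ _ _ f x).
exact: phi_cont.
Qed.

Fact cube_map_comp_boundary n (p : P) (f : cube_map R n p) x :
  cube_boundary x -> phi (f x) = phi p.
Proof. by move=> /cube_fun_boundary ->. Qed.

Definition cube_map_comp n (p : P) (f : cube_map R n p) :
    cube_map R n (phi p) :=
  CubeMap (@cube_map_comp_continuous n p f) (@cube_map_comp_boundary n p f).

Definition homotopy_group_map n (p : P) (a : homotopy_group n p) :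
    homotopy_group n (phi p) :=
  homotopy_class (cube_map_comp (repr a)).

Lemma homotopy_group_mapE n (p : P) (f : cube_map R n p) :
  homotopy_group_map (homotopy_class f) = homotopy_class (cube_map_comp f).
Proof.
have : homotopic (repr (homotopy_class f)) f.
  by apply/homotopy_classP; rewrite homotopy_class_repr.
move=> [H [cH H0 H1 Hb]]; apply/homotopy_classP; exists (phi \o H); split=> /=.
- move=> z; apply: (@continuous_comp (subspace _) P Q H phi); first exact: cH.
  exact: phi_cont.
- by move=> x cx; rewrite H0.
- by move=> x cx; rewrite H1.
- by move=> t x t01 bx; rewrite Hb.
Qed.

Lemma homotopy_group_mapM n (p : P) :
  {morph @homotopy_group_map n.+1 p : a b / (a * b)%g}.
Proof.
move=> a b; rewrite -(homotopy_class_repr a) -(homotopy_class_repr b).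
set f := repr a; set g := repr b.
have -> : (homotopy_class f * homotopy_class g)%g = homotopy_class (concat f g).
  exact: pi_mulE.
rewrite !homotopy_group_mapE.
have -> : (homotopy_class (cube_map_comp f) * homotopy_class (cube_map_comp g) =
    homotopy_class (concat (cube_map_comp f) (cube_map_comp g)))%g.
  exact: pi_mulE.
apply/homotopy_classP; apply: homotopic_eq => x _ /=.
by rewrite /conc; case: ifP.
Qed.
End Functor.
End HomotopyGroupType.
Arguments homotopy_group R n {P} p.

Section Rationalization.

Local Notation "'Q[' A ]" := (malg A rat) (at level 0, A at level 200).

(* Q[A] is the free rational vector space on A; free_map is functoriality. *)
Definition free_map (A B : choiceType) (f : A -> B) (x : Q[A]) : Q[B] :=
  \sum_(a <- msupp x) mkmalgU (f a) (mcoeff a x).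

Definition rational_span (A : choiceType) (S : set Q[A]) : set Q[A] :=
  [set x | exists m (c : 'I_m -> rat) (s : 'I_m -> Q[A]),
     (forall i, S (s i)) /\ x = \sum_i c i *: s i].

Definition augmentation (A : choiceType) (x : Q[A]) : rat :=
  \sum_(a <- msupp x) mcoeff a x.

(* The isomorphism Q[A] (x) Q[B] = Q[A * B] applied to x (x) y. *)
Definition outer (A B : choiceType) (x : Q[A]) (y : Q[B]) : Q[(A * B)%type] :=
  \sum_(a <- msupp x) \sum_(b <- msupp y)
    mkmalgU (a, b) (mcoeff a x * mcoeff b y).

(* f induces a well-defined bijection D/eqA -> E/eqB. *)
Definition induces_bijection (A B : Type) (D : set A) (eqA : A -> A -> Prop)
    (E : set B) (eqB : B -> B -> Prop) (f : A -> B) :=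
  [/\ forall x, D x -> E (f x),
      forall x y, D x -> D y -> (eqA x y <-> eqB (f x) (f y)) &
      forall y, E y -> exists2 x, D x & eqB (f x) y].

Section Group.
Context (G : groupType).

(* For an abelian group G (written multiplicatively), the tensor product of G
   with Q is Q[G] modulo the span of the [ab] - [a] - [b]. *)
Definition tensorQ_relations : set Q[G] :=
  rational_span [set mkmalgU (ab.1 * ab.2)%g 1 - mkmalgU ab.1 1 - mkmalgU ab.2 1
       | ab in [set: G * G]].

Definition tensorQ_eq (x y : Q[G]) := tensorQ_relations (x - y).

(* The product of the group algebra Q[G]. *)
Definition convolution (x y : Q[G]) : Q[G] :=
  \sum_(g <- msupp x) \sum_(h <- msupp y)
    mkmalgU (g * h)%g (mcoeff g x * mcoeff h y).

(* I^n, where I is the augmentation ideal of Q[G]. *)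
Fixpoint augmentation_power (n : nat) : set Q[G] :=
  if n is n'.+1 then
    rational_span [set convolution xy.1 xy.2 | xy in
          [set x | augmentation x = 0] `*` augmentation_power n']
  else setT.

(* A sequence x represents an element of the completed group algebra
   lim_n Q[G]/I^n, with x n taken modulo I^n, when x n.+1 = x n mod I^n. *)
Definition completion_eq (x y : nat -> Q[G]) :=
  forall n, augmentation_power n (x n - y n).

End Group.

(* The Malcev completion of an arbitrary group G after Quillen: the group-like
   elements of lim_n Q[G]/I^n, that is, those with augmentation 1 and
   Delta x = x (x) x in the completed tensor square, which is lim_n Q[G * G]/J^n
   with J the augmentation ideal of G * G.  For nilpotent G this is the
   rationalization of G, and for abelian G it is the tensor product with Q. *)
Definition malcev (G : groupType) : set (nat -> Q[G]) :=
  [set x |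
    [/\ forall n, augmentation_power n (x n.+1 - x n),
        forall n, augmentation (x n.+1) = 1 &
        forall n, augmentation_power n
          (free_map (fun g : G => (g, g)) (x n) - outer (x n) (x n))]].

Definition tensorQ_iso (G H : groupType) (phi : G -> H) :=
  induces_bijection setT (@tensorQ_eq G) setT (@tensorQ_eq H)
    (free_map phi).

Definition malcev_iso (G H : groupType) (phi : G -> H) :=
  induces_bijection (@malcev G) (@completion_eq G) (@malcev H)
    (@completion_eq H) (fun x n => free_map phi (x n)).

End Rationalization.

Section Spaces.
Context (R : realType).

Definition path_equiv (P : topologicalType) (x y : P) :=
  exists gamma : R -> P,
    [/\ {within unit_interval, continuous gamma}, gamma 0 = x & gamma 1 = y].

Definition rational_equivalence_upto (P Q : topologicalType) (k : nat)
    (phi : P -> Q) :=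
  exists phi_cont : continuous phi,
    induces_bijection setT (@path_equiv P) setT (@path_equiv Q) phi /\
    forall p : P,
      ((1 <= k)%N -> malcev_iso (@homotopy_group_map R P Q phi phi_cont 1 p)) /\
      forall i, (2 <= i.+2 <= k)%N ->
        tensorQ_iso (@homotopy_group_map R P Q phi phi_cont i.+2 p).

(* f and g are freely homotopic, the boundary of the cube following gamma: the
   classes of f and g correspond under the action of gamma on pi_n(P, p). *)
Definition moved_along n (P : topologicalType) (p : P) (gamma : cube_map R 1 p)
    (f g : cube_map R n p) :=
  exists H : R * 'rV[R]_n -> P,
    [/\ {within unit_interval `*` @cube R n, continuous H},
        forall x, cube R n x -> H (0, x) = f x,
        forall x, cube R n x -> H (1, x) = g x &
        forall t x, unit_interval t -> cube_boundary x ->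
          H (t, x) = gamma (const_mx t)].

Definition generated_subgroup (G : groupType) (S : set G) : set G :=
  [set x | forall H : set G, S `<=` H -> H 1%g ->
     (forall a b, H a -> H b -> H (a * b^-1)%g) -> H x].

(* The lower central series of the action of pi_1(P, p) on pi_n.+1(P, p).  For
   n = 0 the action is conjugation, so this is the usual lower central series. *)
Fixpoint action_lower_series n (P : topologicalType) (p : P) (k : nat) :
    set (homotopy_group R n.+1 p) :=
  if k is k'.+1 then
    generated_subgroup [set z |
      exists (gamma : cube_map R 1 p) (f g : cube_map R n.+1 p),
      [/\ action_lower_series k' (homotopy_class f), moved_along gamma f g &
          z = (homotopy_class g / homotopy_class f)%g]]
  else setT.

Definition nilpotent_space (P : topologicalType) :=
  (forall x y : P, path_equiv x y) /\
  forall (p : P) (n : nat), exists k,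
    @action_lower_series n P p k `<=` [set 1%g].

End Spaces.

Section Varieties.
Context (R : realType).
Local Notation C := (complex R).

Definition zariski_closed n (Z : set 'rV[C]_n) :=
  exists S : set (mpoly n C),
    Z = [set v | forall f, S f -> meval (v 0) f = 0].

(* Complex algebraic varieties in the sense of Serre: finitely many charts onto
   Zariski-closed subsets of affine spaces, overlapping in Zariski-open subsets,
   with regular coordinate changes and a Zariski-closed diagonal.  The value of
   [chart i] outside [chart_dom i] is irrelevant.  Irreducibility is not
   required. *)
Record variety := Variety {
  point_of :> choiceType;
  chart_index : finType;
  chart_dim : chart_index -> nat;
  chart_dom : chart_index -> set point_of;
  chart : forall i, point_of -> 'rV[C]_(chart_dim i);
  chart_cover : forall x, exists i, chart_dom i x;
  chart_inj : forall i, set_inj (chart_dom i) (chart i);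
  chart_affine : forall i, zariski_closed (chart i @` chart_dom i);
  chart_overlap : forall i j, exists2 Z, zariski_closed Z &
    chart i @` (chart_dom i `&` chart_dom j) =
    chart i @` (chart_dom i) `\` Z;
  chart_regular : forall i j x, chart_dom i x -> chart_dom j x ->
    forall l : 'I_(chart_dim j), exists f g : mpoly (chart_dim i) C,
      meval (chart i x 0) g != 0 /\
      forall y, chart_dom i y -> chart_dom j y ->
        meval (chart i y 0) g != 0 ->
        chart j y 0 l = meval (chart i y 0) f / meval (chart i y 0) g;
  chart_separated : forall i j, zariski_closed
    ((fun x => row_mx (chart i x) (chart j x)) @` (chart_dom i `&` chart_dom j))
}.

(* The set of points with the classical topology: a set is open when its trace on
   every chart is open for the Euclidean topology. *)
Definition analytic (X : variety) : Type := X.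

Section AnalyticTopology.
Context (X : variety).

HB.instance Definition _ := Choice.on (analytic X).

Definition analytic_open (A : set (analytic X)) :=
  forall i : chart_index X, exists2 O : set 'rV[C^o]_(chart_dim i), open O &
    chart_dom i `&` A = chart_dom i `&` @chart X i @^-1` O.

Fact analytic_openT : analytic_open setT.
Proof. by move=> i; exists setT; [exact: openT | rewrite preimage_setT]. Qed.

Fact analytic_openI : setI_closed analytic_open.
Proof.
move=> A B oA oB i; have [U oU UE] := oA i; have [V oV VE] := oB i.
exists (U `&` V); first exact: openI.
by rewrite setIIr UE VE -setIIr -preimage_setI.
Qed.

Fact analytic_open_bigcup (I : Type) (F : I -> set (analytic X)) :
  (forall i, analytic_open (F i)) -> analytic_open (\bigcup_i F i).
Proof.
move=> oF i.
pose O j := sval (cid2 (oF j i)).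
exists (\bigcup_j O j).
  by apply: bigcup_open => j _; rewrite /O; case: cid2.
rewrite preimage_bigcup !setI_bigcupr; apply: eq_bigcupr => j _.
by rewrite /O; case: cid2.
Qed.

HB.instance Definition _ := isOpenTopological.Build (analytic X)
  analytic_openT analytic_openI analytic_open_bigcup.

End AnalyticTopology.
End Varieties.

Section ProjectiveLine.
Context (R : realType).
Local Notation C := (complex R).

Definition CP1 := one_point_compactification C^o.

Definition CP1_pow (d : nat) (z : CP1) : CP1 :=
  if z is Some w then Some ((w : C) ^+ d) else None.

(* The coordinate w = 1/z at infinity. *)
Definition CP1_at_infinity (w : C^o) : CP1 :=
  if w == 0 then None else Some (w^-1 : C).

(* The increasing homeomorphism (0, 1) -> R used below; in both coordinates it
   gives an orientation-preserving homeomorphism from the open square to C, whose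
   extension [collapse] identifies I^2/dI^2 with CP1, dI^2 going to infinity. *)
Definition stretch (s : R) : R := (1 - s)^-1 - s^-1.

Definition collapse (x : 'rV[R]_2) : CP1 :=
  if (0 < x 0 ord0 < 1) && (0 < x 0 ord_max < 1)
  then Some (Complex (stretch (x 0 ord0)) (stretch (x 0 ord_max))) else None.

Lemma collapse_boundary x : cube_boundary x -> collapse x = None.
Proof.
case=> _ [j xj]; rewrite /collapse; case: ifP => // /andP[x0 x1]; exfalso.
have {xj} : x 0 ord0 = 0 \/ x 0 ord0 = 1 \/ x 0 ord_max = 0 \/ x 0 ord_max = 1.
  have : j = ord0 \/ j = ord_max.
    by case: j {xj} => -[|[|//]] ?; [left|right]; apply/val_inj.
  by case=> jE; rewrite jE in xj; case: xj => ->; auto.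
by case=> [|[|[|]]] xE; rewrite xE in x0 x1; lra.
Qed.

Lemma stretch_continuous s : 0 < s < 1 -> {for s, continuous stretch}.
Proof.
move=> s01; apply: cvgB.
  apply: cvgV; first by apply/eqP; lra.
  by apply: cvgB; [exact: cvg_cst|exact: cvg_id].
by apply: cvgV; [apply/eqP; lra|exact: cvg_id].
Qed.

Lemma norm_ReIm (z : C) : `|z| <= (`|complex.Re z| + `|complex.Im z|)%:C%C.
Proof.
case: z => a b; rewrite normc_def lecR /=.
rewrite -(ler_pXn2r (n := 2)) ?nnegrE ?sqrtr_ge0 ?addr_ge0 //.
rewrite sqr_sqrtr ?addr_ge0 ?sqr_ge0 // sqrrD !real_normK ?num_real //.
by rewrite addrAC lerDl mulrn_wge0 // mulr_ge0.
Qed.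

Lemma complex_continuous (T : topologicalType) (a b : T -> R) (x : T) :
  {for x, continuous a} -> {for x, continuous b} ->
  {for x, continuous (fun y => Complex (a y) (b y) : C^o)}.
Proof.
move=> ca cb; apply/cvgrPdist_lt => e e0.
have [r r0 re] : exists2 r : R, 0 < r & e = r%:C%C.
  move: e0; case: e => r i; rewrite ltcE /= => /andP[/eqP-> r0].
  by exists r.
have r20 : 0 < r / 2 by lra.
move/cvgrPdist_lt : ca => /(_ _ r20) na.
move/cvgrPdist_lt : cb => /(_ _ r20) nb.
apply: filterS2 na nb => y ay by_; rewrite re.
apply: le_lt_trans (norm_ReIm _) _; rewrite ltcR /=; lra.
Qed.

Lemma Re_continuous : continuous (@complex.Re R : C^o -> R).
Proof.
move=> z U /nbhs_ballP[e /= e0 eU].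
suff : nbhs (z : C^o) (@complex.Re R @^-1` U) by [].
have e0' : 0 < e%:C%C :> C by rewrite ltcR.
apply: filterS (nbhsx_ballx (z : C^o) (e%:C%C : C) e0') => w wz; apply: eU.
move: wz; rewrite /ball /= normc_def ltcR; apply: le_lt_trans.
case: z w => [a b] [c d] /=; rewrite -sqrtr_sqr ler_sqrt.
  by rewrite lerDl sqr_ge0.
by rewrite addr_ge0 ?sqr_ge0.
Qed.

Lemma Im_continuous : continuous (@complex.Im R : C^o -> R).
Proof.
move=> z U /nbhs_ballP[e /= e0 eU].
suff : nbhs (z : C^o) (@complex.Im R @^-1` U) by [].
have e0' : 0 < e%:C%C :> C by rewrite ltcR.
apply: filterS (nbhsx_ballx (z : C^o) (e%:C%C : C) e0') => w wz; apply: eU.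
move: wz; rewrite /ball /= normc_def ltcR; apply: le_lt_trans.
case: z w => [a b] [c d] /=; rewrite -sqrtr_sqr ler_sqrt.
  by rewrite lerDr sqr_ge0.
by rewrite addr_ge0 ?sqr_ge0.
Qed.

Lemma compact_ReIm (W : set C^o) : compact W -> exists2 M : R, 0 <= M &
  forall w, W w -> `|complex.Re w| <= M /\ `|complex.Im w| <= M.
Proof.
have bounded (f : C^o -> R) : continuous f -> compact W ->
    exists2 M : R, 0 <= M & forall w, W w -> `|f w| <= M.
  move=> cf cW.
  have : compact (f @` W).
    by apply: continuous_compact cW; exact: continuous_subspaceT.
  move=> /compact_bounded[M [_ HM]]; exists (`|M| + 1).
    by rewrite addr_ge0.
  move=> w Ww; apply: (HM (`|M| + 1)); last by exists w.
  by rewrite (le_lt_trans (ler_norm M)) // ltrDl.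
move=> cW; have [M M0 HM] := bounded _ Re_continuous cW.
have [N N0 HN] := bounded _ Im_continuous cW.
exists (M + N); first exact: addr_ge0.
by move=> w Ww; have := HM w Ww; have := HN w Ww; lra.
Qed.

Lemma stretch_large (M s : R) : 0 <= M -> 0 < s < 1 ->
  s < (M + 3)^-1 \/ 1 - (M + 3)^-1 < s -> M < `|stretch s|.
Proof.
move=> M0 s01 sM.
have near0 t : 0 < t < 1 -> t < (M + 3)^-1 -> M < t^-1 - (1 - t)^-1.
  move=> t01 tM; have [t0 t1] := andP t01.
  have M3 : 0 < M + 3 by lra.
  have tV : M + 3 < t^-1.
    by rewrite -[M + 3]invrK ltf_pV2 // posrE invr_gt0.
  have t3 : (M + 3)^-1 <= 3^-1 by rewrite lef_pV2 ?posrE //; lra.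
  have t2 : (1 - t)^-1 <= 2.
    by rewrite -[2]invrK lef_pV2 ?posrE ?invr_gt0 //; lra.
  lra.
case: sM => sM.
  apply: lt_le_trans (near0 s s01 sM) _.
  by rewrite -normrN /stretch opprB ler_norm.
apply: lt_le_trans (near0 (1 - s) _ _) _; try lra.
by rewrite /stretch opprB addrCA subrr addr0 ler_norm.
Qed.

Lemma collapse_continuous : continuous collapse.
Proof.
move=> x; have cc (j : 'I_2) := @coord_cont R 2 j x.
have [xin|xout] := boolP ((0 < x 0 ord0 < 1) && (0 < x 0 ord_max < 1)).
  have itv j : 0 < x 0 j < 1 -> nbhs x [set y : 'rV[R]_2 | 0 < y 0 j < 1].
    move=> /andP[j0 j1].
    have n0 : nbhs x [set y : 'rV[R]_2 | 0 < y 0 j].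
      exact: (cc j _ (lt_nbhsr j0)).
    have n1 : nbhs x [set y : 'rV[R]_2 | y 0 j < 1].
      exact: (cc j _ (lt_nbhsl j1)).
    by apply: (filterS _ (filterI n0 n1)) => y [/= -> ->].
  have /andP[x0 x1] := xin.
  pose K (y : 'rV[R]_2) : CP1 := Some
    (Complex (stretch (y 0 ord0)) (stretch (y 0 ord_max))).
  have cK : {for x, continuous K}.
    apply: (@continuous_comp _ C^o CP1 _ Some).
      apply: complex_continuous; apply: continuous_comp; try exact: cc;
        exact: stretch_continuous.
    exact: one_point_compactification_some_continuous.
  have KE : nbhs x [set y | collapse y = K y].
    apply: (filterS _ (filterI (itv _ x0) (itv _ x1))) => y [/= y0 y1].
    by rewrite /collapse y0 y1.
  move=> U; rewrite (nbhs_singleton KE) => nU.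
  suff : nbhs x (collapse @^-1` U) by [].
  have nK : nbhs x (K @^-1` U) by exact: cK.
  by apply: (filterS _ (filterI KE nK)) => y [/= yK]; rewrite /preimage /= yK.
have xN : collapse x = None by rewrite /collapse (negbTE xout).
move=> U; rewrite xN => -[W [cW _] WU].
have [M M0 HM] := compact_ReIm cW.
have M3 : 0 < (M + 3)^-1 by rewrite invr_gt0; lra.
suff : nbhs x [set y : 'rV[R]_2 |
    (0 < y 0 ord0 < 1) && (0 < y 0 ord_max < 1) ->
    M < `|stretch (y 0 ord0)| \/ M < `|stretch (y 0 ord_max)|].
  move=> nM; suff : nbhs x (collapse @^-1` U) by [].
  apply: filterS nM => y yM; apply: WU; rewrite /collapse.
  case: ifP => [yin|]; last by right.
  left; eexists; last by [].
  by move=> /HM /=; have := yM yin; lra.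
have main (j : 'I_2) : ~~ (0 < x 0 j < 1) ->
    nbhs x [set y : 'rV[R]_2 | 0 < y 0 j < 1 -> M < `|stretch (y 0 j)|].
  move=> xj; have [xj0|xj1] : x 0 j < (M + 3)^-1 \/ 1 - (M + 3)^-1 < x 0 j.
    by move: xj; rewrite negb_and -!leNgt => /orP[?|?]; [left|right]; lra.
  - have nj : nbhs x [set y : 'rV[R]_2 | y 0 j < (M + 3)^-1].
      exact: (cc j _ (lt_nbhsl xj0)).
    apply: filterS nj => y /= yj yin.
    by apply: stretch_large => //; left.
  - have nj : nbhs x [set y : 'rV[R]_2 | 1 - (M + 3)^-1 < y 0 j].
      exact: (cc j _ (lt_nbhsr xj1)).
    apply: filterS nj => y /= yj yin.
    by apply: stretch_large => //; right.
move: xout; rewrite negb_and => /orP[/main|/main].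
  by apply: filterS => y yM /andP[y0 _]; left; exact: yM.
by apply: filterS => y yM /andP[_ y1]; right; exact: yM.
Qed.

Section Sphere.
Context {X : topologicalType} {x0 : X} (f : CP1 -> X).
Context (f_cont : continuous f) (f_based : f None = x0).

Fact sphere_cube_continuous : {within cube R 2, continuous (f \o collapse)}.
Proof.
apply: continuous_subspaceT; apply: comp_cont f_cont.
exact: collapse_continuous.
Qed.

Fact sphere_cube_boundary x : cube_boundary x -> f (collapse x) = x0.
Proof. by move=> /collapse_boundary ->. Qed.

(* The element of pi_2(X, x0) represented by a based map CP1 -> X is the class of
   this cube. *)
Definition sphere_cube : cube_map R 2 x0 :=
  CubeMap sphere_cube_continuous sphere_cube_boundary.

End Sphere.
End ProjectiveLine.

Section MappingSpaces.
Context {R : realType} {X : variety R} {x0 : analytic X} {r : nat}.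
Local Notation CP1 := (CP1 R).
Local Notation C := (complex R).

(* f is continuous and its coordinates in the charts of X are complex
   differentiable wherever f takes values in the chart; the domain of
   a chart is open, so this is holomorphy on open sets. *)
Definition holomorphic (f : CP1 -> analytic X) :=
  [/\ continuous f,
      forall (i : chart_index X) (z : C), chart_dom i (f (Some z)) ->
        forall l, derivable (fun w : C^o => chart i (f (Some w)) 0 l : C^o) z 1 &
      forall i : chart_index X, chart_dom i (f None) ->
        forall l, derivable
          (fun w : C^o => chart i (f (CP1_at_infinity w)) 0 l : C^o) 0 1].

Context (deg : homotopy_group R 2 x0 -> 'rV[int]_r).

Definition BasedMaps (n : 'rV[int]_r) : set {compact-open, CP1 -> analytic X} :=
  [set f | exists (f_cont : continuous (f : CP1 -> analytic X))
      (f_based : f None = x0),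
      deg (homotopy_class (sphere_cube f_cont f_based)) = n].

Definition Hol (n : 'rV[int]_r) : set {compact-open, CP1 -> analytic X} :=
  [set f | BasedMaps n f /\ holomorphic f].

Fact Hol_sub_BasedMaps n : Hol n `<=` BasedMaps n.
Proof. by move=> f []. Qed.

Definition Hol_inclusion n (f : Hol n) : BasedMaps n :=
  exist _ (val f) (mem_set (Hol_sub_BasedMaps (set_valP f))).

End MappingSpaces.

Definition positive_cone r (D : set 'rV[int]_r) :=
  (forall n, D n -> forall i, 0 <= n 0 i) /\
  (forall n (m : nat), D n -> (1 <= m)%N -> D (n *+ m)).

Definition tends_to_infinity_in r (D : set 'rV[int]_r) (k : 'rV[int]_r -> nat) :=
  forall K : nat, exists N : nat, forall n, D n ->
    (forall i, N%:Z <= n 0 i) -> (K <= k n)%N.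

(* Main.v *)
Require Import Defs.
From HB Require Import structures.
From mathcomp Require Import all_boot all_order all_algebra finmap.
From mathcomp Require Import all_classical all_reals all_analysis.
From mathcomp Require Import complex.
From mathcomp Require Import -(notations) monalg.
From mathcomp Require Import lra ring.

Set Implicit Arguments.
Unset Strict Implicit.
Unset Printing Implicit Defensive.

Import Order.TTheory GRing.Theory Num.Theory.
Import numFieldNormedType.Exports.

Local Open Scope classical_set_scope.
Local Open Scope ring_scope.

(** * Rational equivalence of the power maps between spaces of holomorphic maps

   Write F(n) for the space of based maps of degree n and p for z |-> z^d.  The
   square formed by f |-> f o p on Hol(n) and on F(n) and by the two inclusions
   commutes, and the inclusions are rational equivalences in the degrees
   considered.  By two out of three it is enough that f |-> f o p from F(n) to
   F(dn) is rationally an isomorphism on every homotopy group ([induces_F_pow]).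
   On path components nothing more is needed: F(n) is nonempty and path connected,
   because degrees correspond bijectively to elements of pi_2, and hence so is
   Hol(n).

   The map f |-> f o p extends to the space Y of all based maps from the
   line, a double loop space whose components are the F(n).  Viewed on the square,
   elements of Y can be stacked along either coordinate.  The proof for Y has
   three ingredients.

   - The class of p in pi_2 of the line is d times that of the identity
     ([class_pow_map]).  Away from a neighbourhood of infinity, which is collapsed,
     the roots of w^(d+1) can be pulled apart to -1, with multiplicity d, and to 1;
     the imaginary axis then separates a map homotopic to w^d from one homotopic
       to w.
     Hence f |-> f o p is homotopic to f |-> f + ... + f, stacked along the
     first coordinate ([precompose_pow_homotopic]), and it multiplies degrees by d.

   - At the constant map, f |-> f + ... + f induces the d-th power on the homotopy
     groups, which are abelian, by the Eckmann-Hilton argument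
     ([induces_multiple_base_map]).  It commutes strictly with stacking along the
     second coordinate ([stack_interchange]), and translations for that operation
     are homotopy equivalences, so the other components behave like the
     component of the constant map ([induces_multiple]).

   - The d-th power map of an abelian group is an isomorphism after
     rationalization.  For the tensor product with Q this is immediate; for the
     Malcev completion it holds because on the quotient of the k-th power of the
     augmentation ideal by the next one the power map is multiplication
     by d^k ([pow_graded]).

   Homotopies need not preserve base points, so change of base point along a path
   is developed for homotopy groups defined by cubes ([base_change]). *)

(** * Free rational vector spaces and the group algebra *)

Local Notation "'Q[' A ]" := (malg A rat) (at level 0, A at level 200).
Local Notation "<| a |>" := (mkmalgU a (1 : rat)) (format "<| a |>").

Section FreeSpaces.
Variable A : choiceType.

Lemma mkmalgUZ (a : A) (c : rat) : mkmalgU a c = c *: <|a|>.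
Proof. by apply/malgP => b; rewrite mcoeffZ !mcoeffU mulr_natr. Qed.

Lemma free_decomp (x : Q[A]) : x = \sum_(a <- msupp x) mcoeff a x *: <|a|>.
Proof. by rewrite {1}[x]monalgE; apply: eq_bigr => a _; exact: mkmalgUZ. Qed.

(** The universal property of the free vector space Q[A]. *)
Definition lift_linear (V : lmodType rat) (h : A -> V) (x : Q[A]) : V :=
  \sum_(a <- msupp x) mcoeff a x *: h a.

Section Lift.
Variables (V : lmodType rat) (h : A -> V).

Lemma lift_linearEw (x : Q[A]) (d : {fset A}) : (msupp x `<=` d)%fset ->
  lift_linear h x = \sum_(a <- d) mcoeff a x *: h a.
Proof.
move=> sub; rewrite /lift_linear (big_fset_incl _ sub) // => a _ /mcoeff_outdom->.
by rewrite scale0r.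
Qed.

Fact lift_linear_is_linear : linear (lift_linear h).
Proof.
move=> c x y; pose d := (msupp x `|` msupp y `|` msupp (c *: x + y))%fset.
have sx : (msupp x `<=` d)%fset by rewrite /d -fsetUA fsubsetUl.
have sy : (msupp y `<=` d)%fset by rewrite /d fsetUAC fsubsetUr.
rewrite (lift_linearEw (fsubsetUr _ _ : (_ `<=` d)%fset)).
rewrite (lift_linearEw sx) (lift_linearEw sy) scaler_sumr -big_split /=.
by apply: eq_bigr => a _; rewrite mcoeffD mcoeffZ scalerDl scalerA.
Qed.

HB.instance Definition _ := GRing.isLinear.Build rat Q[A] V _ (lift_linear h)
  lift_linear_is_linear.

Lemma lift_linearU a : lift_linear h <|a|> = h a.
Proof. by rewrite /lift_linear msuppU oner_eq0 big_seq_fset1 mcoeffUU scale1r. Qed.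

End Lift.

Lemma eq_linear_free (V : lmodType rat) (f g : {linear Q[A] -> V}) :
  (forall a, f <|a|> = g <|a|>) -> f =1 g.
Proof.
move=> fg x; rewrite [x]free_decomp !linear_sum; apply: eq_bigr => a _.
by rewrite !linearZ /= fg.
Qed.

End FreeSpaces.

Section Functoriality.
Variables (A B : choiceType) (f : A -> B).

Lemma free_mapE : free_map f = lift_linear (fun a => <|f a|>).
Proof. by apply/funext => x; apply: eq_bigr => a _; exact: mkmalgUZ. Qed.

Fact free_map_is_linear : linear (free_map f).
Proof. by rewrite free_mapE; exact: lift_linear_is_linear. Qed.
HB.instance Definition _ := GRing.isLinear.Build rat Q[A] Q[B] _ (free_map f)
  free_map_is_linear.

Lemma free_mapU a : free_map f <|a|> = <|f a|>.
Proof. by rewrite free_mapE lift_linearU. Qed.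

Lemma augmentationE : @augmentation A = lift_linear (V := rat^o) (fun=> 1).
Proof. by apply/funext => x; apply: eq_bigr => a _;
  rewrite /GRing.scale /= mulr1. Qed.

Fact augmentation_is_linear : linear (@augmentation A : Q[A] -> rat^o).
Proof. by rewrite augmentationE; exact: lift_linear_is_linear. Qed.
HB.instance Definition _ := GRing.isLinear.Build rat Q[A] rat^o _
  (@augmentation A) augmentation_is_linear.

Lemma augmentationU (a : A) : augmentation <|a|> = 1.
Proof. by rewrite augmentationE lift_linearU. Qed.

End Functoriality.

Lemma augmentation_free_map (A B : choiceType) (f : A -> B) (x : Q[A]) :
  augmentation (free_map f x) = augmentation x.
Proof.
apply: (@eq_linear_free A rat^o (@augmentation B \o free_map f)
  (@augmentation A)) => a /=; by
  rewrite free_mapU !augmentationU.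
Qed.

Lemma free_map_comp (A B D : choiceType) (f : A -> B) (g : B -> D) (x : Q[A]) :
  free_map g (free_map f x) = free_map (g \o f) x.
Proof.
by apply: (@eq_linear_free _ _ (free_map g \o free_map f) (free_map (g \o f))) =>
  a /=;
  rewrite !free_mapU.
Qed.

Lemma free_map_id (A : choiceType) (f : A -> A) (x : Q[A]) :
  f =1 id -> free_map f x = x.
Proof.
move=> fid; by apply: (@eq_linear_free _ _ (free_map f) idfun) => a /=;
  rewrite free_mapU fid.
Qed.

Section Bilinear.
Variables (A B D : choiceType) (h : A -> B -> D).

(** The common form of [convolution] and [outer]. *)
Definition bilin (x : Q[A]) (y : Q[B]) : Q[D] :=
  \sum_(a <- msupp x) \sum_(b <- msupp y)
    mkmalgU (h a b) (mcoeff a x * mcoeff b y).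

Lemma bilinEl x y : bilin x y = lift_linear (fun a => free_map (h a) y) x.
Proof.
apply: eq_bigr => a _; rewrite free_mapE /lift_linear scaler_sumr.
by apply: eq_bigr => b _; rewrite scalerA; exact: mkmalgUZ.
Qed.

Lemma bilinEr x y :
  bilin x y = lift_linear (fun b => free_map (h^~ b) x) y.
Proof.
rewrite /bilin exchange_big; apply: eq_bigr => b _.
rewrite free_mapE /lift_linear scaler_sumr.
by apply: eq_bigr => a _; rewrite scalerA [LHS]mkmalgUZ mulrC.
Qed.

Fact bilin_linearl y : linear (bilin^~ y).
Proof. by move=> c x x'; rewrite !bilinEl linearP. Qed.
Fact bilin_linearr x : linear (bilin x).
Proof. by move=> c y y'; rewrite !bilinEr linearP. Qed.
HB.instance Definition _ := bilinear_isBilinear.Build rat Q[A] Q[B] Q[D] *:%R *:%R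
  bilin (bilin_linearl, bilin_linearr).

Lemma bilinU a b : bilin <|a|> <|b|> = <|h a b|>.
Proof. by rewrite bilinEl lift_linearU free_mapU. Qed.

End Bilinear.

(** * Powers of the augmentation ideal *)

Section Spans.
Variable A : choiceType.
Implicit Types S T : set Q[A].

Definition subspace_of T := T 0 /\ forall c x y, T x -> T y -> T (c *: x + y).

Section Closure.
Variables (T : set Q[A]) (sT : subspace_of T).

Lemma subspaceZ c x : T x -> T (c *: x).
Proof. by case: sT => T0 TD Tx; rewrite -[_ *: _]addr0; exact: TD. Qed.
Lemma subspaceD x y : T x -> T y -> T (x + y).
Proof. by case: sT => _ TD Tx Ty; rewrite -[x]scale1r; exact: TD. Qed.
Lemma subspaceN x : T x -> T (- x).
Proof. by rewrite -scaleN1r; exact: subspaceZ. Qed.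
Lemma subspaceB x y : T x -> T y -> T (x - y).
Proof. by move=> Tx /subspaceN; exact: subspaceD. Qed.
Lemma subspace_sum (I : Type) (r : seq I) (P : pred I) (F : I -> Q[A]) :
  (forall i, P i -> T (F i)) -> T (\sum_(i <- r | P i) F i).
Proof.
by move=> TF; elim/big_rec: _ => [|i x Pi Tx]; [exact: sT.1|exact/subspaceD/Tx/TF].
Qed.
Lemma subspace_distC x y : T (x - y) -> T (y - x).
Proof. by move=> /subspaceN; rewrite opprB. Qed.
Lemma subspace_dist_trans y x z : T (x - y) -> T (y - z) -> T (x - z).
Proof. by move=> xy /(subspaceD xy); rewrite addrA subrK. Qed.
End Closure.

Lemma rational_span_incl S : S `<=` rational_span S.
Proof.
by move=> x Sx; exists 1, (fun=> 1), (fun=> x); rewrite big_ord1 scale1r.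
Qed.

Lemma rational_span_subspace S : subspace_of (rational_span S).
Proof.
split; first by exists 0, (fun=> 0), (fun=> 0); split=> [[]//|]; rewrite big_ord0.
move=> c x y [m [a [s [Ss ->]]]] [m' [a' [s' [Ss' ->]]]].
pose glue I (u : 'I_m -> I) (v : 'I_m' -> I) i :=
  match fintype.split i with inl j => u j | inr j => v j end.
exists (m + m')%N, (glue _ (fun j => c * a j) a'), (glue _ s s').
split=> [i|]; first by rewrite /glue; case: fintype.split.
rewrite big_split_ord scaler_sumr; congr (_ + _); apply: eq_bigr => i _.
  by rewrite /glue (unsplitK (inl i)) scalerA.
by rewrite /glue (unsplitK (inr i)).
Qed.

Lemma rational_span_sub S T : subspace_of T -> S `<=` T -> rational_span S `<=` T.
Proof.
move=> sT ST _ [m [c [s [Ss ->]]]]; apply: subspace_sum => // i _.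
by apply: subspaceZ => //; exact/ST/Ss.
Qed.

End Spans.

Lemma subspace_preimage (A B : choiceType) (f : {linear Q[A] -> Q[B]})
    (T : set Q[B]) : subspace_of T -> subspace_of (f @^-1` T).
Proof.
move=> sT; split=> [|c x y]; rewrite /preimage /= ?linear0 ?linearP;
  first exact: sT.1.
exact: sT.2.
Qed.

Lemma rational_span_image (A B : choiceType) (f : {linear Q[A] -> Q[B]})
    (S : set Q[A]) (T : set Q[B]) : subspace_of T -> (forall x, S x -> T (f x)) ->
  forall x, rational_span S x -> T (f x).
Proof.
move=> sT ST; apply: (@rational_span_sub _ _ (f @^-1` T)) => //.
exact: subspace_preimage.
Qed.

(* Simplification would otherwise expose the spans behind numeral powers. *)
Arguments augmentation_power : simpl never.

Section GroupAlgebra.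
Variable G : groupType.
Local Notation conv := (@convolution G).
Local Notation I := (@augmentation_power G).

HB.instance Definition _ := Bilinear.copy (@convolution G)
  (bilin (fun g h : G => (g * h)%g)).
(* Linearity of a partial application is not inferred from bilinearity. *)
HB.instance Definition _ x := GRing.isLinear.Build rat Q[G] Q[G] _
  (@convolution G x) (bilin_linearr (fun g h : G => (g * h)%g) x).

Lemma convolutionU (g h : G) : conv <|g|> <|h|> = <|(g * h)%g|>.
Proof. exact: bilinU. Qed.

Lemma convolutionBl x x' y : conv (x - x') y = conv x y - conv x' y.
Proof. exact: (linearB (applyr conv y)). Qed.
Lemma convolutionBr x y y' : conv x (y - y') = conv x y - conv x y'.
Proof. exact: (linearB (conv x)). Qed.
Lemma convolutionZl c x y : conv (c *: x) y = c *: conv x y.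
Proof. exact: (linearZ_LR (applyr conv y)). Qed.
Lemma convolutionZr c x y : conv x (c *: y) = c *: conv x y.
Proof. exact: (linearZ_LR (conv x)). Qed.

Lemma convolutionA : associative conv.
Proof.
move=> x y z.
refine (@eq_linear_free _ _ (applyr conv (conv y z))
  (applyr conv z \o applyr conv y) _ x) => a.
refine (@eq_linear_free _ _ (conv <|a|> \o applyr conv z)
  (applyr conv z \o conv <|a|>) _ y) => b.
refine (@eq_linear_free _ _ (conv <|a|> \o conv <|b|>)
  (conv (conv <|a|> <|b|>)) _ z) => c.
by rewrite /= !convolutionU mulgA.
Qed.

Lemma convolution1 x : conv x <|1%g|> = x.
Proof.
refine (@eq_linear_free _ _ (applyr conv <|1%g|>) idfun _ x) => a.
by rewrite /= convolutionU mulg1.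
Qed.

Lemma augmentation_convolution x y :
  augmentation (conv x y) = augmentation x * augmentation y.
Proof.
rewrite [conv x y]bilinEl /lift_linear linear_sum /= /(augmentation x) mulr_suml.
by apply: eq_bigr => a _; rewrite linearZ /= augmentation_free_map.
Qed.

Lemma augmentation_power_subspace n : subspace_of (I n).
Proof. by case: n => [|n]; [split|exact: rational_span_subspace]. Qed.
Hint Resolve augmentation_power_subspace : core.

Lemma augmentation_power0 n : I n 0.
Proof. exact: (augmentation_power_subspace n).1. Qed.
Lemma augmentation_powerZ n c x : I n x -> I n (c *: x).
Proof. by apply: subspaceZ. Qed.
Lemma augmentation_powerD n x y : I n x -> I n y -> I n (x + y).
Proof. by apply: subspaceD. Qed.
Lemma augmentation_powerN n x : I n x -> I n (- x).
Proof. by apply: subspaceN. Qed.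
Lemma augmentation_powerB n x y : I n x -> I n y -> I n (x - y).
Proof. by apply: subspaceB. Qed.
Lemma augmentation_power_distC n x y : I n (x - y) -> I n (y - x).
Proof. by apply: subspace_distC. Qed.
Lemma augmentation_power_dist_trans n y x z :
  I n (x - y) -> I n (y - z) -> I n (x - z).
Proof. exact: subspace_dist_trans. Qed.

Lemma augmentation_power_convolution n x y :
  augmentation x = 0 -> I n y -> I n.+1 (conv x y).
Proof. by move=> x0 Iy; apply: rational_span_incl; exists (x, y). Qed.

Lemma augmentation_powerSP n (T : set Q[G]) : subspace_of T ->
  (forall x y, augmentation x = 0 -> I n y -> T (conv x y)) -> I n.+1 `<=` T.
Proof.
by move=> sT IT; apply: rational_span_sub => // _ [[x y] /= [x0 Iy] <-]; exact: IT.
Qed.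

Lemma augmentation_powerS n : I n.+1 `<=` I n.
Proof.
elim: n => // n IH; apply: augmentation_powerSP => // x y x0 Iy.
by apply: augmentation_power_convolution => //; exact: IH.
Qed.

Lemma augmentation_power_le m n : (m <= n)%N -> I n `<=` I m.
Proof.
move=> /subnK<-; elim: (n - m)%N => // k IH x; rewrite addSn.
by move=> /augmentation_powerS /IH.
Qed.

Lemma augmentation_power1 x : I 1 x <-> augmentation x = 0.
Proof.
split; last by move=> x0; rewrite -[x]convolution1;
  exact: augmentation_power_convolution.
move: x; apply: augmentation_powerSP => [|x y x0 _].
  by split=> [|c x y /= x0 y0]; rewrite ?linear0 // linearP /= x0 y0 scaler0 addr0.
by rewrite augmentation_convolution x0 mul0r.
Qed.

Lemma augmentation_power_mulr n x y : I n x -> I n (conv x y).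
Proof.
elim: n x => // n IH x; apply: (@rational_span_image _ _ (applyr conv y)) => // {x}.
move=> _ [[a b] /= [a0 Ib] <-]; rewrite -convolutionA.
by apply: augmentation_power_convolution => //; exact: IH.
Qed.

Lemma augmentation_power_mull n x y : I n y -> I n (conv x y).
Proof.
case: n => // n; apply: (@rational_span_image _ _ (conv x)) => //.
move=> _ [[a b] /= [a0 Ib] <-]; rewrite convolutionA.
by apply: augmentation_power_convolution => //;
  rewrite augmentation_convolution a0 mulr0.
Qed.

Lemma augmentation_powerM m n x y : I m x -> I n y -> I (m + n) (conv x y).
Proof.
elim: m x => [|m IH] x Ix Iy; first exact: augmentation_power_mull.
move: x Ix; apply: (@rational_span_image _ _ (applyr conv y)) => //.
move=> _ [[a b] /= [a0 Ib] <-]; rewrite -convolutionA.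
by apply: augmentation_power_convolution => //; exact: IH.
Qed.

End GroupAlgebra.
#[global] Hint Resolve augmentation_power_subspace : core.

(** * Rational isomorphisms of groups *)

Lemma tensorQ_relations_subspace (G : groupType) :
  subspace_of (@tensorQ_relations G).
Proof. exact: rational_span_subspace. Qed.

Section GroupMorphism.
Variables (G H : groupType) (phi : G -> H).
Hypothesis phiM : {morph phi : a b / (a * b)%g}.

Lemma free_map_convolution x y :
  free_map phi (convolution x y) = convolution (free_map phi x) (free_map phi y).
Proof.
refine (@eq_linear_free _ _ (free_map phi \o applyr (@convolution G) y)
  (applyr (@convolution H) (free_map phi y) \o free_map phi) _ x) => a.
refine (@eq_linear_free _ _ (free_map phi \o convolution <|a|>)
  (convolution (free_map phi <|a|>) \o free_map phi) _ y) => b.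
by rewrite /= !(convolutionU, free_mapU) phiM.
Qed.

Lemma free_map_augmentation_power n x :
  augmentation_power n x -> augmentation_power n (free_map phi x).
Proof.
elim: n x => // n IH; apply: rational_span_image => //.
move=> _ [[a b] /= [a0 Ib] <-]; rewrite free_map_convolution.
by apply: augmentation_power_convolution; rewrite ?augmentation_free_map //;
  exact: IH.
Qed.

Lemma free_map_tensorQ_relations x :
  tensorQ_relations x -> tensorQ_relations (free_map phi x).
Proof.
apply: rational_span_image; first exact: rational_span_subspace.
move=> _ [[a b] _ <-]; rewrite !linearB /= !free_mapU phiM.
by apply: rational_span_incl; exists (phi a, phi b).
Qed.

End GroupMorphism.

Section Outer.
Variable G : groupType.
Local Notation inl1 := (fun g : G => (g, 1%g : G)).
Local Notation inr1 := (fun g : G => (1%g : G, g)).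

HB.instance Definition _ := Bilinear.copy (@outer G G) (bilin (@pair G G)).
HB.instance Definition _ x := GRing.isLinear.Build rat Q[G] Q[(G * G)%type] _
  (@outer G G x) (bilin_linearr (@pair G G) x).

Lemma outerU (a b : G) : outer <|a|> <|b|> = <|(a, b)|>.
Proof. exact: bilinU. Qed.

Lemma outerBl x x' y : @outer G G (x - x') y = outer x y - outer x' y.
Proof. exact: (linearB (applyr (@outer G G) y)). Qed.
Lemma outerBr x y y' : @outer G G x (y - y') = outer x y - outer x y'.
Proof. exact: (linearB (@outer G G x)). Qed.

Lemma outerE x y :
  @outer G G x y = convolution (free_map inl1 x) (free_map inr1 y).
Proof.
refine (@eq_linear_free _ _ (applyr (@outer G G) y)
  (applyr (@convolution (G * G)%type) (free_map inr1 y) \o free_map inl1) _ x) => a.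
refine (@eq_linear_free _ _ (@outer G G <|a|>)
  (convolution (free_map inl1 <|a|>) \o free_map inr1) _ y) => b.
rewrite /= !free_mapU convolutionU outerU; congr (<| _ |>).
transitivity ((a * 1)%g, (1 * b)%g); first by rewrite mulg1 mul1g.
by [].
Qed.

Lemma augmentation_power_outer n (x x' : Q[G]) :
  augmentation_power n (x - x') -> augmentation_power n (outer x x - outer x' x').
Proof.
have inl1M : {morph inl1 : a b / (a * b)%g} by move=> a b;
  rewrite -[in LHS](mulg1 1%g).
have inr1M : {morph inr1 : a b / (a * b)%g} by move=> a b;
  rewrite -[in LHS](mulg1 1%g).
move=> xx'.
have left_diff : augmentation_power n (@outer G G (x - x') x).
  rewrite outerE; apply: augmentation_power_mulr.
  exact: free_map_augmentation_power.
have right_diff : augmentation_power n (@outer G G x' (x - x')).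
  rewrite outerE; apply: augmentation_power_mull.
  exact: free_map_augmentation_power.
move: left_diff right_diff; rewrite outerBl outerBr.
exact: augmentation_power_dist_trans.
Qed.

End Outer.

(** Two out of three for [induces_bijection]. *)
Section InducedBijection.
Variables (A B D : Type) (dA : set A) (dB : set B) (dD : set D).
Variables (eqA : A -> A -> Prop) (eqB : B -> B -> Prop) (eqD : D -> D -> Prop).
Variables (f : A -> B) (g : B -> D).
Hypothesis fB : forall x, dA x -> dB (f x).
Hypothesis gD : forall x, dB x -> dD (g x).
Hypothesis eqB_sym : forall x y, eqB x y -> eqB y x.
Hypothesis eqB_trans : forall x y z, eqB x y -> eqB y z -> eqB x z.
Hypothesis eqD_sym : forall x y, eqD x y -> eqD y x.
Hypothesis eqD_trans : forall x y z, eqD x y -> eqD y z -> eqD x z.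
Hypothesis g_eq : forall x y, eqB x y -> eqD (g x) (g y).

Lemma induces_bijection_comp :
  induces_bijection dA eqA dB eqB f -> induces_bijection dB eqB dD eqD g ->
  induces_bijection dA eqA dD eqD (g \o f).
Proof.
move=> [_ fi fs] [_ gi gs]; split=> [x /fB /gD //|x y dx dy|z dz].
  by apply: iff_trans (fi _ _ dx dy) (gi _ _ (fB dx) (fB dy)).
have [y dy yz] := gs z dz; have [x dx xy] := fs y dy; exists x => //.
exact: eqD_trans (g_eq xy) yz.
Qed.

Lemma induces_bijection_cancell :
  induces_bijection dB eqB dD eqD g -> induces_bijection dA eqA dD eqD (g \o f) ->
  induces_bijection dA eqA dB eqB f.
Proof.
move=> [_ gi gs] [_ fi fs]; split=> // [x y dx dy|y dy].
  exact: iff_trans (fi _ _ dx dy) (iff_sym (gi _ _ (fB dx) (fB dy))).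
have [x dx xy] := fs _ (gD dy); exists x => //; apply/gi => //; exact: fB.
Qed.

Lemma induces_bijection_cancelr :
  induces_bijection dA eqA dB eqB f -> induces_bijection dA eqA dD eqD (g \o f) ->
  induces_bijection dB eqB dD eqD g.
Proof.
move=> [_ fi fs] [_ gi gs]; split=> // [y y' dy dy'|z /gs[x dx xz]]; last first.
  by exists (f x) => //; exact: fB.
have [x dx xy] := fs _ dy; have [x' dx' xy'] := fs _ dy'.
split; first exact: g_eq.
move=> gyy'; have gff := eqD_trans (g_eq xy) (eqD_trans gyy' (eqD_sym (g_eq xy'))).
have ff : eqB (f x) (f x') by apply/(fi _ _ dx dx')/(gi _ _ dx dx').
exact: eqB_trans (eqB_sym xy) (eqB_trans ff xy').
Qed.

End InducedBijection.

Section RationalIsos.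
Variables (G H : groupType).
Implicit Types (phi : G -> H).

Lemma tensorQ_eq_sym (x y : Q[G]) : tensorQ_eq x y -> tensorQ_eq y x.
Proof. by apply: subspace_distC; exact: rational_span_subspace. Qed.

Lemma tensorQ_eq_trans (x y z : Q[G]) :
  tensorQ_eq x y -> tensorQ_eq y z -> tensorQ_eq x z.
Proof. by apply: subspace_dist_trans; exact: rational_span_subspace. Qed.

Lemma completion_eq_sym (x y : nat -> Q[G]) : completion_eq x y -> completion_eq
  y x.
Proof. by move=> xy n; exact: augmentation_power_distC. Qed.

Lemma completion_eq_trans (x y z : nat -> Q[G]) :
  completion_eq x y -> completion_eq y z -> completion_eq x z.
Proof. by move=> xy yz n; exact: augmentation_power_dist_trans (xy n) (yz n). Qed.

Lemma tensorQ_eq_map phi : {morph phi : a b / (a * b)%g} ->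
  forall x y, tensorQ_eq x y -> tensorQ_eq (free_map phi x) (free_map phi y).
Proof. by move=> phiM x y; rewrite /tensorQ_eq -linearB;
  exact: free_map_tensorQ_relations. Qed.

Lemma completion_eq_map phi : {morph phi : a b / (a * b)%g} -> forall x y,
  completion_eq x y -> completion_eq (free_map phi \o x) (free_map phi \o y).
Proof. by move=> phiM x y xy n; rewrite /= -linearB;
  exact: free_map_augmentation_power. Qed.

Local Notation square phi := (fun z : G * G => (phi z.1, phi z.2)).

Lemma free_map_diagonal phi x :
  free_map (fun g => (g, g)) (free_map phi x) =
  free_map (square phi) (free_map (fun g => (g, g)) x).
Proof. by rewrite !free_map_comp. Qed.

Lemma free_map_outer phi x y :
  outer (free_map phi x) (free_map phi y) = free_map (square phi) (outer x y).
Proof.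
refine (@eq_linear_free _ _ (applyr (@outer H H) (free_map phi y) \o free_map phi)
  (free_map (square phi) \o applyr (@outer G G) y) _ x) => a.
refine (@eq_linear_free _ _ (outer (free_map phi <|a|>) \o free_map phi)
  (free_map (square phi) \o outer <|a|>) _ y) => b.
by rewrite /= !(free_mapU, outerU).
Qed.

Lemma square_morph phi : {morph phi : a b / (a * b)%g} ->
  {morph square phi : a b / (a * b)%g}.
Proof. by move=> phiM a b; rewrite /= !phiM. Qed.

Lemma malcev_map phi : {morph phi : a b / (a * b)%g} -> forall x,
  malcev x -> malcev (free_map phi \o x).
Proof.
move=> phiM x [xS x1 xD]; split=> n /=.
- by rewrite -linearB; exact: free_map_augmentation_power.
- by rewrite augmentation_free_map.
- rewrite free_map_diagonal free_map_outer -linearB.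
  by apply: free_map_augmentation_power => //; exact: square_morph.
Qed.

(** Bijectivity at each finite stage Q[G]/I^n passes to sequences.  A preimage of a
   group-like sequence is group-like because the defect of this property lives in
   the group algebra of G * G, where the square of phi is injective on the
   quotients. *)
Lemma malcev_iso_filtered phi : {morph phi : a b / (a * b)%g} ->
  (forall n x, augmentation_power n (free_map phi x) -> augmentation_power n x) ->
  (forall n z, augmentation_power n (free_map (square phi) z) ->
     augmentation_power n z) ->
  (forall n (y : Q[H]), exists x, augmentation_power n (free_map phi x - y)) ->
  malcev_iso phi.
Proof.
move=> phiM phiI phi2I phiS; split=> [x|x y _ _|y [yS y1 yD]].
- exact: malcev_map.
- split; first exact: completion_eq_map.
  by move=> xy n; apply: phiI; rewrite linearB; exact: xy.
have [x xy] := choice (fun n => phiS n (y n)).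
exists x; last exact: xy.
have stage n : augmentation_power n (free_map phi (x n.+1) - y n).
  exact: augmentation_power_dist_trans (augmentation_powerS (xy n.+1)) (yS n).
split=> n.
- apply: phiI; rewrite linearB.
  apply: augmentation_power_dist_trans (stage n) _.
  exact: augmentation_power_distC (xy n).
- have /(augmentation_power_le (ltn0Sn n))/augmentation_power1 := xy n.+1.
  by rewrite linearB /= augmentation_free_map y1 => /eqP; rewrite subr_eq0 => /eqP.
- apply: phi2I; rewrite linearB /= -free_map_diagonal -free_map_outer.
  have := augmentation_power_outer (augmentation_power_distC (xy n)).
  apply: augmentation_power_dist_trans.
  apply: augmentation_power_dist_trans (yD n); rewrite -linearB.
  exact: free_map_augmentation_power.
Qed.

End RationalIsos.

Section PowerMap.
Variables (G : groupType) (d : nat).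
Hypothesis d_gt0 : (0 < d)%N.
Hypothesis powM : {morph (fun g : G => g ^+ d)%g : a b / (a * b)%g}.
Local Notation pow := (free_map (fun g : G => g ^+ d)%g).
Local Notation I := (@augmentation_power G).

Lemma dX_neq0 k : (d ^ k)%:R != 0 :> rat.
Proof. by rewrite pnatr_eq0 expn_eq0 negb_and -lt0n d_gt0. Qed.

(** The power map acts on I/I^2, which is spanned by the g - 1, as multiplication
   by d: the class of gh - 1 is the sum of those of g - 1 and h - 1. *)
Lemma pow_augmentation_ideal x : I 1 x -> I 2 (pow x - d%:R *: x).
Proof.
move=> /augmentation_power1 x0.
have zmodE (V : lmodType rat) (c : rat) (gh g e h : V) :
    gh - e - (c + 1) *: (g - e) = gh - g - (h - e) + (h - e - c *: (g - e)).
  rewrite [RHS]addrA subrK scalerDl scale1r opprD opprB.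
  by rewrite addrCA [gh - e + _]addrA subrK addrC.
have main (g : G) : I 2 (<|(g ^+ d)%g|> - <|1%g|> - d%:R *: (<|g|> - <|1%g|>)).
  elim: d => [|m IH]; first by rewrite expg0 subrr scale0r subr0;
    exact: augmentation_power0.
  pose u := <|g|> - <|1%g|> : Q[G]; pose v := <|(g ^+ m)%g|> - <|1%g|> : Q[G].
  have -> : <|(g ^+ m.+1)%g|> - <|1%g|> - m.+1%:R *: u =
      convolution u v + (v - m%:R *: u).
    rewrite /u /v convolutionBl !convolutionBr !convolutionU !mul1g mulg1 -expgS.
    by rewrite -natr1; exact: zmodE.
  apply: augmentation_powerD => //; apply: augmentation_power_convolution.
    by rewrite /u linearB /= !augmentationU subrr.
  by apply/augmentation_power1; rewrite /v linearB /= !augmentationU subrr.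
have aug0 : x = \sum_(g <- msupp x) mcoeff g x *: (<|g|> - <|1%g|>).
  under eq_bigr do rewrite scalerBr.
  by rewrite sumrB -free_decomp -scaler_suml -/(augmentation x) x0 scale0r subr0.
rewrite aug0 linear_sum scaler_sumr -sumrB.
apply: (subspace_sum (augmentation_power_subspace G 2)) => g _.
rewrite linearZ /= linearB /= !free_mapU expg1n scalerA mulrC -scalerA -scalerBr.
exact: augmentation_powerZ.
Qed.

(** I^k/I^(k+1) is spanned by products of k elements of I, on each of which the
   power map is multiplication by d. *)
Lemma pow_graded k x : I k x -> I k.+1 (pow x - (d ^ k)%:R *: x).
Proof.
elim: k x => [|k IH] x.
  move=> _; apply/augmentation_power1; rewrite expn0 scale1r.
  by rewrite linearB /= augmentation_free_map subrr.
apply: (@rational_span_image _ _ (pow \- (d ^ k.+1)%:R \*: idfun) _ _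
  (augmentation_power_subspace G k.+2)) => {x}.
move=> _ [[x y] /= [x0 Iy] <-];
  rewrite free_map_convolution // expnS natrM -scalerA.
rewrite -convolutionZr -convolutionZl.
have Ix : I 1 x by apply/augmentation_power1.
apply: (@augmentation_power_dist_trans _ _ (convolution (pow x) ((d ^ k)%:R *: y))).
  rewrite -convolutionBr; apply: augmentation_power_convolution; last exact: IH.
  by rewrite augmentation_free_map.
rewrite -convolutionBl; apply: (@augmentation_powerM G 2 k).
  exact: pow_augmentation_ideal.
exact: augmentation_powerZ.
Qed.

(** If x is in I^k and its image, which is d^k x modulo I^(k+1), is in I^(k+1),
   then x is in I^(k+1) too. *)
Lemma pow_strict n x : I n (pow x) -> I n x.
Proof.
move=> In; have main k : (k <= n)%N -> I k x.
  elim: k => // k IH kn; have Ik := IH (ltnW kn).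
  rewrite -[x]scale1r -(mulVf (dX_neq0 k)) -scalerA; apply: subspaceZ => //.
  rewrite -[_ *: x](subKr (pow x)); apply: augmentation_powerB => //;
    last exact: pow_graded.
  exact: augmentation_power_le In.
exact: main.
Qed.

(** An approximation modulo I^n is corrected by d^(-n) times its error. *)
Lemma pow_dense n (y : Q[G]) : exists x, I n (pow x - y).
Proof.
elim: n => [|n [x xy]]; first by exists 0.
exists (x - ((d ^ n)%:R)^-1 *: (pow x - y)).
set z := pow x - y in xy *.
rewrite linearB linearZ /=.
have -> : pow x - (d ^ n)%:R^-1 *: pow z - y =
   - ((d ^ n)%:R^-1 *: (pow z - (d ^ n)%:R *: z)).
  by rewrite scalerBr scalerA mulVf ?dX_neq0 // scale1r opprB addrAC.
by apply: augmentation_powerN; apply: augmentation_powerZ; exact: pow_graded.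
Qed.

Lemma pow_tensorQ x : tensorQ_eq (pow x) (d%:R *: x).
Proof.
have sT := tensorQ_relations_subspace G.
rewrite [x]free_decomp linear_sum scaler_sumr /tensorQ_eq -sumrB.
apply: (subspace_sum sT) => g _;
  rewrite linearZ /= free_mapU scalerA mulrC -scalerA.
rewrite -scalerBr; apply: (subspaceZ sT).
have rel (a b : G) : tensorQ_relations (<|(a * b)%g|> - <|a|> - <|b|>).
  by apply: rational_span_incl; exists (a, b).
elim: d => [|m IH].
  rewrite scale0r subr0 expg0; have := rel 1%g 1%g.
  by rewrite mulg1 subrr sub0r => /(subspaceN sT); rewrite opprK; exact.
rewrite expgS; have := subspaceD sT (rel g (g ^+ m)%g) IH.
by rewrite addrA subrK -natr1 scalerDl scale1r opprD addrA addrAC.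
Qed.

End PowerMap.

(** A notion of isomorphism after rationalization: both [tensorQ_iso] and
   [malcev_iso] are instances, so that the homotopy groups of degree 1 and of
   higher degrees can be treated together. *)
Record rational_notion (E : forall G H : groupType, (G -> H) -> Prop) : Prop := {
  notion_bijective : forall (G H : groupType) (phi : G -> H),
    {morph phi : a b / (a * b)%g} -> bijective phi -> E G H phi;
  notion_power : forall (G : groupType) (d : nat), (0 < d)%N ->
    {morph (fun g : G => g ^+ d)%g : a b / (a * b)%g} ->
    E G G (fun g => g ^+ d)%g;
  notion_comp : forall (G H K : groupType) (phi : G -> H) (psi : H -> K),
    {morph phi : a b / (a * b)%g} -> {morph psi : a b / (a * b)%g} ->
    E G H phi -> E H K psi -> E G K (psi \o phi);
  notion_cancell : forall (G H K : groupType) (phi : G -> H) (psi : H -> K),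
    {morph phi : a b / (a * b)%g} -> {morph psi : a b / (a * b)%g} ->
    E H K psi -> E G K (psi \o phi) -> E G H phi;
  notion_cancelr : forall (G H K : groupType) (phi : G -> H) (psi : H -> K),
    {morph phi : a b / (a * b)%g} -> {morph psi : a b / (a * b)%g} ->
    E G H phi -> E G K (psi \o phi) -> E H K psi }.

Lemma morph_inverse (G H : groupType) (phi : G -> H) (psi : H -> G) :
  {morph phi : a b / (a * b)%g} -> cancel phi psi -> cancel psi phi ->
  {morph psi : a b / (a * b)%g}.
Proof. by move=> phiM phiK psiK a b; apply: (can_inj phiK); rewrite phiM !psiK. Qed.

Lemma tensorQ_notion : rational_notion tensorQ_iso.
Proof.
split.
- move=> G H phi phiM [psi phiK psiK].
  have psiM := morph_inverse phiM phiK psiK.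
  split=> // [x y _ _|y _]; last first.
    exists (free_map psi y) => //; rewrite free_map_comp free_map_id //.
    by rewrite /tensorQ_eq subrr; exact: (tensorQ_relations_subspace _).1.
  split; first exact: tensorQ_eq_map.
  by move=> /(tensorQ_eq_map psiM); rewrite !free_map_comp !free_map_id.
- move=> G d d0 powM; have d0' : d%:R != 0 :> rat by rewrite pnatr_eq0 -lt0n.
  have sT := tensorQ_relations_subspace G.
  split=> // [x y _ _|y _].
    split; first exact: tensorQ_eq_map.
    rewrite /tensorQ_eq -linearB /= => xy.
    rewrite -[x - y]scale1r -(mulVf d0') -scalerA; apply: (subspaceZ sT).
    rewrite -[_ *: _](subKr (free_map (fun g : G => g ^+ d)%g (x - y))).
    by apply: (subspaceB sT) => //; exact: pow_tensorQ.
  exists (d%:R^-1 *: y) => //; apply: tensorQ_eq_trans (pow_tensorQ _ _) _.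
  by rewrite scalerA mulfV // scale1r /tensorQ_eq subrr; exact: sT.1.
- move=> G H K phi psi phiM psiM fE gE.
  have := induces_bijection_comp _ _ (@tensorQ_eq_trans K) (tensorQ_eq_map psiM)
    fE gE.
  rewrite /tensorQ_iso (_ : free_map psi \o free_map phi = free_map (psi \o phi)).
    exact.
  by apply/funext => x; exact: free_map_comp.
- move=> G H K phi psi phiM psiM gE.
  rewrite /tensorQ_iso (_ : free_map (psi \o phi) = free_map psi \o free_map phi).
    by move=> fE; apply: (induces_bijection_cancell _ _ gE fE).
  by apply/funext => x; rewrite /= free_map_comp.
- move=> G H K phi psi phiM psiM gE.
  rewrite /tensorQ_iso (_ : free_map (psi \o phi) = free_map psi \o free_map phi).
    move=> fE; apply: (induces_bijection_cancelr _ _ _ _ _ _ _ gE fE) => //.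
    + exact: tensorQ_eq_sym.
    + exact: tensorQ_eq_trans.
    + exact: tensorQ_eq_sym.
    + exact: tensorQ_eq_trans.
    + exact: tensorQ_eq_map.
  by apply/funext => x; rewrite /= free_map_comp.
Qed.

Lemma malcev_notion : rational_notion malcev_iso.
Proof.
have compE (G H K : groupType) (phi : G -> H) (psi : H -> K) :
    (fun (x : nat -> Q[G]) n => free_map (psi \o phi) (x n)) =
    (fun x n => free_map psi (x n)) \o (fun x n => free_map phi (x n)).
  by apply/funext => x; apply/funext => n; rewrite /= free_map_comp.
split.
- move=> G H phi phiM [psi phiK psiK].
  have strict (A B : groupType) (f : A -> B) (g : B -> A) n x :
      {morph f : a b / (a * b)%g} -> cancel f g -> cancel g f ->
      augmentation_power n (free_map f x) -> augmentation_power n x.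
    move=> fM fK gK /(free_map_augmentation_power (morph_inverse fM fK gK)).
    by rewrite free_map_comp free_map_id.
  apply: malcev_iso_filtered => // [n x|n x|n y].
  + exact: strict.
  + apply: (strict _ _ _ (fun z => (psi z.1, psi z.2))).
    * exact: square_morph.
    * by case=> a b /=; rewrite !phiK.
    * by case=> a b /=; rewrite !psiK.
  + exists (free_map psi y); rewrite free_map_comp free_map_id // subrr.
    exact: (augmentation_power_subspace _ _).1.
- move=> G d d0 powM; apply: malcev_iso_filtered => // [n x|n w|n y].
  + exact: pow_strict.
  + have squareX (z : G * G) : ((z.1 ^+ d, z.2 ^+ d) = z ^+ d)%g.
      by case: z => a b /=; elim: (d) => // m IH; rewrite !expgS -IH.
    rewrite (funext squareX); apply: pow_strict => // a b.
    by rewrite -!squareX; exact: (square_morph powM a b).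
  + exact: pow_dense.
- move=> G H K phi psi phiM psiM fE gE; rewrite /malcev_iso compE.
  apply: (induces_bijection_comp _ _ _ _ fE gE).
  + exact: malcev_map.
  + exact: malcev_map.
  + exact: completion_eq_trans.
  + exact: completion_eq_map.
- move=> G H K phi psi phiM psiM gE; rewrite /malcev_iso compE => fE.
  apply: (induces_bijection_cancell _ _ gE fE); exact: malcev_map.
- move=> G H K phi psi phiM psiM gE; rewrite /malcev_iso compE => fE.
  apply: (induces_bijection_cancelr _ _ _ _ _ _ _ gE fE).
  + exact: malcev_map.
  + exact: malcev_map.
  + exact: completion_eq_sym.
  + exact: completion_eq_trans.
  + exact: completion_eq_sym.
  + exact: completion_eq_trans.
  + exact: completion_eq_map.
Qed.

(** * Change of base point *)

Section BaseChange.
Context {R : realType} {P : topologicalType}.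
Local Notation half := (2^-1 : R).

Lemma sub_cont (T : topologicalType) (f g : T -> R) :
  continuous f -> continuous g -> continuous (fun x => f x - g x).
Proof. by move=> cf cg x; apply: cvgB; [exact: cf|exact: cg]. Qed.
Lemma add_cont (T : topologicalType) (f g : T -> R) :
  continuous f -> continuous g -> continuous (fun x => f x + g x).
Proof. by move=> cf cg x; apply: cvgD; [exact: cf|exact: cg]. Qed.
Lemma mul_cont (T : topologicalType) (f g : T -> R) :
  continuous f -> continuous g -> continuous (fun x => f x * g x).
Proof. by move=> cf cg x; apply: cvgM; [exact: cf|exact: cg]. Qed.

Lemma min_cont (T : topologicalType) (f g : T -> R) :
  continuous f -> continuous g -> continuous (fun x => Num.min (f x) (g x)).
Proof.
by move=> cf cg x; apply: (@continuous_min R T f g x); [exact: cf|exact: cg].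
Qed.

(** The graph of change of base point along gamma.  Unlike a formula for the
   action, this relation is visibly compatible with concatenation, with reversal of
   gamma and with continuous maps. *)
Definition transported n (p q : P) (gamma : R -> P) (f : cube_map R n p)
    (g : cube_map R n q) :=
  exists H : R * 'rV[R]_n -> P,
    [/\ continuous H, forall x, cube R n x -> H (0, x) = f x,
        forall x, cube R n x -> H (1, x) = g x &
        forall t x, 0 <= t <= 1 -> cube_boundary x -> H (t, x) = gamma t].

Lemma row_coord_le_norm n (v : 'rV[R]_n) i : `|v 0 i| <= `|v|.
Proof.
rewrite (_ : `|v| = mx_norm v) // mx_normrE.
exact: (le_bigmax 0 (fun ij : 'I_1 * 'I_n => `|v ij.1 ij.2|) (0, i)).
Qed.

Lemma row_norm_attained n (v : 'rV[R]_n) : `|v| != 0 -> exists i, `|v| = `|v 0 i|.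
Proof.
by move=> /mx_norm_neq0[[i j] vE]; exists j; rewrite -(ord1 i).
Qed.

(** The sup-norm distance to the cube. *)
Definition outside n (y : 'rV[R]_n) : R := `|\row_i (y 0 i - clamp (y 0 i))|.

Lemma outside_cont n : continuous (@outside n).
Proof.
apply: (comp_cont _ (@norm_continuous _ _)); apply: continuous_row => i.
apply: sub_cont; first exact: coord_cont.
exact: (comp_cont (@coord_cont _ _ i) (@clamp_continuous R)).
Qed.

Lemma outside_ge0 n (y : 'rV[R]_n) : 0 <= outside y.
Proof. exact: normr_ge0. Qed.

Lemma outside_cube n (y : 'rV[R]_n) : cube R n y -> outside y = 0.
Proof.
move=> cy; rewrite /outside (_ : \row_i _ = 0) ?normr0 //.
by apply/rowP => i; rewrite !mxE clampK // subrr.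
Qed.

Lemma clamp_eq (s : R) : 0 < clamp s < 1 -> clamp s = s.
Proof.
have [s0|s0] := leP s 0; first by rewrite clamp_le0 // ltxx.
have [s1|s1] := leP 1 s; first by rewrite clamp_ge1 // ltxx andbF.
by move=> _; rewrite clampK // !ltW.
Qed.

Lemma clampv_interior n (y : 'rV[R]_n) :
  ~ cube_boundary (clampv y) -> clampv y = y.
Proof.
move=> nb; apply/rowP => i; rewrite mxE clamp_eq // !lt_neqAle.
have /andP[-> ->] := clamp_itv (y 0 i); rewrite !andbT.
apply/andP; split; apply/eqP => yi; apply: nb; split;
  first [exact: clampv_cube | exists i; rewrite mxE -?yi ?yi; auto].
Qed.

(** Scaling by 2 - s about the center of the cube.  It pushes the boundary out to
   distance (1 - s)/2, which leaves room for a collar ([zoom_boundary]). *)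
Definition zoom (s : R) n (x : 'rV[R]_n) : 'rV[R]_n :=
  \row_i ((2 - s) * (x 0 i - half) + half).

Lemma zoom_cont n (T : topologicalType) (s : T -> R) (x : T -> 'rV[R]_n) :
  continuous s -> continuous x -> continuous (fun z => zoom (s z) (x z)).
Proof.
move=> cs cx; apply: continuous_row => i; apply: add_cont;
  last exact: cst_continuous.
apply: mul_cont; apply: sub_cont; try exact: cst_continuous; first exact: cs.
exact: (comp_cont cx (@coord_cont _ _ i)).
Qed.

Lemma zoom1 n (x : 'rV[R]_n) : zoom 1 x = x.
Proof. by apply/rowP => i; rewrite mxE; lra. Qed.

Lemma zoom_boundary (s : R) n (x : 'rV[R]_n) : 0 <= s <= 1 -> cube_boundary x ->
  cube_boundary (clampv (zoom s x)) /\ 1 - s <= 2 * outside (zoom s x).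
Proof.
move=> s01 [cx [i xi]].
have zi : zoom s x 0 i <= 0 \/ 1 <= zoom s x 0 i.
  by rewrite mxE; case: xi => ->; [left|right]; lra.
split; first by apply: clampv_boundary; exists i.
have := row_coord_le_norm (\row_i (zoom s x 0 i - clamp (zoom s x 0 i))) i.
rewrite -/(outside _).
rewrite !mxE.
case: xi => ->.
  rewrite clamp_le0; last lra.
  rewrite ler_norml; lra.
rewrite clamp_ge1; last lra.
rewrite ler_norml; lra.
Qed.

(** Nonpositive exactly on the cube, and zero exactly on its boundary. *)
Definition cube_side n (y : 'rV[R]_n) : R := `|\row_i (y 0 i - half)| - half.

Lemma cube_side_cont n : continuous (@cube_side n).
Proof.
apply: sub_cont; last exact: cst_continuous.
apply: (comp_cont _ (@norm_continuous _ _)); apply: continuous_row => i.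
by apply: sub_cont; [exact: coord_cont|exact: cst_continuous].
Qed.

Lemma cube_side_le0 n (y : 'rV[R]_n) : cube_side y <= 0 -> cube R n y.
Proof.
move=> y0 i; have := row_coord_le_norm (\row_j (y 0 j - half)) i.
rewrite mxE => yi; have : `|y 0 i - half| <= half by move: y0; rewrite /cube_side;
  lra.
rewrite ler_norml; lra.
Qed.

Lemma cube_side_boundary n (y : 'rV[R]_n) : cube_side y = 0 -> cube_boundary y.
Proof.
move=> y0; have cy : cube R n y by apply: cube_side_le0; rewrite y0.
split=> //.
have yh : `|\row_i (y 0 i - half)| = half by move: y0; rewrite /cube_side; lra.
have yn : `|\row_i (y 0 i - half)| != 0 by rewrite yh; lra.
have [i yi] := row_norm_attained yn.
move: yi; rewrite yh mxE => yi; exists i; have := cy i.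
by move: yi; case: (ger0P (y 0 i - half)) => _ ih _; [right|left]; lra.
Qed.

Lemma cube_side_gt0 n (y : 'rV[R]_n) : 0 < cube_side y -> ~ cube R n y.
Proof.
rewrite /cube_side => y0 cy.
have /row_norm_attained[i yi] : `|\row_i (y 0 i - half)| != 0 by lra.
move: y0; rewrite yi mxE; have := cy i; case: (ger0P (y 0 i - half)) => _; lra.
Qed.

(** The usual picture of the action of a path on a cube: F inside, and gamma along
   the segments that leave the cube. *)
Definition collared n (F : 'rV[R]_n -> P) (gamma : R -> P) (s : R)
    (y : 'rV[R]_n) : P :=
  if cube_side y <= 0 then F y else gamma (Num.min s (2 * outside y)).

Section Collar.
Variables (n : nat) (p q : P) (gamma : R -> P).
Hypothesis gamma_cont : continuous gamma.
Hypothesis gamma0 : gamma 0 = p.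
Hypothesis gamma1 : gamma 1 = q.

Lemma collared_cont (T : topologicalType) (F : T * 'rV[R]_n -> P) (s : T -> R)
    (y : T -> 'rV[R]_n) : continuous F -> continuous s -> continuous y ->
  (forall z, 0 <= s z) -> (forall z x, bdext x -> F (z, x) = p) ->
  continuous (fun z => collared (fun x => F (z, x)) gamma (s z) (y z)).
Proof.
move=> cF cs cy s0 Fb; apply: continuous_paste.
- exact: (comp_cont cy (@cube_side_cont n)).
- by apply: (comp_cont _ cF); apply: pair_cont => // z; exact: cvg_id.
- apply: (comp_cont _ gamma_cont); apply: min_cont; first exact: cs.
  by apply: scale_cont; apply: (comp_cont cy); exact: outside_cont.
- move=> z /cube_side_boundary yb; rewrite Fb; last exact: boundary_bdext.
  by rewrite outside_cube ?mulr0 ?min_r //; case: yb.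
Qed.

Lemma collared_extend_cont (f : cube_map R n p) (T : topologicalType) (s : T -> R)
    (y : T -> 'rV[R]_n) : continuous s -> continuous y -> (forall z, 0 <= s z) ->
  continuous (fun z => collared (extend f) gamma (s z) (y z)).
Proof.
move=> cs cy s0; apply: (collared_cont (F := extend f \o snd)) => //.
  by apply: (comp_cont (@snd_cont _ _)); exact: extend_continuous.
by move=> z x; exact: extend_bd.
Qed.

Lemma collared_boundary (F : 'rV[R]_n -> P) (s : R) (x : 'rV[R]_n) :
  (forall x, bdext x -> F x = p) ->
  0 <= s <= 1 -> cube_boundary x -> collared F gamma s (zoom (1 - s) x) = gamma s.
Proof.
move=> Fb s01 bx; have [|bz zo] := zoom_boundary (s := 1 - s) _ bx; first lra.
rewrite /collared; case: ifP => [/cube_side_le0 cz|_]; last by rewrite min_l //;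
  lra.
have s0 : s = 0 by move: zo; rewrite outside_cube //; lra.
by rewrite s0 gamma0 Fb //; apply: boundary_bdext; rewrite clampvK // s0 in bz *.
Qed.

Fact collared_within (f : cube_map R n p) :
  {within cube R n, continuous (fun x => collared (extend f) gamma 1 (zoom 0 x))}.
Proof.
apply: continuous_subspaceT; apply: collared_extend_cont => //;
  try exact: cst_continuous.
by apply: zoom_cont; [exact: cst_continuous|move=> x; exact: cvg_id].
Qed.

Fact collared_based (f : cube_map R n p) x :
  cube_boundary x -> collared (extend f) gamma 1 (zoom 0 x) = q.
Proof.
move=> bx; rewrite -gamma1 -(@collared_boundary (extend f) 1 x) ?subrr ?ler01
  ?lexx //.
exact: extend_bd.
Qed.

Definition transport (f : cube_map R n p) : cube_map R n q :=
  CubeMap (@collared_within f) (@collared_based f).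

Lemma transportP (f : cube_map R n p) : transported gamma f (transport f).
Proof.
exists (fun z => collared (extend f) gamma (clamp z.1) (zoom (1 - clamp z.1) z.2)).
have cc : continuous (fun z : R * 'rV[R]_n => clamp z.1).
  by apply: (comp_cont (@fst_cont _ _)); exact: clamp_continuous.
split=> /=.
- apply: collared_extend_cont => //; last by move=> z;
  have /andP[] := clamp_itv z.1.
  by apply: zoom_cont; [exact: onem_cont|exact: snd_cont].
- move=> x cx; rewrite clamp_le0 // subr0 zoom1 /collared.
  by case: ifP => [_|/negbT]; [exact: extendE|rewrite -ltNge => /cube_side_gt0].
- by move=> x cx; rewrite clamp_ge1 // subrr.
- by move=> t x t01 bx; rewrite clampK //; apply: collared_boundary => //;
  exact: extend_bd.
Qed.

(** Any homotopy along gamma ends at [transport], up to a homotopy that keeps the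
   boundary fixed: at time s the collar carries the part of gamma after s. *)
Lemma transported_transport (f : cube_map R n p) (g : cube_map R n q) :
  transported gamma f g -> homotopic (transport f) g.
Proof.
move=> [H [cH H0 H1 Hb]].
pose K (z : R * 'rV[R]_n) :=
  H (clamp (z.1 + 2 * outside (zoom z.1 z.2)), clampv (zoom z.1 z.2)).
have cz : continuous (fun z : R * 'rV[R]_n => zoom z.1 z.2).
  by apply: zoom_cont; [exact: fst_cont|exact: snd_cont].
apply: (@homotopicI _ _ _ _ _ _ K).
- apply: (comp_cont _ cH); apply: pair_cont; last first.
    by apply: (comp_cont cz); exact: clampv_continuous.
  apply: (comp_cont _ (@clamp_continuous R)); apply: add_cont;
    first exact: fst_cont.
  by apply: scale_cont; apply: (comp_cont cz); exact: outside_cont.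
- move=> x cx; rewrite /K /= add0r /collared; set y := zoom 0 x.
  case: ifP => [/cube_side_le0 cy|/negbT].
    by rewrite outside_cube // mulr0 clamp_le0 // clampvK // H0 // extendE.
  rewrite -ltNge => /cube_side_gt0 ncy.
  have by_ : cube_boundary (clampv y).
    by apply: contrapT => /clampv_interior yE; apply: ncy; rewrite -yE;
      exact: clampv_cube.
  rewrite Hb ?clamp_itv //; congr gamma; rewrite /clamp max_r //.
  by rewrite le_min ler01 mulr_ge0 // outside_ge0.
- move=> x cx; rewrite /K /= zoom1 outside_cube // mulr0 addr0 clamp_ge1 //.
  by rewrite clampvK // H1.
- move=> t x t01 bx; have [bz zo] := zoom_boundary t01 bx.
  by rewrite /K /= clamp_ge1; [rewrite H1; [exact: cube_fun_boundary|case: bz]|lra].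
Qed.

Lemma homotopic_transport (f f' : cube_map R n p) :
  homotopic f f' -> homotopic (transport f) (transport f').
Proof.
move=> /homotopicE[H [cH H0 H1 Hb]].
apply: (@homotopicI _ _ _ _ _ _
  (fun z => collared (fun y => H (z.1, y)) gamma 1 (zoom 0 z.2))).
- pose F (z : (R * 'rV[R]_n) * 'rV[R]_n) := H (z.1.1, z.2).
  apply: (@collared_cont _ F) => //; try exact: cst_continuous; last first.
  + by move=> z x; exact: Hb.
  + by apply: zoom_cont; [exact: cst_continuous|exact: snd_cont].
  apply: (comp_cont _ cH); apply: pair_cont; last exact: snd_cont.
  exact: (comp_cont (@fst_cont _ _) (@fst_cont _ _)).
- by move=> x cx; rewrite /= /collared H0.
- by move=> x cx; rewrite /= /collared H1.
- move=> t x t01 bx; rewrite -gamma1 -(@collared_boundary (fun y => H (t, y)) 1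
  x) //=.
  + by rewrite subrr.
  + exact: Hb.
  + by rewrite ler01 lexx.
Qed.

End Collar.

Lemma transported_rev n (p q : P) (gamma : R -> P) (f : cube_map R n p)
    (g : cube_map R n q) :
  transported gamma f g -> transported (fun t => gamma (1 - t)) g f.
Proof.
move=> [H [cH H0 H1 Hb]]; exists (H \o (fun z => (1 - z.1, z.2))); split.
- apply: (comp_cont _ cH); apply: pair_cont; last exact: snd_cont.
  by apply: onem_cont; exact: fst_cont.
- by move=> x cx; rewrite /= subr0 H1.
- by move=> x cx; rewrite /= subrr H0.
- by move=> t x t01 bx; rewrite /= Hb //; lra.
Qed.

(** At each time the two homotopies can be concatenated, as both are constant, with
   value gamma t, on the common face. *)
Lemma transported_concat n (p q : P) (gamma : R -> P)
    (f f' : cube_map R n.+1 p) (g g' : cube_map R n.+1 q) :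
  transported gamma f g -> transported gamma f' g' ->
  transported gamma (concat f f') (concat g g').
Proof.
move=> [H [cH H0 H1 Hb]] [K [cK K0 K1 Kb]].
pose tame (L : R * 'rV[R]_n.+1 -> P) z := L (clamp z.1, clampv z.2).
have tame_cont L : continuous L -> continuous (tame L).
  move=> cL; apply: (comp_cont _ cL); apply: pair_cont.
    by apply: (comp_cont (@fst_cont _ _)); exact: clamp_continuous.
  by apply: (comp_cont (@snd_cont _ _)); exact: clampv_continuous.
have cc : continuous (fun z : R * 'rV[R]_n.+1 => z.2 0 ord0).
  exact: (comp_cont (@snd_cont _ _) (@coord_cont _ _ ord0)).
have bd s (x : 'rV[R]_n.+1) : s = 0 \/ s = 1 -> cube_boundary (clampv (upd s x)).
  by move=> s01; apply: clampv_boundary; exists ord0; rewrite upd0; lra.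
exists (fun z => conc (fun y => tame H (z.1, y)) (fun y => tame K (z.1, y)) z.2).
split.
- apply: continuous_paste => //.
  + apply: (comp_cont _ (tame_cont _ cH)); apply: pair_cont; first exact: fst_cont.
    by apply: upd_cont; [exact: scale_cont|exact: snd_cont].
  + apply: (comp_cont _ (tame_cont _ cK)); apply: pair_cont; first exact: fst_cont.
    by apply: upd_cont; [exact: affine_cont|exact: snd_cont].
  + move=> [t x] /= ->; rewrite /tame /= Hb ?Kb ?clamp_itv //; apply: bd; lra.
- move=> x cx; apply: eq_conc; last by rewrite inE.
  + by move=> y; rewrite inE => cy; rewrite /tame /= clamp_le0 // clampvK // H0.
  + by move=> y; rewrite inE => cy; rewrite /tame /= clamp_le0 // clampvK // K0.
- move=> x cx; apply: eq_conc; last by rewrite inE.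
  + by move=> y; rewrite inE => cy; rewrite /tame /= clamp_ge1 // clampvK // H1.
  + by move=> y; rewrite inE => cy; rewrite /tame /= clamp_ge1 // clampvK // K1.
- move=> t x t01 /boundary_bdext bx.
  apply: (@conc_bd _ _ (gamma t)) => // y yb; rewrite /tame /= clampK //.
    by apply: Hb => //; exact: clampv_boundary.
  by apply: Kb => //; exact: clampv_boundary.
Qed.

Section BaseChangeIso.
Variables (n : nat) (p q : P) (gamma : R -> P).
Hypothesis gamma_cont : continuous gamma.
Hypothesis gamma0 : gamma 0 = p.
Hypothesis gamma1 : gamma 1 = q.

Definition base_change (a : homotopy_group R n p) : homotopy_group R n q :=
  homotopy_class (transport gamma_cont gamma0 gamma1 (repr a)).

Lemma base_changeE f g : transported gamma f g ->
  base_change (homotopy_class f) = homotopy_class g.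
Proof.
move=> fg; apply/homotopy_classP.
apply: homotopic_trans (transported_transport gamma_cont gamma0 gamma1 fg).
by apply: homotopic_transport; apply/homotopy_classP; rewrite homotopy_class_repr.
Qed.

End BaseChangeIso.

Lemma base_change_bij n (p q : P) (gamma : R -> P) (gamma_cont : continuous gamma)
    (gamma0 : gamma 0 = p) (gamma1 : gamma 1 = q) :
  bijective (@base_change n p q gamma gamma_cont gamma0 gamma1).
Proof.
have rcont : continuous (fun t : R => gamma (1 - t)).
  by apply: (comp_cont _ gamma_cont); apply: onem_cont => t; exact: cvg_id.
have r0 : gamma (1 - 0) = q by rewrite subr0.
have r1 : gamma (1 - 1) = p by rewrite subrr.
exists (base_change rcont r0 r1); elim/(@pi_ind R)=> f.
  have fg := transportP gamma_cont gamma0 gamma1 f.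
  rewrite (base_changeE gamma_cont gamma0 gamma1 fg).
  by rewrite (base_changeE rcont r0 r1 (transported_rev fg)).
have fg := transportP rcont r0 r1 f.
rewrite (base_changeE rcont r0 r1 fg).
apply: base_changeE; have := transported_rev fg.
by rewrite (_ : (fun t => _) = gamma) //; apply/funext => t; congr gamma; lra.
Qed.

Lemma base_changeM n (p q : P) (gamma : R -> P) (gamma_cont : continuous gamma)
    (gamma0 : gamma 0 = p) (gamma1 : gamma 1 = q) :
  {morph @base_change n.+1 p q gamma gamma_cont gamma0 gamma1 : a b / (a * b)%g}.
Proof.
elim/(@pi_ind R)=> f; elim/(@pi_ind R)=> g.
have ft := transportP gamma_cont gamma0 gamma1 f.
have gt := transportP gamma_cont gamma0 gamma1 g.
rewrite (base_changeE _ _ _ ft) (base_changeE _ _ _ gt).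
rewrite (_ : (homotopy_class f * _)%g = homotopy_class (concat f g));
  last exact: pi_mulE.
rewrite (base_changeE _ _ _ (transported_concat ft gt)).
by symmetry; exact: pi_mulE.
Qed.

End BaseChange.

Definition homotopic_maps {R : realType} (P Q : topologicalType) (phi psi : P ->
  Q) :=
  exists H : R * P -> Q,
    [/\ continuous H, forall x, H (0, x) = phi x & forall x, H (1, x) = psi x].

Section Induced.
Context {R : realType}.

Lemma homotopy_group_map_id n (P : topologicalType) (idc : continuous (@id P))
    (p : P) (a : homotopy_group R n p) : homotopy_group_map idc a = a.
Proof.
by elim/(@pi_ind R): a => f; rewrite homotopy_group_mapE; apply/homotopy_classP;
  exact: homotopic_eq.
Qed.

Lemma homotopy_group_map_comp n (P Q S : topologicalType) (phi : P -> Q) (psi : Q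
  -> S)
    (cphi : continuous phi) (cpsi : continuous psi) (c : continuous (psi \o phi))
    (p : P) : @homotopy_group_map R _ _ _ c n p =
      @homotopy_group_map R _ _ _ cpsi n (phi p) \o @homotopy_group_map R _ _ _
        cphi n p.
Proof.
apply/funext; elim/(@pi_ind R)=> f /=; rewrite !homotopy_group_mapE.
by apply/homotopy_classP; exact: homotopic_eq.
Qed.

Section Homotopy.
Variables (P Q : topologicalType) (phi psi : P -> Q).
Variables (cphi : continuous phi) (cpsi : continuous psi).
Variables (H : R * P -> Q) (cH : continuous H).
Hypotheses (H0 : forall x, H (0, x) = phi x) (H1 : forall x, H (1, x) = psi x).

Let track_cont p : continuous (fun t => H (t, p)).
Proof.
apply: (comp_cont _ cH); apply: pair_cont; first by move=> x; exact: cvg_id.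
exact: cst_continuous.
Qed.

(** The homotopy composed with a cube carries it along the track of the base
   point. *)
Lemma homotopy_group_map_homotopic n (p : P) :
  @homotopy_group_map R _ _ _ cpsi n p =
  base_change (@track_cont p) (H0 p) (H1 p) \o @homotopy_group_map R _ _ _ cphi n p.
Proof.
apply/funext; elim/(@pi_ind R)=> f /=; rewrite !homotopy_group_mapE.
symmetry; apply: base_changeE.
exists (H \o (fun z => (z.1, extend f z.2))); split.
- apply: (comp_cont _ cH); apply: pair_cont; first exact: fst_cont.
  by apply: (comp_cont (@snd_cont _ _)); exact: extend_continuous.
- by move=> x cx; rewrite /= extendE // H0.
- by move=> x cx; rewrite /= extendE // H1.
- by move=> t x t01 bx; rewrite /= extend_bd //; exact: boundary_bdext.
Qed.
End Homotopy.

Lemma homotopy_group_map_path n (P Q : topologicalType) (phi : P -> Q)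
    (cphi : continuous phi) (p q : P) (gamma : R -> P) (cgamma : continuous gamma)
    (gamma0 : gamma 0 = p) (gamma1 : gamma 1 = q)
    (c : continuous (phi \o gamma)) (c0 : (phi \o gamma) 0 = phi p)
    (c1 : (phi \o gamma) 1 = phi q) :
  @homotopy_group_map R _ _ _ cphi n q \o base_change cgamma gamma0 gamma1 =
  base_change c c0 c1 \o @homotopy_group_map R _ _ _ cphi n p.
Proof.
apply/funext; elim/(@pi_ind R)=> f /=.
have [K [cK K0 K1 Kb]] := transportP cgamma gamma0 gamma1 f.
have ft : transported gamma f (transport cgamma gamma0 gamma1 f) by exists K.
rewrite (base_changeE _ _ _ ft) !homotopy_group_mapE; symmetry; apply: base_changeE.
exists (phi \o K); split.
- exact: comp_cont.
- by move=> x cx; rewrite /= K0.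
- by move=> x cx; rewrite [LHS]/= K1.
- by move=> t x t01 bx; rewrite /= Kb.
Qed.

Section Notion.
Variable E : forall G H : groupType, (G -> H) -> Prop.
Hypothesis EP : rational_notion E.

(** The quantification over continuity proofs makes it possible to rewrite phi. *)
Definition induces n (P Q : topologicalType) (phi : P -> Q) (p : P) :=
  forall c : continuous phi, E (@homotopy_group_map R P Q phi c n.+1 p).

Lemma induces_comp n (P Q S : topologicalType) (phi : P -> Q) (psi : Q -> S) p :
  continuous phi -> continuous psi ->
  induces n phi p -> induces n psi (phi p) -> induces n (psi \o phi) p.
Proof.
move=> cphi cpsi i j c; rewrite (homotopy_group_map_comp _ cphi cpsi c).
by apply: (notion_comp EP);
  [exact: homotopy_group_mapM|exact: homotopy_group_mapM| |].
Qed.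

Lemma induces_cancell n (P Q S : topologicalType) (phi : P -> Q) (psi : Q -> S) p :
  continuous phi -> continuous psi ->
  induces n psi (phi p) -> induces n (psi \o phi) p -> induces n phi p.
Proof.
move=> cphi cpsi i j c; have := j (comp_cont cphi cpsi).
rewrite (homotopy_group_map_comp _ c cpsi).
by apply: (notion_cancell EP);
  [exact: homotopy_group_mapM|exact: homotopy_group_mapM|].
Qed.

Lemma induces_cancelr n (P Q S : topologicalType) (phi : P -> Q) (psi : Q -> S) p :
  continuous phi -> continuous psi ->
  induces n phi p -> induces n (psi \o phi) p -> induces n psi (phi p).
Proof.
move=> cphi cpsi i j c; have := j (comp_cont cphi cpsi).
rewrite (homotopy_group_map_comp _ cphi c).
by apply: (notion_cancelr EP);
  [exact: homotopy_group_mapM|exact: homotopy_group_mapM|].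
Qed.

Lemma induces_homotopic n (P Q : topologicalType) (phi psi : P -> Q) p :
  continuous phi -> continuous psi -> @homotopic_maps R P Q phi psi ->
  induces n psi p -> induces n phi p.
Proof.
move=> cphi cpsi [H [cH H0 H1]] /(_ cpsi);
  rewrite (homotopy_group_map_homotopic cphi cpsi cH H0 H1).
move=> i c; rewrite (_ : c = cphi); last exact: Prop_irrelevance.
apply: (notion_cancell EP) i; [exact: homotopy_group_mapM|exact: base_changeM|].
by apply: (notion_bijective EP); [exact: base_changeM|exact: base_change_bij].
Qed.

Lemma induces_path n (P Q : topologicalType) (phi : P -> Q) p q :
  continuous phi -> (exists gamma : R -> P, [/\ continuous gamma, gamma 0 = p &
    gamma 1 = q]) ->
  induces n phi p -> induces n phi q.
Proof.
move=> cphi [gamma [cg g0 g1]] i c.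
have c' := comp_cont cg cphi.
have c0 : (phi \o gamma) 0 = phi p by rewrite /= g0.
have c1 : (phi \o gamma) 1 = phi q by rewrite /= g1.
apply: (notion_cancelr EP (phi := base_change cg g0 g1)).
- exact: base_changeM.
- exact: homotopy_group_mapM.
- by apply: (notion_bijective EP); [exact: base_changeM|exact: base_change_bij].
rewrite (homotopy_group_map_path _ c cg g0 g1 c' c0 c1).
apply: (notion_comp EP); [exact: homotopy_group_mapM|exact: base_changeM|exact: i|].
by apply: (notion_bijective EP); [exact: base_changeM|exact: base_change_bij].
Qed.

End Notion.

Lemma homotopic_id_bij n (P : topologicalType) (phi : P -> P) (c : continuous
  phi) p :
  @homotopic_maps R P P phi id -> bijective (@homotopy_group_map R P P phi c n p).
Proof.
move=> [H [cH H0 H1]]; have idc : continuous (@id P) by move=> x; exact: cvg_id.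
have E := homotopy_group_map_homotopic c idc cH H0 H1 n p.
set b := base_change _ _ _ in E; have bbij : bijective b by exact: base_change_bij.
have [b' bK b'K] := bbij.
exists b => a; first by have := congr1 (@^~ a) E; rewrite homotopy_group_map_id.
by apply: (can_inj bK); have := congr1 (@^~ (b a)) E; rewrite homotopy_group_map_id.
Qed.

(** The composites induce bijections at all base points, although they move them:
   so psi induces a bijection at phi p, and then phi at p. *)
Lemma homotopy_equivalence_bij n (P Q : topologicalType) (phi : P -> Q) (psi : Q
  -> P)
    (cphi : continuous phi) (cpsi : continuous psi) p :
  @homotopic_maps R P P (psi \o phi) id -> @homotopic_maps R Q Q (phi \o psi) id ->
  bijective (@homotopy_group_map R P Q phi cphi n p).
Proof.
move=> h1 h2.
have := homotopic_id_bij n (comp_cont cphi cpsi) p h1.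
have := homotopic_id_bij n (comp_cont cpsi cphi) (phi p) h2.
rewrite (homotopy_group_map_comp _ cphi cpsi) (homotopy_group_map_comp _ cpsi cphi).
set f := @homotopy_group_map R _ _ _ cphi n p.
set g := @homotopy_group_map R _ _ _ cpsi n (phi p).
set f' := @homotopy_group_map R _ _ _ cphi n (psi (phi p)).
move=> [h hK _] [k kK Kk]; exists (k \o g) => a; first exact: kK.
apply: (can_inj (g := h \o f')) => [b|]; first exact: hK.
by have := Kk (g a); rewrite /= => ->.
Qed.

End Induced.

(** * The topology of the projective line *)

Section Line.
Context {R : realType}.
Local Notation C := (complex R).
Local Notation CP1 := (CP1 R).

Definition box (M : R) : set C^o :=
  [set z | `|complex.Re z| <= M /\ `|complex.Im z| <= M].

Lemma box_compact M : compact (box M).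
Proof.
pose I : set R := [set t | t \in `[- M, M]].
have -> : box M = (fun u : R * R => Complex u.1 u.2 : C^o) @` (I `*` I).
  apply/seteqP; split=> [[a b] [/= aM bM]|_ [[a b] [/= aM bM] <-]].
    by exists (a, b) => //; split; rewrite /I /= in_itv /= -ler_norml.
  by split; rewrite /= ler_norml; [move: aM|move: bM]; rewrite /I /= in_itv.
apply: continuous_compact; last by apply: compact_setX; exact: segment_compact.
apply: continuous_subspaceT => u; apply: complex_continuous.
  exact: cvg_fst.
exact: cvg_snd.
Qed.

Lemma C_hausdorff : hausdorff_space C^o.
Proof. exact: norm_hausdorff. Qed.

Lemma C_locally_compact : locally_compact [set: C^o].
Proof.
move=> z _; pose M := `|complex.Re z| + `|complex.Im z| + 1.
exists (box M); last by split; [|apply: compact_closed; [exact: C_hausdorff|]];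
  exact: box_compact.
rewrite withinET.
have near_lt (f : C^o -> R) : continuous f -> `|f z| < M ->
    nbhs z [set w | `|f w| < M].
  move=> cf fz; exact: (comp_cont cf (@norm_continuous _ R^o) (lt_nbhsl fz)).
have := near_lt _ (@Im_continuous R) _; have := near_lt _ (@Re_continuous R) _.
have a0 := normr_ge0 (complex.Re z); have b0 := normr_ge0 (complex.Im z).
move=> /(_ ltac:(rewrite /M; lra)) nRe /(_ ltac:(rewrite /M; lra)) nIm.
by apply: filterS2 nRe nIm => w /= /ltW ? /ltW ?.
Qed.

Lemma CP1_hausdorff : hausdorff_space CP1.
Proof. exact: (one_point_compactification_hausdorff C_locally_compact
  C_hausdorff). Qed.

Lemma CP1_locally_compact : locally_compact [set: CP1].
Proof.
move=> z _; exists setT; first exact: filterT.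
by split; [exact: one_point_compactification_compact|exact: closedT].
Qed.

(** Compact sets of the plane are bounded, and closed squares are compact. *)
Lemma nbhs_infinity (U : set CP1) :
  nbhs (None : CP1) U <->
  U None /\ exists M : R, forall w : C, M < `|complex.Re w| \/ M < `|complex.Im
    w| -> U (Some w).
Proof.
split=> [[W [cW _] WU]|[UN [M MU]]].
  split; first by apply: WU; right.
  have [M _ HM] := compact_ReIm cW; exists M => w wM; apply: WU; left;
    exists w => //.
  by move=> /HM /=; lra.
exists (box M); first by split; [|apply: compact_closed; [exact: C_hausdorff|]];
  exact: box_compact.
move=> z [[w /= nw <-]|/= ->//]; apply: MU.
have [?|Re_le] := ltP M `|complex.Re w|; first by left.
have [?|Im_le] := ltP M `|complex.Im w|; first by right.
by case: nw.
Qed.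

(** ** The cube covers the line *)

(** The root between 0 and 1 of t s^2 + (2 - t) s - 1, in a form that makes sense
   for t = 0 as well. *)
Definition unstretch (t : R) : R := 2 / (2 - t + Num.sqrt (t ^+ 2 + 4)).

Lemma unstretchK t : 0 < unstretch t < 1 /\ stretch (unstretch t) = t.
Proof.
have q2 : Num.sqrt (t ^+ 2 + 4) ^+ 2 = t ^+ 2 + 4.
  by rewrite sqr_sqrtr // addr_ge0 ?sqr_ge0.
have q0 : 0 <= Num.sqrt (t ^+ 2 + 4) by exact: sqrtr_ge0.
rewrite /unstretch; set q := Num.sqrt _ in q2 q0 *.
have tq : t < q by nra.
have tq' : - t < q by nra.
set v := 2 - t + q; have v2 : 2 < v by rewrite /v; lra.
have v0 : v != 0 by lra.
have v2' : v - 2 != 0 by lra.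
split; first by rewrite divr_gt0 ?ltr_pdivrMr ?mul1r //; lra.
rewrite /stretch (_ : 1 - 2 / v = (v - 2) / v); last by field.
rewrite !invf_div.
have : t * (v - 2) * 2 = 2 * v - (v - 2) * v by rewrite /v; nra.
move=> e; apply: (mulIf v2'); apply: (@mulIf _ 2); first by lra.
rewrite e; field.
by [].
Qed.

Lemma stretch_inj (s s' : R) : 0 < s < 1 -> 0 < s' < 1 -> stretch s = stretch s'
  -> s = s'.
Proof.
wlog ss' : s s' / s <= s'.
  move=> main s01 s01' e; have [ss'|/ltW ss'] := leP s s'; first exact: main.
  by symmetry; apply: main.
move=> /andP[s0 s1] /andP[s0' s1']; rewrite /stretch => e.
apply/eqP; rewrite eq_le ss' /= leNgt; apply/negP => lt.
have : (1 - s)^-1 < (1 - s')^-1 by rewrite ltf_pV2 ?posrE; lra.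
have : s'^-1 < s^-1 by rewrite ltf_pV2 ?posrE; lra.
lra.
Qed.

Lemma ord2P (i : 'I_2) : i = ord0 \/ i = ord_max.
Proof. by case: i => -[|[|//]] ?; [left|right]; apply/val_inj. Qed.

Lemma collapse_surj (z : CP1) : exists2 x : 'rV[R]_2, cube R 2 x & collapse x = z.
Proof.
case: z => [[a b]|].
  have [ua ea] := unstretchK a; have [ub eb] := unstretchK b.
  exists (\row_i if i == ord0 then unstretch a else unstretch b).
    by move=> i; rewrite mxE; case: ifP => _; lra.
  by rewrite /collapse !mxE /= ua ub ea eb.
exists 0; first by move=> i; rewrite mxE lexx ler01.
by rewrite /collapse mxE ltxx.
Qed.

Lemma collapse_bdext (x : 'rV[R]_2) : bdext x -> collapse x = None.
Proof.
move=> [i xi]; rewrite /collapse; case: ifP => // /andP[x0 x1]; exfalso.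
by have [iE|iE] := ord2P i; rewrite iE in xi; lra.
Qed.

Lemma collapse_eq (x y : 'rV[R]_2) : cube R 2 x -> cube R 2 y ->
  collapse x = collapse y -> x = y \/ (cube_boundary x /\ cube_boundary y).
Proof.
have out (u : 'rV[R]_2) : cube R 2 u -> (0 < u 0 ord0 < 1) && (0 < u 0 ord_max <
  1) = false ->
    cube_boundary u.
  move=> cu /negbT; rewrite negb_and => u01; split=> //.
  by case/orP: u01 => h; [exists ord0; have := cu ord0|exists ord_max;
    have := cu ord_max]; lra.
move=> cx cy; rewrite /collapse; case: ifP => [/andP[x0 x1]|/(out x cx) bx];
  case: ifP => [/andP[y0 y1]|/(out y cy) by_] //; last by right.
move=> [] e0 e1; left; apply/rowP => i; have [->|->] := ord2P i; exact: stretch_inj.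
Qed.

(** A set-theoretic section is enough: continuity comes from
   [descend_continuous]. *)
Definition section (z : CP1) : 'rV[R]_2 := sval (cid2 (collapse_surj z)).
Lemma section_cube z : cube R 2 (section z).
Proof. by rewrite /section; case: cid2. Qed.
Lemma sectionK z : collapse (section z) = z.
Proof. by rewrite /section; case: cid2. Qed.

(** [collapse] is a quotient map, being a continuous surjection from a compact space
   to a Hausdorff one; the compactness argument allows an extra parameter t. *)
Lemma descend_continuous (T X : topologicalType) (x0 : X) (A : T * 'rV[R]_2 -> X) :
  continuous A -> (forall t x, cube_boundary x -> A (t, x) = x0) ->
  continuous (fun u : T * CP1 => A (u.1, section u.2)).
Proof.
move=> cA Ab [t z] U; set K := fun u => _; rewrite {1}/K /= => nU.
suff : nbhs (t, z) (K @^-1` U) by [].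
have cc : compact (cube R 2).
  have -> : cube R 2 = [set v | forall i, [set s : R | s \in `[0, 1]] (v ord0 i)].
    by apply/seteqP; split=> v cv i; have := cv i; rewrite /= in_itv.
  apply: (@rV_compact R 2 (fun=> [set s : R | s \in `[0, 1]])) => i.
  exact: (@segment_compact R 0 1).
move/compact_near_coveringP : cc => /(_ _ (nbhs (t, z))
  (fun u x => section u.2 = x -> U (A (u.1, x))) _) ncov.
have : \forall u \near (t, z), cube R 2 `<=` (fun x => section u.2 = x -> U (A
  (u.1, x))).
  apply: ncov => x cx.
  have [xz|xz] := pselect (collapse x = z); last first.
    have [[V W] /= [Vx Wz] VW] : exists2 VW : set CP1 * set CP1,
        nbhs (collapse x) VW.1 /\ nbhs z VW.2 & VW.1 `&` VW.2 = set0.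
      have := CP1_hausdorff; rewrite open_hausdorff => /(_ _ _ (introN eqP xz)).
      move=> [[V W] /= [xV zW] [oV oW VW]]; exists (V, W); last exact/eqP.
      rewrite !inE in xV zW.
      by split; apply: open_nbhs_nbhs; split.
    have nV := collapse_continuous (x := x) Vx.
    have nW : nbhs (t, z) [set u : T * CP1 | W u.2] by exact: (cvg_snd Wz).
    exists (@collapse R @^-1` V, [set u | W u.2]) => //= -[y [s w]] /= [Vy Ww] wy.
    have : (V `&` W) w by split=> //; rewrite -(sectionK w) wy.
    by rewrite VW.
  have Ax : A (t, x) = A (t, section z).
    rewrite -(sectionK z) in xz.
    by have [->//|[bx bz]] := collapse_eq cx (section_cube z) xz; rewrite !Ab.
  have : nbhs (t, x) (A @^-1` U) by apply: cA; rewrite Ax.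
  move=> [[V W] /= [Vt Wx] VW].
  exists (W, [set u : T * CP1 | V u.1]); first by split=> //; exact: (cvg_fst Vt).
  by move=> -[y [s w]] /= [Wy Vs] _; exact: (VW (s, y)).
by apply: filterS => -[s w] /= H; apply: (H (section w) (section_cube w)).
Qed.

End Line.

(** * Spaces of based maps from the line *)

Lemma val_continuous (T : topologicalType) (A : set T) :
  continuous (val : A -> T).
Proof. exact: initial_continuous. Qed.

Lemma to_subspace_continuous (S T : topologicalType) (A : set T) (phi : S -> A) :
  continuous (val \o phi) -> continuous phi.
Proof. exact: continuous_comp_initial. Qed.

Section Evaluation.
Context {R : realType} {X : topologicalType}.
Variable B : set {compact-open, CP1 R -> X}.

Lemma to_maps_continuous (T : topologicalType) (alpha : T -> B) :
  continuous (fun u : T * CP1 R => val (alpha u.1) u.2) -> continuous alpha.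
Proof.
move=> c; apply: to_subspace_continuous.
exact: (continuous_curry_fun c).
Qed.

Lemma from_maps_continuous (T : topologicalType) (alpha : T -> B) :
  (forall f, B f -> continuous (f : CP1 R -> X)) ->
  continuous alpha -> continuous (fun u : T * CP1 R => val (alpha u.1) u.2).
Proof.
move=> Bc c.
have c1 := comp_cont c (@val_continuous _ B).
have c2 t : continuous (val (alpha t) : CP1 R -> X) by apply: Bc; exact: set_valP.
have := continuous_uncurry CP1_locally_compact CP1_hausdorff c1 c2.
by rewrite (_ : uncurry _ = (fun u : T * CP1 R => val (alpha u.1) u.2)) //;
  apply/funext => -[].
Qed.
End Evaluation.

Section BasedMaps.
Context {R : realType} (X : topologicalType) (x0 : X).
Local Notation CP1 := (CP1 R).

Definition based : set {compact-open, CP1 -> X} :=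
  [set f | continuous (f : CP1 -> X) /\ f None = x0].

Lemma based_cont (f : based) : continuous (val f : CP1 -> X).
Proof. by have [] := set_valP f. Qed.
Lemma based_infinity (f : based) : val f None = x0.
Proof. by have [] := set_valP f. Qed.

Definition square_map (f : based) (x : 'rV[R]_2) : X := val f (collapse x).

Lemma square_map_boundary f x : bdext x -> square_map f x = x0.
Proof. by move=> bx; rewrite /square_map collapse_bdext // based_infinity. Qed.

Lemma eq_square_map (f g : based) :
  (forall x, cube R 2 x -> square_map f x = square_map g x) -> f = g.
Proof.
move=> fg; apply/val_inj/funext => z; have [x cx <-] := collapse_surj z.
exact: fg.
Qed.

Lemma square_map_continuous (T : topologicalType) (alpha : T -> based) :
  continuous alpha -> continuous (fun u : T * 'rV[R]_2 => square_map (alpha u.1)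
    u.2).
Proof.
move=> c; have cev := from_maps_continuous (fun f (bf : based f) => bf.1) c.
have cc : continuous (fun u : T * 'rV[R]_2 => (u.1, collapse u.2)).
  apply: pair_cont; first exact: fst_cont.
  by apply: (comp_cont (@snd_cont _ _)); exact: collapse_continuous.
exact: (comp_cont cc cev).
Qed.

Lemma square_map_cont f : continuous (square_map f).
Proof. by apply: (comp_cont (@collapse_continuous R)); exact: based_cont. Qed.

(** Continuity of a family of based maps can be tested on the square, because
   [collapse] is a quotient map, even with parameters. *)
Lemma based_continuous (T : topologicalType) (alpha : T -> based)
    (A : T * 'rV[R]_2 -> X) : continuous A ->
  (forall t x, cube R 2 x -> square_map (alpha t) x = A (t, x)) -> continuous alpha.
Proof.
move=> cA AE; apply: to_maps_continuous.
have Ab t x : cube_boundary x -> A (t, x) = x0.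
  by move=> bx; rewrite -AE; [exact/square_map_boundary/boundary_bdext|case: bx].
have := descend_continuous cA Ab.
rewrite (_ : (fun u => A _) = (fun u : T * CP1 => val (alpha u.1) u.2)) //.
apply/funext => -[t z] /=; rewrite -AE; last exact: section_cube.
by rewrite /square_map sectionK.
Qed.

Section Glue.
Variables (F : 'rV[R]_2 -> X).
Hypothesis F_cont : continuous F.
Hypothesis F_boundary : forall x, cube_boundary x -> F x = x0.

Fact glue_based : based (F \o section).
Proof.
have cA : continuous (fun u : R * 'rV[R]_2 => F u.2).
  by apply: (comp_cont (@snd_cont _ _)).
have Ab (t : R) x : cube_boundary x -> F x = x0 by exact: F_boundary.
split.
  have := descend_continuous cA Ab => c.
  have cz : continuous (fun z : CP1 => (0 : R, z)).
    by apply: pair_cont; [exact: cst_continuous|move=> z; exact: cvg_id].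
  exact: (comp_cont cz c).
have c0 : cube_boundary (section (None : CP1)).
  have c0 : cube R 2 0 by move=> i; rewrite mxE lexx ler01.
  have e : collapse (section None) = collapse (0 : 'rV[R]_2).
    by rewrite sectionK /collapse mxE ltxx.
  have [->|[]//] := collapse_eq (section_cube _) c0 e.
  by split=> //; exists ord0; rewrite mxE; left.
exact: F_boundary.
Qed.

Definition glue : based := exist _ (F \o section : CP1 -> X) (mem_set glue_based).

Lemma square_map_glue x : cube R 2 x -> square_map glue x = F x.
Proof.
move=> cx; rewrite /square_map /=.
have [->//|[bs bx]] := collapse_eq (section_cube _) cx (sectionK (collapse x)).
by rewrite !F_boundary.
Qed.
End Glue.

Definition based_cube (f : based) : cube_map R 2 x0 :=
  sphere_cube (@based_cont f) (based_infinity f).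

(** A cube descends along the quotient map [collapse]. *)
Lemma based_cube_surj (c : cube_map R 2 x0) :
  exists f : based, homotopic (based_cube f) c.
Proof.
have cb x : cube_boundary x -> extend c x = x0.
  by move=> /boundary_bdext; exact: extend_bd.
have ec : continuous (extend c) by exact: extend_continuous.
exists (glue ec cb); apply: homotopic_eq => x cx.
exact: etrans (square_map_glue ec cb cx) (extendE c cx).
Qed.

Lemma based_path (f g : based) : homotopic (based_cube f) (based_cube g) ->
  exists gamma : R -> based, [/\ continuous gamma, gamma 0 = f & gamma 1 = g].
Proof.
move=> /homotopicE[H [cH H0 H1 Hb]].
have cHt t : continuous (fun x => H (t, x)).
  by apply: (comp_cont _ cH); apply: pair_cont; [exact: cst_continuous|move=> x;
    exact: cvg_id].
have Hbt t x : cube_boundary x -> H (t, x) = x0.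
  by move=> /boundary_bdext; exact: Hb.
exists (fun t => glue (cHt t) (Hbt t)); split.
- by apply: based_continuous cH _ => t x cx; rewrite square_map_glue.
- by apply: eq_square_map => x cx; rewrite square_map_glue // H0 extendE.
- by apply: eq_square_map => x cx; rewrite square_map_glue // H1 extendE.
Qed.

End BasedMaps.

(** * Double loop space structure *)

Section HomotopicMaps.
Context {R : realType}.
Local Notation half := (2^-1 : R).

Lemma homotopic_maps_trans (P Q : topologicalType) (g f h : P -> Q) :
  @homotopic_maps R P Q f g -> @homotopic_maps R P Q g h -> @homotopic_maps R P Q
    f h.
Proof.
move=> [H [cH H0 H1]] [K [cK K0 K1]].
exists (fun z => if z.1 <= half then H (2 * z.1, z.2) else K (2 * z.1 + -1, z.2)).
split=> [|x|x] /=.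
- apply: continuous_paste; first exact: fst_cont.
  + apply: (comp_cont _ cH); apply: pair_cont; last exact: snd_cont.
    by apply: scale_cont; exact: fst_cont.
  + apply: (comp_cont _ cK); apply: pair_cont; last exact: snd_cont.
    by apply: affine_cont; exact: fst_cont.
  + move=> [t x] /= ->; rewrite (_ : 2 * half = 1) ?H1; last lra.
    by rewrite (_ : 1 + -1 = 0) ?K0 //; lra.
- by rewrite ifT ?mulr0 ?H0 //; lra.
- rewrite ifF; last by apply/negP; lra.
  by rewrite (_ : 2 * 1 + -1 = 1) ?K1 //; lra.
Qed.

End HomotopicMaps.

Section Loops.
Context {R : realType} {X : topologicalType} {x0 : X}.
Local Notation half := (2^-1 : R).
Local Notation Y := (@based R X x0).

Fact base_map_boundary (x : 'rV[R]_2) : cube_boundary x -> x0 = x0.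
Proof. by []. Qed.

Definition base_map : Y :=
  glue (fun x : 'rV[R]_2 => @cst_continuous _ _ x0 x) base_map_boundary.

Lemma square_base_map x : square_map base_map x = x0.
Proof. by []. Qed.

Fact stack_cont (f g : Y) : continuous (conc (square_map f) (square_map g)).
Proof.
by apply: conc_cont1 => [||x bx|x bx]; try exact: square_map_cont;
  exact: square_map_boundary.
Qed.

Fact stack_boundary (f g : Y) x : cube_boundary x ->
  conc (square_map f) (square_map g) x = x0.
Proof.
by move=> /boundary_bdext; apply: conc_bd => y yb; exact: square_map_boundary.
Qed.

(** The operation of pi_2, on maps rather than on classes. *)
Definition stack (f g : Y) : Y := glue (@stack_cont f g) (@stack_boundary f g).

Lemma square_stack (f g : Y) x : cube R 2 x ->
  square_map (stack f g) x = conc (square_map f) (square_map g) x.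
Proof. by move=> cx; rewrite square_map_glue. Qed.

Lemma stack_continuous (T : topologicalType) (alpha beta : T -> Y) :
  continuous alpha -> continuous beta -> continuous (fun t => stack (alpha t)
    (beta t)).
Proof.
move=> ca cb.
have := conc_cont (square_map_continuous ca) (square_map_continuous cb)
  (fun t x => @square_map_boundary _ _ _ (alpha t) x)
  (fun t x => @square_map_boundary _ _ _ (beta t) x).
by move=> /based_continuous; apply=> t x cx; rewrite square_stack.
Qed.

(** Analogue for families of based maps of [homotopic_reparam]; the homotopy
   moreover fixes the base map. *)
Lemma reparam_homotopic (T : topologicalType) (phi alpha beta : T -> Y) (u v : R
  -> R) :
  continuous phi -> continuous u -> continuous v ->
  (u 0 <= 0 /\ v 0 <= 0) \/ (1 <= u 0 /\ 1 <= v 0) ->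
  (u 1 <= 0 /\ v 1 <= 0) \/ (1 <= u 1 /\ 1 <= v 1) ->
  (forall t x, cube R 2 x ->
     square_map (alpha t) x = square_map (phi t) (upd (u (x 0 ord0)) x)) ->
  (forall t x, cube R 2 x ->
     square_map (beta t) x = square_map (phi t) (upd (v (x 0 ord0)) x)) ->
  exists H : R * T -> Y, [/\ continuous H, forall t, H (0, t) = alpha t,
    forall t, H (1, t) = beta t & forall s t, phi t = base_map -> H (s, t) =
      base_map].
Proof.
move=> cphi cu cv uv0 uv1 alphaE betaE.
pose w (s a : R) := u a + clamp s * (v a - u a).
have cw (S : topologicalType) (s a : S -> R) : continuous s -> continuous a ->
    continuous (fun z => w (s z) (a z)).
  move=> cs ca; apply: add_cont; first exact: (comp_cont ca cu).
  apply: mul_cont; first exact: (comp_cont cs (@clamp_continuous R)).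
  by apply: sub_cont; [exact: (comp_cont ca cv)|exact: (comp_cont ca cu)].
have cx0 (S : topologicalType) (y : S -> 'rV[R]_2) : continuous y ->
    continuous (fun z => y z 0 ord0) by move=> cy;
      exact: (comp_cont cy (@coord_cont _ _ _)).
have cid (S : topologicalType) : continuous (@id S) by move=> z; exact: cvg_id.
have Fc (z : R * T) : continuous (fun x : 'rV[R]_2 => square_map (phi z.2) (upd
  (w z.1 (x 0 ord0)) x)).
  apply: (comp_cont _ (@square_map_cont _ _ _ (phi z.2))); apply: upd_cont;
    last exact: cid.
  by apply: cw; [exact: cst_continuous|exact: cx0].
have Fb (z : R * T) (x : 'rV[R]_2) : cube_boundary x ->
    square_map (phi z.2) (upd (w z.1 (x 0 ord0)) x) = x0.
  move=> [cx [j xj]]; apply: square_map_boundary.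
  have [jE|j0] := eqVneq j ord0; last first.
    by exists j; rewrite updN //; case: xj => ->; [left|right].
  exists ord0; rewrite upd0 /w; have := clamp_itv z.1; rewrite jE in xj.
  have cvx a b (c : R) : (a <= 0 /\ b <= 0) \/ (1 <= a /\ 1 <= b) -> 0 <= c <= 1 ->
      a + c * (b - a) <= 0 \/ 1 <= a + c * (b - a).
    by case=> -[a0 b0]; [left|right]; nra.
  by case: xj => /= ->; apply: cvx.
exists (fun z => glue (Fc z) (Fb z)); split.
- apply: (@based_continuous _ _ _ _ _ (fun z : (R * T) * 'rV[R]_2 =>
    square_map (phi z.1.2) (upd (w z.1.1 (z.2 0 ord0)) z.2))); last first.
    by move=> z x cx; rewrite square_map_glue.
  pose place (z : (R * T) * 'rV[R]_2) := (z.1.2, upd (w z.1.1 (z.2 0 ord0)) z.2).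
  suff c : continuous place by exact: (comp_cont c (square_map_continuous cphi)).
  apply: pair_cont; first exact: (comp_cont (@fst_cont _ _) (@snd_cont _ _)).
  apply: upd_cont; last exact: snd_cont.
  apply: cw; first exact: (comp_cont (@fst_cont _ _) (@fst_cont _ _)).
  by apply: cx0; exact: snd_cont.
- move=> t; apply: eq_square_map => x cx; rewrite square_map_glue //= alphaE //.
  by rewrite /w clamp_le0 // mul0r addr0.
- move=> t; apply: eq_square_map => x cx; rewrite square_map_glue //= betaE //.
  by rewrite /w clamp_ge1 // mul1r addrC subrK.
- move=> s t tE; apply: eq_square_map => x cx; rewrite square_map_glue //= tE.
  by rewrite !square_base_map.
Qed.

Lemma continuous_idfun (T : topologicalType) : continuous (@id T).
Proof. by move=> x; exact: cvg_id. Qed.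

Lemma square_upd_out (f : Y) s x : s <= 0 \/ 1 <= s -> square_map f (upd s x) = x0.
Proof. by move=> s01; apply: square_map_boundary; exists ord0; rewrite upd0. Qed.

Lemma stack_unitr : exists H : R * Y -> Y, [/\ continuous H,
  forall f, H (0, f) = stack f base_map, forall f, H (1, f) = f &
  forall s f, f = base_map -> H (s, f) = base_map].
Proof.
apply: (@reparam_homotopic _ id _ id (fun s => 2 * s + 0) idfun).
- exact: continuous_idfun.
- by apply: affine_cont; exact: continuous_idfun.
- exact: continuous_idfun.
- by left; lra.
- by right; lra.
- move=> f x cx; rewrite square_stack // /conc addr0; case: ifP => // /negbT x2.
  by rewrite square_base_map square_upd_out //; right; lra.
- by move=> f x cx; rewrite upd_id.
Qed.

Lemma stack_unitl : exists H : R * Y -> Y, [/\ continuous H,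
  forall f, H (0, f) = stack base_map f, forall f, H (1, f) = f &
  forall s f, f = base_map -> H (s, f) = base_map].
Proof.
apply: (@reparam_homotopic _ id _ id (fun s => 2 * s + -1) idfun).
- exact: continuous_idfun.
- by apply: affine_cont; exact: continuous_idfun.
- exact: continuous_idfun.
- by left; lra.
- by right; lra.
- move=> f x cx; rewrite square_stack // /conc; case: ifP => // x2.
  by rewrite square_base_map square_upd_out //; left; lra.
- by move=> f x cx; rewrite upd_id.
Qed.

Lemma stack_assoc (T : topologicalType) (f g h : T -> Y) :
  continuous f -> continuous g -> continuous h ->
  @homotopic_maps R T Y (fun t => stack (f t) (stack (g t) (h t)))
    (fun t => stack (stack (f t) (g t)) (h t)).
Proof.
move=> cf cg ch.
have cfgh := stack_continuous (stack_continuous cf cg) ch.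
(* The reparametrization carries the subdivision 1/2, 3/4 to 1/4, 1/2. *)
have [||||||H [cH H0 H1 _]] := @reparam_homotopic T _
  (fun t => stack (f t) (stack (g t) (h t))) (fun t => stack (stack (f t) (g t))
    (h t))
  (fun s => if s <= half then half * s + 0 else
            if s <= 3 / 4 then 1 * s + - (1 / 4) else 2 * s + -1) idfun cfgh.
- apply: continuous_paste; try exact: continuous_idfun.
  + by apply: affine_cont; exact: continuous_idfun.
  + apply: continuous_paste; try exact: continuous_idfun.
    * by apply: affine_cont; exact: continuous_idfun.
    * by apply: affine_cont; exact: continuous_idfun.
    * by move=> s ->; lra.
  + by move=> s ->; rewrite ifT; lra.
- exact: continuous_idfun.
- by left; rewrite /= ifT; lra.
- by right; rewrite /= !ifF; [lra|apply/negP; lra|apply/negP; lra].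
- move=> t x cx; have := cx ord0; set s := x 0 ord0 => x01.
  rewrite [LHS]square_stack // /conc -/s.
  have cu r : 0 <= r <= 1 -> cube R 2 (upd r x) by move=> r01; exact: upd_cube.
  case: ifP => [x2|/negbT x2].
    have e1 : half * s + 0 <= half by lra.
    have e2 : 2 * (half * s + 0) <= half by lra.
    rewrite square_stack; last by apply: cu; lra.
    rewrite /conc !(upd0, upd_upd) e1 square_stack; last by apply: cu; lra.
    by rewrite /conc !(upd0, upd_upd) e2; congr (square_map _ (upd _ _)); lra.
  rewrite square_stack; last by apply: cu; lra.
  have [x3|x3] := leP s (3 / 4).
    have e1 : 1 * s + - (1 / 4) <= half by lra.
    have e2 : 2 * (1 * s + - (1 / 4)) <= half = false by apply/negP; lra.
    have e3 : 2 * s - 1 <= half by lra.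
    rewrite square_stack; last by apply: cu; lra.
    rewrite /conc !(upd0, upd_upd) e1 e3 square_stack; last by apply: cu; lra.
    by rewrite /conc !(upd0, upd_upd) e2; congr (square_map _ (upd _ _)); lra.
  have e1 : 2 * s + -1 <= half = false by apply/negP; lra.
  rewrite square_stack; last by apply: cu; lra.
  by rewrite /conc !(upd0, upd_upd) e1.
- by move=> t x cx; rewrite upd_id.
by exists H; split.
Qed.

(** ** Stacking along the second coordinate *)

Definition flip (x : 'rV[R]_2) : 'rV[R]_2 := \row_i x 0 (rev_ord i).

Lemma flipK : involutive flip.
Proof. by move=> x; apply/rowP => i; rewrite !mxE rev_ordK. Qed.

Lemma flip_cont : continuous flip.
Proof. by apply: continuous_row => i; exact: coord_cont. Qed.

Lemma flip_cube x : cube R 2 x -> cube R 2 (flip x).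
Proof. by move=> cx i; rewrite mxE; exact: cx. Qed.

Lemma flip_bdext x : bdext x -> bdext (flip x).
Proof. by move=> [i xi]; exists (rev_ord i); rewrite mxE rev_ordK. Qed.

Fact transpose_cont (f : Y) : continuous (square_map f \o flip).
Proof. by apply: (comp_cont flip_cont); exact: square_map_cont. Qed.

Fact transpose_boundary (f : Y) x : cube_boundary x -> square_map f (flip x) = x0.
Proof. by move=> /boundary_bdext /flip_bdext; exact: square_map_boundary. Qed.

Definition transpose (f : Y) : Y :=
  glue (@transpose_cont f) (@transpose_boundary f).

Lemma square_transpose f x : cube R 2 x ->
  square_map (transpose f) x = square_map f (flip x).
Proof. by move=> cx; rewrite square_map_glue. Qed.

Lemma transposeK : involutive transpose.
Proof.
move=> f; apply: eq_square_map => x cx.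
by rewrite !square_transpose ?flipK //; exact: flip_cube.
Qed.

Lemma transpose_base_map : transpose base_map = base_map.
Proof. by apply: eq_square_map => x cx; rewrite square_transpose. Qed.

Lemma transpose_continuous : continuous transpose.
Proof.
have c : continuous (fun u : Y * 'rV[R]_2 => square_map u.1 (flip u.2)).
  pose place (u : Y * 'rV[R]_2) := (u.1, flip u.2).
  have cplace : continuous place.
    by apply: pair_cont; [exact: fst_cont|exact: (comp_cont (@snd_cont _ _)
      flip_cont)].
  exact: (comp_cont cplace (square_map_continuous (@continuous_idfun Y))).
by apply: (based_continuous c) => f x cx; rewrite square_transpose.
Qed.

Definition stack' (f g : Y) : Y := transpose (stack (transpose f) (transpose g)).

Lemma square_stack' f g x : cube R 2 x -> square_map (stack' f g) x =
  conc (square_map f \o flip) (square_map g \o flip) (flip x).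
Proof.
move=> cx; rewrite square_transpose // square_stack; last exact: flip_cube.
by apply: eq_conc (_ : flip x \in _); rewrite ?inE; try exact: flip_cube;
  move=> y; rewrite inE => cy; rewrite square_transpose.
Qed.

(** The two ways of stacking commute, since they act on different coordinates. *)
Lemma stack_interchange a b c d :
  stack (stack' a b) (stack' c d) = stack' (stack a c) (stack b d).
Proof.
apply: eq_square_map => x cx; rewrite square_stack // square_stack' // /conc.
have x01 := cx ord0; have y01 := flip_cube cx ord0.
have flip0 s (z : 'rV[R]_2) : flip (upd s z) 0 ord0 = flip z 0 ord0.
  by rewrite !mxE.
have upd_flip s t (z : 'rV[R]_2) :
    flip (upd t (flip (upd s z))) = upd s (flip (upd t (flip z))).
  by apply/rowP => i; rewrite !mxE; have [->|->] := ord2P i; rewrite /= ?mxE.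
have flip_upd0 t (z : 'rV[R]_2) : flip (upd t (flip z)) 0 ord0 = z 0 ord0.
  by rewrite !mxE /= ?mxE; congr (z 0 _); apply/val_inj.
have cu s : 0 <= s <= 1 -> cube R 2 (upd s x) by move=> s01; exact: upd_cube.
have cv t : 0 <= t <= 1 -> cube R 2 (flip (upd t (flip x))).
  by move=> t01; apply: flip_cube; apply: upd_cube => //; exact: flip_cube.
case: (leP (x 0 ord0) half) => x2; rewrite square_stack'; try (by apply: cu; lra);
  rewrite /conc flip0; case: (leP (flip x 0 ord0) half) => y2 /=;
  rewrite square_stack; try (by apply: cv; lra);
  rewrite /conc flip_upd0 ?x2 ?(ltNge (2^-1)) //= ?(negbTE x2) -?upd_flip //.
all: by rewrite ifF ?upd_flip //; apply/negP; lra.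
Qed.

Lemma stack_base_map : stack base_map base_map = base_map.
Proof.
by apply: eq_square_map => x cx; rewrite square_stack // /conc; case: ifP.
Qed.

Lemma stack'_base_map : stack' base_map base_map = base_map.
Proof. by rewrite /stack' transpose_base_map stack_base_map transpose_base_map. Qed.

Lemma stack'_continuous (T : topologicalType) (alpha beta : T -> Y) :
  continuous alpha -> continuous beta -> continuous (fun t => stack' (alpha t)
    (beta t)).
Proof.
move=> ca cb; apply: (comp_cont _ transpose_continuous).
by apply: stack_continuous; apply: (comp_cont _ transpose_continuous).
Qed.

(** ** Translations are homotopy equivalences *)

Local Notation path f g :=
  (exists gamma : R -> Y, [/\ continuous gamma, gamma 0 = f & gamma 1 = g]).

Lemma stack_inverse (f : Y) : exists g : Y,
  path (stack g f) base_map /\ path (stack f g) base_map.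
Proof.
have [g rg] := based_cube_surj (reverse (based_cube f)).
have const_base : homotopic (const_cube 2) (based_cube base_map).
  by apply: homotopic_eq => x cx.
have stackE a b : homotopic (based_cube (stack a b)) (concat (based_cube a)
  (based_cube b)).
  by apply: homotopic_eq => x cx; exact: square_stack.
exists g; split; apply: based_path.
- apply: (homotopic_trans (stackE _ _)); apply: homotopic_trans const_base.
  apply: homotopic_trans (homotopic_Vconcat (based_cube f)).
  by apply: homotopic_concat => //; exact: homotopic_refl.
- apply: (homotopic_trans (stackE _ _)); apply: homotopic_trans const_base.
  apply: homotopic_trans (homotopic_concatV (based_cube f)).
  by apply: homotopic_concat => //; exact: homotopic_refl.
Qed.

(** Up to associativity, stacking with b and then with a is stacking with the sum
   of a and b, which can be deformed to the unit. *)
Lemma stack_translation (a b : Y) : path (stack a b) base_map ->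
  @homotopic_maps R Y Y (stack a \o stack b) id.
Proof.
move=> [gamma [cg g0 g1]].
apply: (homotopic_maps_trans (g := fun f => stack (stack a b) f)).
  by apply: stack_assoc;
    [exact: cst_continuous|exact: cst_continuous|exact: continuous_idfun].
apply: (homotopic_maps_trans (g := fun f => stack base_map f)).
  exists (fun z => stack (gamma z.1) z.2); split=> [|f|f] /=; rewrite ?g0 ?g1 //.
  by apply: stack_continuous;
    [exact: (comp_cont (@fst_cont _ _) cg)|exact: snd_cont].
by have [H [cH H0 H1 _]] := stack_unitl; exists H.
Qed.

Lemma stackl_continuous (f : Y) : continuous (stack f).
Proof. by apply: stack_continuous;
  [exact: cst_continuous|exact: continuous_idfun]. Qed.

Lemma stack'l_continuous (f : Y) : continuous (stack' f).
Proof. by apply: stack'_continuous;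
  [exact: cst_continuous|exact: continuous_idfun]. Qed.

Section Multiples.
Variable E : forall G H : groupType, (G -> H) -> Prop.
Hypothesis EP : rational_notion E.

Lemma induces_bijective n (P Q : topologicalType) (phi : P -> Q) (cphi :
  continuous phi) p :
  bijective (@homotopy_group_map R P Q phi cphi n.+1 p) -> @induces R E n P Q phi p.
Proof.
move=> b c; rewrite (_ : c = cphi); last exact: Prop_irrelevance.
by apply: (notion_bijective EP) => //; exact: homotopy_group_mapM.
Qed.

Lemma induces_transpose n f : @induces R E n Y Y transpose f.
Proof.
have h : @homotopic_maps R Y Y (transpose \o transpose) id.
  exists snd; split=> [|x|x] /=; rewrite ?transposeK //; exact: snd_cont.
apply: (induces_bijective (cphi := transpose_continuous)).
exact: (homotopy_equivalence_bij _ _ transpose_continuous).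
Qed.

Lemma induces_stack n (a f : Y) : @induces R E n Y Y (stack a) f.
Proof.
have [b [ba ab]] := stack_inverse a.
apply: (induces_bijective (cphi := @stackl_continuous a)).
apply: (@homotopy_equivalence_bij R _ Y Y (stack a) (stack b)).
- exact: stackl_continuous.
- exact: stack_translation.
- exact: stack_translation.
Qed.

Lemma induces_stack' n (a f : Y) : @induces R E n Y Y (stack' a) f.
Proof.
have ct := transpose_continuous.
have c1 := comp_cont ct (@stackl_continuous (transpose a)).
apply: (induces_comp EP c1 ct); last exact: induces_transpose.
apply: (induces_comp EP ct); last exact: induces_stack.
  exact: stackl_continuous.
exact: induces_transpose.
Qed.

(** ** The Eckmann-Hilton argument *)

Section Cubes.
Variable n : nat.
Implicit Types a b c d : cube_map R n.+1 base_map.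

Fact stack_cube_continuous a b :
  {within cube R n.+1, continuous (fun x => stack (a x) (b x))}.
Proof.
apply: (@within_eq _ _ _ _ (fun x => stack (extend a x) (extend b x))).
  by move=> x cx; rewrite !extendE.
by apply: stack_continuous; exact: extend_continuous.
Qed.

Fact stack_cube_boundary a b x : cube_boundary x -> stack (a x) (b x) = base_map.
Proof. by move=> bx; rewrite !cube_fun_boundary // stack_base_map. Qed.

Definition stack_cube a b : cube_map R n.+1 base_map :=
  CubeMap (@stack_cube_continuous a b) (@stack_cube_boundary a b).

Lemma homotopic_stack_cube a a' b b' : homotopic a a' -> homotopic b b' ->
  homotopic (stack_cube a b) (stack_cube a' b').
Proof.
move=> /homotopicE[H [cH H0 H1 Hb]] /homotopicE[K [cK K0 K1 Kb]].
apply: (@homotopicI _ _ _ _ _ _ (fun z => stack (H z) (K z))).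
- exact: stack_continuous.
- by move=> x cx; rewrite H0 K0 !extendE.
- by move=> x cx; rewrite H1 K1 !extendE.
- by move=> t x t01 /boundary_bdext bx; rewrite Hb // Kb // stack_base_map.
Qed.

Lemma stack_cube1 a : homotopic (stack_cube a (const_cube _)) a.
Proof.
have [H [cH H0 H1 Hb]] := stack_unitr.
apply: (@homotopicI _ _ _ _ _ _ (fun z => H (z.1, extend a z.2))).
- pose place (z : R * 'rV[R]_n.+1) := (z.1, extend a z.2).
  suff c : continuous place by exact: (comp_cont c cH).
  apply: pair_cont; first exact: fst_cont.
  by apply: (comp_cont (@snd_cont _ _)); exact: extend_continuous.
- by move=> x cx; rewrite H0 /= extendE.
- by move=> x cx; rewrite H1 /= extendE.
- by move=> t x t01 /boundary_bdext bx; rewrite Hb //= extend_bd.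
Qed.

Lemma stack_1cube a : homotopic (stack_cube (const_cube _) a) a.
Proof.
have [H [cH H0 H1 Hb]] := stack_unitl.
apply: (@homotopicI _ _ _ _ _ _ (fun z => H (z.1, extend a z.2))).
- pose place (z : R * 'rV[R]_n.+1) := (z.1, extend a z.2).
  suff c : continuous place by exact: (comp_cont c cH).
  apply: pair_cont; first exact: fst_cont.
  by apply: (comp_cont (@snd_cont _ _)); exact: extend_continuous.
- by move=> x cx; rewrite H0 /= extendE.
- by move=> x cx; rewrite H1 /= extendE.
- by move=> t x t01 /boundary_bdext bx; rewrite Hb //= extend_bd.
Qed.

Lemma stack_cube_concat a b c d : homotopic (stack_cube (concat a b) (concat c d))
  (concat (stack_cube a c) (stack_cube b d)).
Proof. by apply: homotopic_eq => x cx; rewrite /= /conc; case: ifP. Qed.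

(** Write a as a.1 and b as 1.b: stacking commutes with concatenation, and has the
   same unit. *)
Lemma stack_cube_class a b :
  homotopy_class (stack_cube a b) = (homotopy_class a * homotopy_class b)%g.
Proof.
transitivity (homotopy_class (concat a b)); last by symmetry; exact: pi_mulE.
apply/homotopy_classP.
apply: (homotopic_trans (g := stack_cube (concat a (const_cube _)) (concat
  (const_cube _) b))).
  apply: homotopic_sym; apply: homotopic_stack_cube.
    exact: homotopic_concat1.
  exact: homotopic_1concat.
apply: (homotopic_trans (stack_cube_concat _ _ _ _)).
by apply: homotopic_concat; [exact: stack_cube1|exact: stack_1cube].
Qed.

Lemma stack_cube_classC a b :
  homotopy_class (stack_cube a b) = (homotopy_class b * homotopy_class a)%g.
Proof.
transitivity (homotopy_class (concat b a)); last by symmetry; exact: pi_mulE.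
apply/homotopy_classP.
apply: (homotopic_trans (g := stack_cube (concat (const_cube _) a) (concat b
  (const_cube _)))).
  apply: homotopic_sym; apply: homotopic_stack_cube.
    exact: homotopic_1concat.
  exact: homotopic_concat1.
apply: (homotopic_trans (stack_cube_concat _ _ _ _)).
by apply: homotopic_concat; [exact: stack_1cube|exact: stack_cube1].
Qed.

Lemma homotopy_group_based_comm (x y : homotopy_group R n.+1 base_map) : commute
  x y.
Proof.
elim/(@pi_ind R): x => a; elim/(@pi_ind R): y => b.
by rewrite /commute -stack_cube_class stack_cube_classC.
Qed.

End Cubes.

(** ** The multiple of a based map *)

Fixpoint multiple (d : nat) (f : Y) : Y :=
  if d is d'.+1 then stack (multiple d' f) f else base_map.

Lemma multiple_continuous d : continuous (multiple d).
Proof.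
elim: d => [|d IH]; first exact: cst_continuous.
by apply: stack_continuous => //; exact: continuous_idfun.
Qed.

Lemma based_cube_multiple d (f : Y) :
  homotopy_class (based_cube (multiple d f)) = (homotopy_class (based_cube f) ^+
    d)%g.
Proof.
elim: d => [|d IH]; first by apply/homotopy_classP; exact: homotopic_eq.
rewrite expgSr -IH.
transitivity (homotopy_class (concat (based_cube (multiple d f)) (based_cube f))).
  by apply/homotopy_classP; apply: homotopic_eq => x cx; exact: square_stack.
by symmetry; exact: pi_mulE.
Qed.

Lemma multiple_base_map d : multiple d base_map = base_map.
Proof. by elim: d => //= d ->; exact: stack_base_map. Qed.

Lemma multiple_stack' d f g :
  multiple d (stack' f g) = stack' (multiple d f) (multiple d g).
Proof.
elim: d => [|d IH] /=; first by rewrite stack'_base_map.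
by rewrite IH stack_interchange.
Qed.

Fixpoint multiple_cube n (d : nat) (a : cube_map R n.+1 base_map) :
    cube_map R n.+1 base_map :=
  if d is d'.+1 then stack_cube (multiple_cube d' a) a else const_cube _.

Lemma multiple_cubeE n d (a : cube_map R n.+1 base_map) x :
  multiple_cube d a x = multiple d (a x).
Proof. by elim: d => //= d ->. Qed.

Lemma multiple_cube_class n d (a : cube_map R n.+1 base_map) :
  homotopy_class (multiple_cube d a) = (homotopy_class a ^+ d)%g.
Proof. by elim: d => //= d IH; rewrite stack_cube_class IH expgSr. Qed.

Lemma induces_multiple_base_map n d : (0 < d)%N ->
  @induces R E n Y Y (multiple d) base_map.
Proof.
move=> d0 c.
(* The d-fold sum of the base map is equal to the base map, but not by conversion:
   the constant path identifies the two homotopy groups. *)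
have cc : continuous (fun _ : R => base_map) by exact: cst_continuous.
have e0 : (fun _ : R => base_map) 0 = multiple d base_map by rewrite
  multiple_base_map.
have e1 : (fun _ : R => base_map) 1 = base_map by [].
have bM := @base_changeM R Y n _ _ _ cc e0 e1.
have bB := @base_change_bij R Y n.+1 _ _ _ cc e0 e1.
have powE : (fun g => g ^+ d)%g =
    base_change cc e0 e1 \o @homotopy_group_map R _ _ _ c n.+1 base_map.
  apply/funext; elim/(@pi_ind R) => a /=;
    rewrite homotopy_group_mapE -multiple_cube_class.
  symmetry; apply: base_changeE; exists (multiple d \o extend a \o snd); split.
  - apply: (comp_cont (@snd_cont _ _));
    apply: (comp_cont _ (@multiple_continuous d)).
    exact: extend_continuous.
  - by move=> x cx; rewrite /= extendE.
  - by move=> x cx; rewrite /= extendE // multiple_cubeE.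
  - move=> t x t01 bx; rewrite /= extend_bd ?multiple_base_map //.
    exact: boundary_bdext.
apply: (notion_cancell EP (psi := base_change cc e0 e1)) => //.
- exact: homotopy_group_mapM.
- exact: (notion_bijective EP).
- rewrite -powE; apply: (notion_power EP d0) => x y.
  by rewrite expgMn //; exact: homotopy_group_based_comm.
Qed.

(** On the component of the base map the d-fold multiple induces d-th powers, and
   translations carry this to the other components. *)
Lemma induces_multiple n d f : (0 < d)%N -> @induces R E n Y Y (multiple d) f.
Proof.
move=> d0; have cm := @multiple_continuous d.
have cf := @stack'l_continuous f; have cdf := @stack'l_continuous (multiple d f).
apply: (induces_path EP cm (p := stack' f base_map)).
  have [H [cH H0 H1 _]] := stack_unitr.
  exists (fun t => transpose (H (t, transpose f))); split.
  - apply: (comp_cont _ transpose_continuous).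
    pose place (t : R) := (t, transpose f).
    suff c : continuous place by exact: (comp_cont c cH).
    by apply: pair_cont; [exact: continuous_idfun|exact: cst_continuous].
  - by rewrite H0 /stack' transpose_base_map.
  - by rewrite H1 transposeK.
apply: (induces_cancelr EP cf cm); first exact: induces_stack'.
rewrite (_ : multiple d \o stack' f = stack' (multiple d f) \o multiple d);
  last first.
  by apply/funext => g; exact: multiple_stack'.
apply: (induces_comp EP cm cdf); first exact: induces_multiple_base_map.
exact: induces_stack'.
Qed.

End Multiples.

End Loops.

(** * The homotopy class of the power maps *)

Section PowerMaps.
Context {R : realType}.
Local Notation C := (complex R).
Local Notation CP1 := (CP1 R).
Local Notation half := (2^-1 : R).

Definition sqnorm (w : C) : R := complex.Re w ^+ 2 + complex.Im w ^+ 2.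

Lemma sqnormM (z w : C) : sqnorm (z * w) = sqnorm z * sqnorm w.
Proof. by case: z w => [a b] [c d]; rewrite /sqnorm /=; ring. Qed.

Lemma sqnormX (z : C) d : sqnorm (z ^+ d) = sqnorm z ^+ d.
Proof.
elim: d => [|d IH]; first by rewrite !expr0 /sqnorm /=; lra.
by rewrite !exprS sqnormM IH.
Qed.

Lemma sqnorm_ge0 w : 0 <= sqnorm w.
Proof. by rewrite addr_ge0 ?sqr_ge0. Qed.

Lemma sqnorm_cont : continuous (sqnorm : C^o -> R).
Proof.
by apply: add_cont; [apply: (mul_cont (@Re_continuous R) (@Re_continuous R))|
  apply: (mul_cont (@Im_continuous R) (@Im_continuous R))].
Qed.

Lemma sqnorm_large (M : R) (w : C) : 2 * M ^+ 2 < sqnorm w ->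
  M < `|complex.Re w| \/ M < `|complex.Im w|.
Proof.
move=> wM; have [?|aM] := ltP M `|complex.Re w|; first by left.
right; rewrite ltNge; apply/negP => bM; move: wM; rewrite /sqnorm.
rewrite -(real_normK (num_real (complex.Re w))) -(real_normK (num_real
  (complex.Im w))).
have := normr_ge0 (complex.Re w); have := normr_ge0 (complex.Im w); nra.
Qed.

Lemma coord_sqnorm (M : R) (w : C) : 0 <= M ->
  M < `|complex.Re w| \/ M < `|complex.Im w| -> M ^+ 2 < sqnorm w.
Proof.
move=> M0; rewrite /sqnorm.
rewrite -(real_normK (num_real (complex.Re w))) -(real_normK (num_real
  (complex.Im w))).
have := normr_ge0 (complex.Re w); have := normr_ge0 (complex.Im w) => a0 b0 [] h;
  nra.
Qed.

Lemma complexD (a b c d : R) : Complex a b + Complex c d = Complex (a + c) (b +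
  d) :> C.
Proof. by []. Qed.
Lemma complexN (a b : R) : - Complex a b = Complex (- a) (- b) :> C.
Proof. by []. Qed.
Lemma complex1 : 1 = Complex 1 0 :> C.
Proof. by []. Qed.
Lemma complex2 : 2 = Complex 2 0 :> C.
Proof. by apply/eqP; rewrite eq_complex /=; apply/andP; split; apply/eqP; lra. Qed.

Lemma C_mul_cont (T : topologicalType) (f g : T -> C^o) :
  continuous f -> continuous g -> continuous (fun x => (f x : C) * (g x : C) : C^o).
Proof. by move=> cf cg x; apply: cvgM; [exact: cf|exact: cg]. Qed.

Lemma C_exp_cont (T : topologicalType) (f : T -> C^o) d :
  continuous f -> continuous (fun x => (f x : C) ^+ d : C^o).
Proof.
move=> cf; elim: d => [|d IH]; first exact: cst_continuous.
have -> : (fun x => (f x : C) ^+ d.+1 : C^o) = (fun x => (f x : C) * (f x : C) ^+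
  d).
  by apply/funext => x; rewrite exprS.
exact: C_mul_cont.
Qed.

Lemma C_cont (T : topologicalType) (a b : T -> R) :
  continuous a -> continuous b -> continuous (fun x => Complex (a x) (b x) : C^o).
Proof. by move=> ca cb x; apply: complex_continuous; [exact: ca|exact: cb]. Qed.

(** For t = 1 this stretches the open unit disc over the complex plane and sends the
   rest to infinity; t = 0 is the identity. *)
Definition shrink (t : R) (w : C) : CP1 :=
  if t * sqnorm w < 1 then
    Some (Complex (complex.Re w / (1 - t * sqnorm w)) (complex.Im w / (1 - t *
      sqnorm w)))
  else None.

Lemma sqnorm_shrink (t : R) (w : C) : sqnorm
    (Complex (complex.Re w / (1 - t * sqnorm w)) (complex.Im w / (1 - t * sqnorm
      w)))
  = sqnorm w / (1 - t * sqnorm w) ^+ 2.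
Proof. by rewrite {1 4}/sqnorm /= !expr_div_n mulrDl. Qed.

Lemma shrink_cont (T : topologicalType) (s : T -> R) (w : T -> C^o) :
  continuous s -> continuous w -> continuous (fun z => shrink (s z) (w z)).
Proof.
move=> cs cw z; pose m y := s y * sqnorm (w y).
have cn : continuous (fun y => sqnorm (w y)) by exact: (comp_cont cw sqnorm_cont).
have cm : continuous m by exact: mul_cont.
have near_lt (f g : T -> R) : continuous f -> continuous g -> f z < g z ->
    nbhs z [set y | f y < g y].
  move=> cf cg fg; have cgf : continuous (fun y => g y - f y) by exact: sub_cont.
  have : 0 < g z - f z by rewrite subr_gt0.
  move=> /lt_nbhsr n0.
  have n1 : nbhs z [set y | 0 < g y - f y] by exact: (cgf z _ n0).
  by apply: filterS n1 => y /=; rewrite subr_gt0.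
have ccst : continuous (fun _ : T => 1 : R) by exact: cst_continuous.
rewrite /shrink; have [m1|m1] := ltP (m z) 1.
  have nm := near_lt _ _ cm ccst m1.
  pose K y : CP1 := Some (Complex (complex.Re (w y) / (1 - m y)) (complex.Im (w
    y) / (1 - m y))).
  have cK : {for z, continuous K}.
    apply: (@continuous_comp _ C^o CP1 _ Some); last first.
      exact: one_point_compactification_some_continuous.
    apply: complex_continuous; apply: cvgM.
    - exact: (comp_cont cw (@Re_continuous R)).
    - by apply: cvgV; [apply/eqP; lra|exact: (onem_cont cm)].
    - exact: (comp_cont cw (@Im_continuous R)).
    - by apply: cvgV; [apply/eqP; lra|exact: (onem_cont cm)].
  move=> U nU; have nK : nbhs z (K @^-1` U) by apply: cK; rewrite /K /m m1 in nU *.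
  apply: (filterS _ (filterI nm nK)) => y [/= my Ky].
  by rewrite /preimage /= -/(m y) my.
(* Where m = 1 the values are large: their square norm is |w|^2 / (1 - m)^2. *)
move=> U; rewrite -/(m z) ifF; last by apply/negbTE; rewrite -leNgt.
move=> /nbhs_infinity[UN [M MU]].
suff : nbhs z [set y | m y < 1 -> 2 * M ^+ 2 * (1 - m y) ^+ 2 < sqnorm (w y)].
  apply: filterS => y /= yM; rewrite /preimage /= -/(m y).
  case: ifP => // my; apply: MU; apply: sqnorm_large.
  rewrite sqnorm_shrink ltr_pdivlMr; first exact: yM.
  by apply: exprn_gt0; rewrite subr_gt0.
have [m1'|m1'] := eqVneq (m z) 1; last first.
  have m1'' : 1 < m z by rewrite lt_neqAle eq_sym m1' m1.
  apply: filterS (near_lt _ _ ccst cm m1'') => y /= /lt_trans h /h.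
  by rewrite ltxx.
have c1 : continuous (fun y => 2 * M ^+ 2 * (1 - m y) ^+ 2).
  by apply: scale_cont; apply: mul_cont; exact: onem_cont.
have w0 : 2 * M ^+ 2 * (1 - m z) ^+ 2 < sqnorm (w z).
  rewrite m1' subrr expr0n mulr0 lt_neqAle sqnorm_ge0 andbT eq_sym.
  by apply: contra_eq_neq m1' => w0; rewrite /m w0 mulr0 eq_sym oner_neq0.
by apply: filterS (near_lt _ _ c1 cn w0) => y /= ? _.
Qed.

Lemma shrink_infinity (w : C) : 1 <= sqnorm w -> shrink 1 w = None.
Proof. by move=> w1; rewrite /shrink mul1r ltNge w1. Qed.

Lemma shrink0 (w : C) : shrink 0 w = Some w.
Proof. by rewrite /shrink mul0r ltr01 subr0 !divr1; case: w. Qed.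

Definition shrink_line (t : R) (z : CP1) : CP1 :=
  if z is Some w then shrink t w else None.

Lemma shrink_line_cont : continuous (fun u : R * CP1 => shrink_line (clamp u.1)
  u.2).
Proof.
move=> [t [w|]]; last first.
  move=> U /= /nbhs_infinity[UN [M MU]].
  pose V : set CP1 := [set z | if z is Some w then
     `|M| < `|complex.Re w| \/ `|M| < `|complex.Im w| else True].
  have nV : nbhs (None : CP1) V by apply/nbhs_infinity; split=> //; exists `|M|.
  exists (setT, V); first by split=> //; exact: filterT.
  move=> -[s [w|]] /= [_ Vw] //; rewrite /preimage /= /shrink.
  have := clamp_itv s; set c := clamp s => c01; case: ifP => // m1; apply: MU => /=.
  have k1 : 1 <= (1 - c * sqnorm w)^-1.
    have := sqnorm_ge0 w => w0; rewrite invf_ge1; last by rewrite subr_gt0.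
    by rewrite lerBlDr lerDl mulr_ge0 //; case/andP: c01.
  rewrite !normrM (ger0_norm (le_trans ler01 k1)).
  have := ler_norm M; have := normr_ge0 (complex.Re w);
    have := normr_ge0 (complex.Im w).
  by case: Vw => ? ? ? ?; [left|right]; nra.
move=> U nU.
pose K (u : R * C^o) := shrink (clamp u.1) u.2.
have cK : continuous K.
  apply: shrink_cont; last exact: snd_cont.
  by apply: (comp_cont (@fst_cont _ _)); exact: clamp_continuous.
have : nbhs (t, w) (K @^-1` U) by exact: cK.
move=> [[V W] /= [Vt Ww] VW].
exists (V, Some @` W).
  by split=> //=; exact: one_point_compactification_some_nbhs.
by move=> -[s z] /= [Vs [v Wv <-]]; exact: (VW (s, v)).
Qed.

(** ** The power maps are continuous *)

Lemma CP1_pow_continuous d : (0 < d)%N -> continuous (@CP1_pow R d).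
Proof.
move=> d0 [w|] U nU.
  have cX : continuous (fun w : C^o => w ^+ d : C^o) by apply: C_exp_cont;
    exact: continuous_idfun.
  exact: (cX w _ nU).
have [UN [M MU]] := (nbhs_infinity _).1 nU.
suff : nbhs (None : CP1) (CP1_pow d @^-1` U) by [].
(* This bound gives both 1 <= |w|^2 and 2 M^2 < |w|^2. *)
apply/nbhs_infinity; split=> //; exists (1 + 2 * `|M|) => w wM; apply: MU.
apply: sqnorm_large; rewrite sqnormX.
have M0 := normr_ge0 M; have {wM} := coord_sqnorm (_ : 0 <= 1 + 2 * `|M|) wM.
move=> /(_ ltac:(lra)) wM; have wM' : 1 + 4 * M ^+ 2 < sqnorm w.
  by rewrite -(real_normK (num_real M)); nra.
have w1 : 1 <= sqnorm w by have := sqr_ge0 M; lra.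
have : sqnorm w <= sqnorm w ^+ d by rewrite -{1}[sqnorm w]expr1 ler_weXn2l.
have := sqr_ge0 M; lra.
Qed.

(** ** Classes of maps of the square given by complex-valued functions *)

Local Notation pi2 := (homotopy_group R 2 (None : CP1)).

(** Since [shrink] sends everything outside the open unit disc to infinity,
   homotopies of u only have to stay out of this disc on the boundary of the
   square ([represents_homotopic]). *)
Definition represents (a : pi2) (u : 'rV[R]_2 -> C) :=
  exists2 c : cube_map R 2 (None : CP1), homotopy_class c = a &
    forall x, cube R 2 x -> c x = shrink 1 (u x).

Lemma represents_uniq a b u : represents a u -> represents b u -> a = b.
Proof.
move=> [c <- cu] [c' <- cu']; apply/homotopy_classP; apply: homotopic_eq => x cx.
by rewrite cu // cu'.
Qed.

Lemma represents_homotopic a u v (w : R * 'rV[R]_2 -> C^o) : continuous w ->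
  (forall x, cube R 2 x -> w (0, x) = u x) ->
  (forall x, cube R 2 x -> w (1, x) = v x) ->
  (forall t x, 0 <= t <= 1 -> cube_boundary x -> 1 <= sqnorm (w (t, x))) ->
  represents a u -> represents a v.
Proof.
move=> cw w0 w1 wb [c <- cu].
have cH : continuous (fun z => shrink 1 (w z)).
  by apply: shrink_cont => //; exact: cst_continuous.
have ce : {within cube R 2, continuous (fun x => shrink 1 (w (1, x)))}.
  apply: continuous_subspaceT.
  have cp : continuous (fun x : 'rV[R]_2 => (1 : R, x)).
    by apply: pair_cont; [exact: cst_continuous|exact: continuous_idfun].
  exact: (comp_cont cp cH).
have be x : cube_boundary x -> shrink 1 (w (1, x)) = None.
  by move=> bx; rewrite shrink_infinity // wb // ler01 lexx.
exists (CubeMap ce be); last by move=> x cx /=; rewrite w1.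
apply/homotopy_classP; apply: homotopic_sym; apply: (homotopicI cH) => //=.
- by move=> x cx; rewrite w0 // cu.
- by move=> t x t01 bx; rewrite shrink_infinity // wb.
Qed.

Lemma represents_mul (a b : pi2) u v w : represents a u -> represents b v ->
  (forall x, cube R 2 x -> w x = conc u v x) -> represents (a * b)%g w.
Proof.
move=> [c <- cu] [c' <- cv] wE; exists (concat c c'); first by symmetry;
  exact: pi_mulE.
move=> x cx; rewrite wE //= /conc; have := cx ord0; case: ifP => [x2|/negbT x2] x01.
  by rewrite cu //; apply: upd_cube => //; lra.
by rewrite cv //; apply: upd_cube => //; lra.
Qed.

(** The coordinates of the square rescaled to [-2, 2]^2 and to [-1, 1] x [-2, 2]. *)
Definition wide (x : 'rV[R]_2) : C := Complex (4 * x 0 ord0 - 2) (4 * x 0 ord_max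
  - 2).
Definition narrow (x : 'rV[R]_2) : C := Complex (2 * x 0 ord0 - 1) (4 * x 0
  ord_max - 2).

Lemma sqnorm_ge1 (a b : R) : a <= -1 \/ 1 <= a \/ b <= -1 \/ 1 <= b ->
  1 <= sqnorm (Complex a b).
Proof. by rewrite /sqnorm /= => -[h|[h|[h|h]]]; nra. Qed.

Lemma boundaryP (x : 'rV[R]_2) : cube_boundary x ->
  [\/ x 0 ord0 = 0, x 0 ord0 = 1, x 0 ord_max = 0 | x 0 ord_max = 1].
Proof.
case=> _ [j xj]; move: xj; have [->|->] := ord2P j => -[->|->]; 
  [by constructor 1|by constructor 2|by constructor 3|by constructor 4].
Qed.

Let Z := (R * 'rV[R]_2)%type.
Let t_cont : continuous (fun z : Z => z.1). Proof. exact: fst_cont. Qed.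
Let x_cont i : continuous (fun z : Z => z.2 0 i).
Proof. exact: (comp_cont (@snd_cont _ _) (@coord_cont _ _ i)). Qed.

(** A product stays out of the open unit disc if its factors do. *)
Lemma represents_prod d (pi : pi2) u v (A B : Z -> C^o) :
  continuous A -> continuous B ->
  (forall t x, 0 <= t <= 1 -> cube_boundary x ->
     1 <= sqnorm (A (t, x)) /\ 1 <= sqnorm (B (t, x))) ->
  (forall x, u x = (A (0, x) : C) ^+ d * (B (0, x) : C)) ->
  (forall x, v x = (A (1, x) : C) ^+ d * (B (1, x) : C)) ->
  represents pi u -> represents pi v.
Proof.
move=> cA cB AB uE vE.
pose w (z : Z) : C^o := (A z : C) ^+ d * (B z : C).
have cw : continuous w by exact: (C_mul_cont (@C_exp_cont _ _ d cA) cB).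
apply: (represents_homotopic cw).
- by move=> x _; rewrite uE.
- by move=> x _; rewrite vE.
move=> t x t01 bx; rewrite /w sqnormM sqnormX; have [A1 B1] := AB t x t01 bx.
by rewrite mulr_ege1 // exprn_ege1.
Qed.

Lemma wide_to_narrow d (a : pi2) : represents a (fun x => wide x ^+ d) ->
  represents a (fun x => narrow x ^+ d).
Proof.
apply: (@represents_prod d _ _ _ (fun z : Z => Complex
  ((4 - 2 * z.1) * z.2 0 ord0 + (z.1 - 2)) (4 * z.2 0 ord_max - 2)) (fun=> 1)).
- apply: C_cont; last exact: affine_cont.
  apply: add_cont; last by apply: sub_cont => //; exact: cst_continuous.
  apply: mul_cont => //; apply: sub_cont; first exact: cst_continuous.
  exact: scale_cont.
- exact: cst_continuous.
- move=> t x t01 bx; split; last by rewrite /sqnorm /=; lra.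
  by apply: sqnorm_ge1 => /=; case: (boundaryP bx) => ->; nra.
- by move=> x; rewrite mulr1 /wide; congr (Complex _ _ ^+ d) => /=; lra.
- by move=> x; rewrite mulr1 /narrow; congr (Complex _ _ ^+ d) => /=; lra.
Qed.

(** The left half of the square: the factor 1 is rotated to -1 and then moved to the
   factor that vanishes in the right half. *)
Lemma left_factor d (a : pi2) : represents a (fun x => narrow x ^+ d) ->
  represents a (fun x => narrow x ^+ d * (narrow x - 2)).
Proof.
have cn : continuous (fun z : Z => narrow z.2 : C^o).
  by apply: C_cont; exact: affine_cont.
have n1 x : cube_boundary x -> 1 <= sqnorm (narrow x).
  by move=> bx; apply: sqnorm_ge1; case: (boundaryP bx) => ->; lra.
move=> ra; have {ra} : represents a (fun x => narrow x ^+ d * (- 1)).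
  apply: (@represents_prod d a (fun x => narrow x ^+ d) _ (fun z : Z => narrow z.2)
    (fun z : Z => Complex (cos (pi * z.1)) (sin (pi * z.1)))) ra.
  - exact: cn.
  - have cp : continuous (fun z : Z => pi * z.1 : R) by exact: scale_cont.
    by apply: C_cont; [exact: (comp_cont cp (@continuous_cos R))|
      exact: (comp_cont cp (@continuous_sin R))].
  - move=> t x t01 bx; split; first exact: n1.
    by rewrite /sqnorm /= cos2Dsin2.
  - by move=> x /=; rewrite mulr0 cos0 sin0 mulr1.
  - move=> x /=; rewrite mulr1 cospi sinpi; congr (_ * _).
    by rewrite complex1 complexN oppr0.
apply: (@represents_prod d a _ _ (fun z : Z => narrow z.2)
  (fun z : Z => Complex (z.1 * (2 * z.2 0 ord0 - 2) + - 1) (z.1 * (4 * z.2 0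
    ord_max - 2)))).
- exact: cn.
- apply: C_cont.
    apply: add_cont; last exact: cst_continuous.
    by apply: mul_cont => //; exact: affine_cont.
  by apply: mul_cont => //; exact: affine_cont.
- move=> t x t01 bx; split; first exact: n1.
  apply: sqnorm_ge1; left => /=; case: bx => cx _; have := cx ord0; nra.
- move=> x /=; congr (_ * _).
  by rewrite !mul0r add0r complex1 complexN oppr0.
- move=> x /=; congr (_ * _); rewrite /narrow !mul1r complex2 complexN complexD.
  by congr Complex; lra.
Qed.

(** In the right half of the square the other factor has real part at least 1, so
   that it can be deformed to 1. *)
Lemma right_factor d (a : pi2) : represents a narrow ->
  represents a (fun x => (narrow x + 2) ^+ d * narrow x).
Proof.
have cn : continuous (fun z : Z => narrow z.2 : C^o).
  by apply: C_cont; exact: affine_cont.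
apply: (@represents_prod d a _ _ (fun z : Z => Complex
   (z.1 * (2 * z.2 0 ord0) + 1) (z.1 * (4 * z.2 0 ord_max - 2)))
  (fun z : Z => narrow z.2)).
- apply: C_cont.
    apply: add_cont; last exact: cst_continuous.
    by apply: mul_cont => //; exact: scale_cont.
  by apply: mul_cont => //; exact: affine_cont.
- exact: cn.
- move=> t x t01 bx; split.
    apply: sqnorm_ge1; right; left => /=; case: bx => cx _; have := cx ord0; nra.
  by apply: sqnorm_ge1; case: (boundaryP bx) => ->; lra.
- by move=> x /=; rewrite !mul0r add0r expr1n mul1r.
- move=> x /=; congr (_ ^+ d * _); rewrite /narrow !mul1r complex2 complexD.
  by congr Complex; lra.
Qed.

(** The roots of w^d.w are pulled apart to -1 and 1, so that the imaginary axis
  goes to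
   infinity and separates the factors w^d and w. *)
Lemma represents_step d (a b : pi2) :
  represents a (fun x => wide x ^+ d) -> represents b wide ->
  represents (a * b)%g (fun x => wide x ^+ d.+1).
Proof.
move=> ra rb.
have rl := left_factor (wide_to_narrow ra).
have rr : represents b narrow.
  have : represents b (fun x => wide x ^+ 1) by [].
  by move/wide_to_narrow.
have {rr} rr := right_factor d rr.
have := @represents_mul a b _ _ (fun x => (wide x + 1) ^+ d * (wide x - 1)) rl rr _.
have max0 s (x : 'rV[R]_2) : upd s x 0 ord_max = x 0 ord_max by rewrite updN.
move=> /(_ _)/wrap[].
  move=> x cx; rewrite /conc; case: ifP => _; congr (_ ^+ d * _);
    rewrite /wide /narrow upd0 max0 ?complex2 complex1 ?complexN ?complexD;
      congr Complex; lra.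
apply: (@represents_prod d _ _ _
  (fun z : Z => Complex (4 * z.2 0 ord0 + (- 2 + (1 - z.1))) (4 * z.2 0 ord_max -
    2))
  (fun z : Z => Complex (4 * z.2 0 ord0 + (- 2 - (1 - z.1))) (4 * z.2 0 ord_max -
    2))).
- apply: C_cont; last exact: affine_cont.
  apply: add_cont; first exact: scale_cont.
  by apply: add_cont; [exact: cst_continuous|exact: onem_cont].
- apply: C_cont; last exact: affine_cont.
  apply: add_cont; first exact: scale_cont.
  by apply: sub_cont; [exact: cst_continuous|exact: onem_cont].
- by move=> t x t01 bx; split; apply: sqnorm_ge1 => /=;
  case: (boundaryP bx) => ->; lra.
- move=> x /=; congr (_ ^+ d * _); rewrite /wide complex1 ?complexN complexD;
    congr Complex; lra.
- move=> x /=; rewrite exprSr; congr (_ ^+ d * _); rewrite /wide; congr Complex;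
  lra.
Qed.

(** ** Power maps and multiples *)

Local Notation line_maps := (@based R CP1 None).

Fact CP1_pow_based d : (0 < d)%N -> @based R CP1 None (@CP1_pow R d).
Proof. by move=> d0; split=> //; exact: CP1_pow_continuous. Qed.

Definition pow_map d (d0 : (0 < d)%N) : line_maps :=
  exist _ (@CP1_pow R d) (mem_set (CP1_pow_based d0)).

(** Values of [collapse] with a coordinate outside ]-1, 1[ are sent to infinity by
   [shrink]; hence stretch may be made bounded, so that it can be deformed
     linearly. *)
Definition cutoff (s : R) : R := Num.max (1 / 8) (Num.min (7 / 8) s).

Lemma cutoff_cont : continuous (fun s => stretch (cutoff s)).
Proof.
have c : continuous cutoff.
  move=> s; apply: (@continuous_max R R (fun=> 1 / 8) (fun s => Num.min (7 / 8)
    s) s).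
    exact: cst_continuous.
  apply: (@continuous_min R R (fun=> 7 / 8) id s); first exact: cst_continuous.
  exact: continuous_idfun.
move=> s; apply: continuous_comp; first exact: c.
apply: stretch_continuous; rewrite /cutoff; case: (leP (7 / 8) s) => h.
  by rewrite max_r; lra.
by case: (leP (1 / 8) s) => h'; lra.
Qed.

Lemma stretch_small (s : R) : 0 < s -> s <= 1 / 8 -> stretch s <= -1.
Proof.
move=> s0 s8; rewrite /stretch.
have : (1 - s)^-1 <= 2 by rewrite -[2]invrK lef_pV2 ?posrE ?invr_gt0; lra.
have : 8 <= s^-1 by rewrite -[8]invrK lef_pV2 ?posrE ?invr_gt0; lra.
lra.
Qed.

Lemma stretch_opp (s : R) : stretch (1 - s) = - stretch s.
Proof. by rewrite /stretch subKr opprB. Qed.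

Lemma stretch_big (s : R) : s < 1 -> 7 / 8 <= s -> 1 <= stretch s.
Proof.
move=> s1 s7; have := @stretch_small (1 - s); rewrite stretch_opp.
by move=> /(_ ltac:(lra) ltac:(lra)); lra.
Qed.

Lemma cutoff_small s : s <= 1 / 8 -> cutoff s = 1 / 8.
Proof. by move=> h; rewrite /cutoff min_r ?max_l //; lra. Qed.
Lemma cutoff_big s : 7 / 8 <= s -> cutoff s = 7 / 8.
Proof. by move=> h; rewrite /cutoff min_l ?max_r //; lra. Qed.
Lemma cutoff_mid s : 1 / 8 < s < 7 / 8 -> cutoff s = s.
Proof. by move=> h; rewrite /cutoff min_r ?max_r //; lra. Qed.

Definition bounded_collapse (x : 'rV[R]_2) : C :=
  Complex (stretch (cutoff (x 0 ord0))) (stretch (cutoff (x 0 ord_max))).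

Lemma sqnorm_bounded_collapse (x : 'rV[R]_2) i : x 0 i <= 1 / 8 \/ 7 / 8 <= x 0 i ->
  1 <= sqnorm (bounded_collapse x).
Proof.
have small : stretch (1 / 8 : R) <= -1 by apply: stretch_small; lra.
have big : 1 <= stretch (7 / 8 : R) by apply: stretch_big; lra.
have [->|->] := ord2P i => -[h|h]; apply: sqnorm_ge1.
- by left; rewrite cutoff_small.
- by right; left; rewrite cutoff_big.
- by right; right; left; rewrite cutoff_small.
- by right; right; right; rewrite cutoff_big.
Qed.

Lemma shrink_pow_collapse d (x : 'rV[R]_2) :
  shrink_line 1 (CP1_pow d (collapse x)) = shrink 1 (bounded_collapse x ^+ d).
Proof.
have mid_or i : (x 0 i <= 1 / 8 \/ 7 / 8 <= x 0 i) \/ 1 / 8 < x 0 i < 7 / 8.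
  by have [?|?] := leP (x 0 i) (1 / 8); [left;
    left|have [?|?] := leP (7 / 8) (x 0 i);
    [left; right|right; apply/andP]].
have far i : x 0 i <= 1 / 8 \/ 7 / 8 <= x 0 i ->
    shrink_line 1 (CP1_pow d (collapse x)) = None.
  move=> xi; rewrite /collapse; case: ifP => // /andP[x0 x1].
  rewrite /= shrink_infinity // sqnormX exprn_ege1 //.
  have [iE|iE] := ord2P i; rewrite iE in xi; apply: sqnorm_ge1; case: xi => h.
  - by left; apply: stretch_small; lra.
  - by right; left; apply: stretch_big; lra.
  - by right; right; left; apply: stretch_small; lra.
  - by right; right; right; apply: stretch_big; lra.
have far' i : x 0 i <= 1 / 8 \/ 7 / 8 <= x 0 i ->
    shrink_line 1 (CP1_pow d (collapse x)) = shrink 1 (bounded_collapse x ^+ d).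
  move=> xi; rewrite (far i xi) shrink_infinity // sqnormX exprn_ege1 //.
  exact: sqnorm_bounded_collapse xi.
have [/far'//|x0] := mid_or ord0; have [/far'//|x1] := mid_or ord_max.
rewrite /collapse ifT; last by apply/andP; split; lra.
by rewrite /bounded_collapse !cutoff_mid.
Qed.

(** [shrink_line] deforms the identity of the line to a map that collapses the
   complement of the disc; then the coordinates are deformed linearly. *)
Lemma represents_pow d (d0 : (0 < d)%N) :
  represents (homotopy_class (based_cube (pow_map d0))) (fun x => wide x ^+ d).
Proof.
have cpc : continuous (fun x : 'rV[R]_2 => CP1_pow d (collapse x)).
  exact: (comp_cont (@collapse_continuous R) (CP1_pow_continuous d0)).
have : represents (homotopy_class (based_cube (pow_map d0)))
    (fun x => bounded_collapse x ^+ d).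
  pose H (z : R * 'rV[R]_2) := shrink_line (clamp z.1) (CP1_pow d (collapse z.2)).
  have cH : continuous H.
    pose place (z : R * 'rV[R]_2) := (z.1, CP1_pow d (collapse z.2)).
    suff c : continuous place by exact: (comp_cont c shrink_line_cont).
    by apply: pair_cont; [exact: fst_cont|exact: (comp_cont (@snd_cont _ _) cpc)].
  have ce : {within cube R 2, continuous (fun x => H (1, x))}.
    apply: continuous_subspaceT.
    have cp : continuous (fun x : 'rV[R]_2 => (1 : R, x)).
      by apply: pair_cont; [exact: cst_continuous|exact: continuous_idfun].
    exact: (comp_cont cp cH).
  have Hb t x : cube_boundary x -> H (t, x) = None.
    by move=> bx; rewrite /H /= collapse_boundary.
  exists (CubeMap ce (Hb 1)).
    apply/homotopy_classP; apply: homotopic_sym; apply: (homotopicI cH) => //=.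
      move=> x cx; rewrite /H /= clamp_le0 //; case: (CP1_pow _ _) => //= w.
      exact: shrink0.
    by move=> t x _; exact: Hb.
  move=> x cx; transitivity (shrink_line 1 (CP1_pow d (collapse x))).
    by rewrite /= /H /= clamp_ge1.
  exact: shrink_pow_collapse.
apply: (@represents_prod d _ _ _ (fun z : Z => Complex
   ((1 - z.1) * stretch (cutoff (z.2 0 ord0)) + z.1 * (4 * z.2 0 ord0 - 2))
   ((1 - z.1) * stretch (cutoff (z.2 0 ord_max)) + z.1 * (4 * z.2 0 ord_max - 2)))
   (fun=> 1)).
- have cc i : continuous (fun z : Z =>
      (1 - z.1) * stretch (cutoff (z.2 0 i)) + z.1 * (4 * z.2 0 i - 2)).
    apply: add_cont; apply: mul_cont => //.
    + exact: onem_cont.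
    + exact: (comp_cont (@x_cont i) cutoff_cont).
    + exact: affine_cont.
  by apply: C_cont.
- exact: cst_continuous.
- move=> t x t01 bx; split; last by rewrite /sqnorm /=; lra.
  have small : stretch (1 / 8 : R) <= -1 by apply: stretch_small; lra.
  have big : 1 <= stretch (7 / 8 : R) by apply: stretch_big; lra.
  apply: sqnorm_ge1 => /=.
  case: (boundaryP bx) => ->; rewrite ?(@cutoff_small 0) ?(@cutoff_big 1); try lra.
  + by left; nra.
  + by right; left; nra.
  + by right; right; left; nra.
  + by right; right; right; nra.
- by move=> x /=; rewrite mulr1 !subr0 !mul1r !mul0r !addr0.
- by move=> x /=; rewrite mulr1 !subrr !mul1r !mul0r !add0r.
Qed.

Definition id_map : line_maps := pow_map (ltnSn 0).

(** The splitting of roots in [represents_step], iterated. *)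
Lemma class_pow_map d (d0 : (0 < d)%N) :
  homotopy_class (based_cube (pow_map d0)) = (homotopy_class (based_cube id_map)
    ^+ d)%g.
Proof.
apply: (represents_uniq (represents_pow d0)).
have r1 : represents (homotopy_class (based_cube id_map)) wide.
  exact: (represents_pow (ltnSn 0)).
case: d d0 => // d _; elim: d => [|d IH]; first by rewrite expg1.
by rewrite expgSr; exact: represents_step.
Qed.

Lemma pow_map_path d (d0 : (0 < d)%N) : exists gamma : R -> line_maps,
  [/\ continuous gamma, gamma 0 = pow_map d0 & gamma 1 = multiple d id_map].
Proof.
by apply: based_path; apply/homotopy_classP;
  rewrite class_pow_map based_cube_multiple.
Qed.

End PowerMaps.

(** * Precomposition with a power map *)

Section Precomposition.
Context {R : realType}.
Local Notation CP1 := (CP1 R).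

Lemma precompose_continuous (X : topologicalType) (A B : set {compact-open, CP1
  -> X})
    (h : CP1 -> CP1) (phi : A -> B) : continuous h ->
  (forall f, A f -> continuous (f : CP1 -> X)) ->
  (forall f, val (phi f) = val f \o h) -> continuous phi.
Proof.
move=> ch Ac phiE; apply: to_maps_continuous.
have cev := from_maps_continuous Ac (@continuous_idfun A).
pose place (u : A * CP1) := (u.1, h u.2).
have cplace : continuous place.
  by apply: pair_cont; [exact: fst_cont|exact: (comp_cont (@snd_cont _ _) ch)].
have := comp_cont cplace cev.
rewrite (_ : _ \o place = (fun u : A * CP1 => val (phi u.1) u.2)) //.
by apply/funext => u /=; rewrite phiE.
Qed.

Section Based.
Context {X : topologicalType} {x0 : X}.
Local Notation Y := (@based R X x0).
Local Notation line_maps := (@based R CP1 None).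

Fact precompose_based (f : Y) (h : line_maps) : @based R X x0 (val f \o val h).
Proof.
split; first exact: (comp_cont (@based_cont _ _ _ h) (@based_cont _ _ _ f)).
by rewrite /= based_infinity based_infinity.
Qed.

Definition precompose (f : Y) (h : line_maps) : Y :=
  exist _ (val f \o val h : CP1 -> X) (mem_set (precompose_based f h)).

Lemma precompose_multiple f h d : precompose f (multiple d h) = multiple d
  (precompose f h).
Proof.
elim: d => [|d IH] /=; first by apply: eq_square_map => x cx; exact: based_infinity.
rewrite -IH; apply: eq_square_map => x cx.
transitivity (val f (square_map (stack (multiple d h) h) x)); first by [].
by rewrite !square_stack // /conc; case: ifP.
Qed.

Lemma precompose_id f : precompose f id_map = f.
Proof.
apply: eq_square_map => x _; rewrite /square_map /=.
by congr (val f _); case: (collapse x).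
Qed.

Lemma precompose_continuous2 : continuous (fun u : Y * line_maps => precompose
  u.1 u.2).
Proof.
apply: to_maps_continuous.
have cX := from_maps_continuous (fun f (bf : @based R X x0 f) => bf.1)
  (@continuous_idfun Y).
have cL := from_maps_continuous (fun f (bf : @based R CP1 None f) => bf.1)
  (@continuous_idfun line_maps).
pose inner (u : (Y * line_maps) * CP1) := (u.1.2, u.2).
have cinner : continuous inner.
  by apply: pair_cont; [exact: (comp_cont (@fst_cont _ _) (@snd_cont _ _))|exact:
    snd_cont].
pose outer (u : (Y * line_maps) * CP1) := (u.1.1, val u.1.2 u.2).
have couter : continuous outer.
  apply: pair_cont; first exact: (comp_cont (@fst_cont _ _) (@fst_cont _ _)).
  exact: (comp_cont cinner cL).
exact: (comp_cont couter cX).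
Qed.

Variables (d : nat) (d0 : (0 < d)%N).

(** Since z^d is homotopic to d times the identity, f(z^d) is homotopic to d.f,
   continuously in f. *)
Lemma precompose_pow_homotopic :
  @homotopic_maps R Y Y (precompose^~ (pow_map d0)) (multiple d).
Proof.
have [gamma [cg g0 g1]] := @pow_map_path R d d0.
pose place (u : R * Y) := (u.2, gamma u.1).
have cplace : continuous place.
  by apply: pair_cont; [exact: snd_cont|exact: (comp_cont (@fst_cont _ _) cg)].
exists (fun u => precompose u.2 (gamma u.1)); split.
- exact: (comp_cont cplace precompose_continuous2).
- by move=> f; rewrite /= g0.
- by move=> f; rewrite /= g1 precompose_multiple precompose_id.
Qed.

Lemma precompose_pow_continuous : continuous (fun f : Y => precompose f (pow_map
  d0)).
Proof.
apply: (precompose_continuous (CP1_pow_continuous d0)) => //.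
by move=> f [].
Qed.

Lemma induces_precompose_pow E (EP : rational_notion E) n f :
  @induces R E n Y Y (precompose^~ (pow_map d0)) f.
Proof.
apply: (induces_homotopic EP precompose_pow_continuous _ precompose_pow_homotopic).
  exact: multiple_continuous.
exact: induces_multiple.
Qed.

Lemma path_homotopic (gamma : R -> Y) : continuous gamma ->
  homotopic (based_cube (gamma 0)) (based_cube (gamma 1)).
Proof.
move=> cg; apply: (homotopicI (square_map_continuous cg)) => //.
by move=> t x _ /boundary_bdext; exact: square_map_boundary.
Qed.

Lemma class_precompose_pow (f : Y) :
  homotopy_class (based_cube (precompose f (pow_map d0))) =
  (homotopy_class (based_cube f) ^+ d)%g.
Proof.
rewrite -based_cube_multiple; apply/homotopy_classP.
have [H [cH H0 H1]] := precompose_pow_homotopic.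
pose place (t : R) := (t, f).
have cplace : continuous place.
  by apply: pair_cont; [exact: continuous_idfun|exact: cst_continuous].
by have := path_homotopic (comp_cont cplace cH); rewrite /= H0 H1.
Qed.

End Based.
End Precomposition.

(** * Inclusions of unions of path components *)

Section Components.
Context {R : realType} {P Q : topologicalType} (J : P -> Q).
Hypothesis J_cont : continuous J.
Hypothesis J_inj : injective J.
Hypothesis J_initial : forall (T : topologicalType) (alpha : T -> P),
  continuous (J \o alpha) -> continuous alpha.
Hypothesis J_path : forall gamma : R -> Q, continuous gamma ->
  (exists p, J p = gamma 0) -> exists p, J p = gamma 1.

(** The image of J contains the end of a path when it contains its origin; this is
   applied to the segments that start at the origin of the space of cubes. *)
Lemma component_lift (T : topologicalType) n (c : T * 'rV[R]_n -> Q) : continuous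
  c ->
  (forall t, exists p, J p = c (t, 0)) ->
  exists2 l : T * 'rV[R]_n -> P, continuous l & forall z, J (l z) = c z.
Proof.
move=> cc c0.
have lift z : exists p, J p = c z.
  case: z => t x; pose place (s : R) := (t, s *: x).
  have cplace : continuous place.
    apply: pair_cont; first exact: cst_continuous.
    rewrite (_ : (fun s : R => s *: x) = (fun s => \row_i (s * x 0 i))).
      apply: continuous_row => i; apply: mul_cont; first exact: continuous_idfun.
      exact: cst_continuous.
    by apply/funext => s; apply/rowP => i; rewrite !mxE.
  have := J_path (comp_cont cplace cc); rewrite /= /place /= scale1r scale0r.
  by apply; exact: c0.
have [l lE] := choice lift; exists l => //.
by apply: J_initial; rewrite (_ : J \o l = c) //; apply/funext.
Qed.

Lemma cube_boundary0 n : cube_boundary (0 : 'rV[R]_n.+1).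
Proof. by split=> [i|]; [|exists ord0]; rewrite mxE ?lexx ?ler01 //; left. Qed.

Lemma component_bij n (p : P) : bijective (@homotopy_group_map R P Q J J_cont
  n.+1 p).
Proof.
have injJ : injective (@homotopy_group_map R P Q J J_cont n.+1 p).
  elim/(@pi_ind R) => a; elim/(@pi_ind R) => b; rewrite !homotopy_group_mapE.
  move=> /homotopy_classP /homotopicE[H [cH H0 H1 Hb]]; apply/homotopy_classP.
  have [|l cl lE] := component_lift cH.
    by move=> t; exists p; rewrite Hb //; exact/boundary_bdext/cube_boundary0.
  apply: (homotopicI cl).
  - by move=> x cx; apply: J_inj; rewrite lE H0 extendE.
  - by move=> x cx; apply: J_inj; rewrite lE H1 extendE.
  - by move=> t x _ /boundary_bdext bx; apply: J_inj; rewrite lE Hb.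
have surJ b : exists a, @homotopy_group_map R P Q J J_cont n.+1 p a = b.
  elim/(@pi_ind R): b => c.
  have cc : continuous (fun z : R * 'rV[R]_n.+1 => extend c z.2).
    by apply: (comp_cont (@snd_cont _ _)); exact: extend_continuous.
  have [|l cl lE] := component_lift cc.
    by move=> t; exists p; rewrite /= extend_bd //;
      exact/boundary_bdext/cube_boundary0.
  have cl0 : continuous (fun x => l (0, x)).
    have cp : continuous (fun x : 'rV[R]_n.+1 => (0 : R, x)).
      by apply: pair_cont; [exact: cst_continuous|exact: continuous_idfun].
    exact: (comp_cont cp cl).
  have ca : {within cube R n.+1, continuous (fun x => l (0, x))}.
    exact: continuous_subspaceT.
  have ba x : cube_boundary x -> l (0, x) = p.
    by move=> /boundary_bdext bx; apply: J_inj; rewrite lE /= extend_bd.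
  exists (homotopy_class (CubeMap ca ba)); rewrite homotopy_group_mapE.
  by apply/homotopy_classP; apply: homotopic_eq => x cx; rewrite /= lE /= extendE.
have [inv invE] := choice surJ.
by exists inv => a; [apply: injJ|]; rewrite invE.
Qed.

End Components.

(** * Spaces of maps of a given degree *)

Section Degree.
Context {R : realType} {X : variety R} {x0 : analytic X} {r : nat}.
Local Notation CP1 := (CP1 R).
Local Notation C := (complex R).
Variable deg : homotopy_group R 2 x0 -> 'rV[int]_r.
Hypothesis deg_bij : bijective deg.
Hypothesis degM : forall a b : homotopy_group R 2 x0, deg (a * b)%g = deg a + deg b.
Local Notation Y := (@based R (analytic X) x0).
Local Notation F := (BasedMaps deg).

Lemma degX (a : homotopy_group R 2 x0) d : deg (a ^+ d)%g = deg a *+ d.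
Proof.
have deg1 : deg 1%g = 0 by apply: (addrI (deg 1%g)); rewrite -degM mulg1 addr0.
by elim: d => [|d IH]; rewrite ?expg0 ?mulr0n // expgS degM IH mulrS.
Qed.

Lemma F_based n : F n `<=` @based R (analytic X) x0.
Proof. by move=> f [fc [fb _]]. Qed.

Lemma F_degree n (f : Y) : F n (val f) <-> deg (homotopy_class (based_cube f)) = n.
Proof.
split=> [[fc [fb <-]]|<-]; last by exists (@based_cont _ _ _ f), (based_infinity f).
by congr (deg (homotopy_class _)); rewrite /based_cube; congr sphere_cube;
  exact: Prop_irrelevance.
Qed.

Definition to_based n (f : F n) : Y :=
  exist _ (val f) (mem_set (F_based (set_valP f))).

Lemma degree_to_based n (f : F n) : deg (homotopy_class (based_cube (to_based
  f))) = n.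
Proof. by apply/F_degree; exact: (set_valP f). Qed.

Lemma to_based_onto n (g : Y) : deg (homotopy_class (based_cube g)) = n ->
  exists f : F n, to_based f = g.
Proof.
by move=> /F_degree gn; exists (exist _ (val g) (mem_set gn)); exact: val_inj.
Qed.

Lemma to_based_initial n (T : topologicalType) (alpha : T -> F n) :
  continuous (@to_based n \o alpha) -> continuous alpha.
Proof.
move=> c; apply: to_subspace_continuous.
exact: (comp_cont c (@val_continuous _ _)).
Qed.

Lemma to_based_cont n : continuous (@to_based n).
Proof. by apply: to_subspace_continuous; exact: val_continuous. Qed.

Lemma to_based_inj n : injective (@to_based n).
Proof. by move=> f g /(congr1 val) fg; exact: val_inj. Qed.

Lemma to_based_path n (gamma : R -> Y) : continuous gamma ->
  (exists p : F n, to_based p = gamma 0) -> exists p : F n, to_based p = gamma 1.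
Proof.
move=> cg [p pE]; apply: to_based_onto; rewrite -(degree_to_based p) pE.
by congr deg; apply/esym/homotopy_classP; exact: (path_homotopic cg).
Qed.

Lemma F_nonempty n : exists f : F n, True.
Proof.
have [deg' degK deg'K] := deg_bij.
have [f fE] := based_cube_surj (repr (deg' n)).
have [|g _] := @to_based_onto n f; last by exists g.
by move/homotopy_classP: fE => ->; rewrite homotopy_class_repr deg'K.
Qed.

Lemma F_connected n (f g : F n) : @path_equiv R _ f g.
Proof.
have fg : homotopic (based_cube (to_based f)) (based_cube (to_based g)).
  by apply/homotopy_classP; apply: (bij_inj deg_bij); rewrite !degree_to_based.
have [gamma [cg g0 g1]] := based_path fg.
pose c (z : R * 'rV[R]_1) := gamma (z.2 0 ord0).
have cc : continuous c.
  exact: (comp_cont (comp_cont (@snd_cont _ _) (@coord_cont _ _ ord0)) cg).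
have [|l cl lE] := component_lift (@to_based_initial n) (@to_based_path n) cc.
  by move=> t; exists f; rewrite /c /= mxE g0.
have cp : continuous (fun t : R => (0 : R, \row_(j < 1) t)).
  apply: pair_cont; first exact: cst_continuous.
  by apply: continuous_row => j; exact: continuous_idfun.
exists (fun t => l (0, \row_(j < 1) t)); split.
- by apply: continuous_subspaceT; exact: (comp_cont cp cl).
- by apply: to_based_inj; rewrite lE /c /= mxE g0.
- by apply: to_based_inj; rewrite lE /c /= mxE g1.
Qed.

Section Power.
Variables (d : nat) (d0 : (0 < d)%N).

Fact F_pow_degree n (f : F n) : F (n *+ d) (val f \o @CP1_pow R d).
Proof.
apply/(@F_degree _ (precompose (to_based f) (pow_map d0))).
by rewrite class_precompose_pow degX degree_to_based.
Qed.

Definition F_pow n (f : F n) : F (n *+ d) :=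
  exist _ (val f \o @CP1_pow R d : CP1 -> analytic X) (mem_set (F_pow_degree f)).

Lemma F_pow_cont n : continuous (@F_pow n).
Proof.
apply: (precompose_continuous (CP1_pow_continuous d0)) => //.
by move=> f /F_based[].
Qed.

(** The components F n of the space of all based maps have the same homotopy groups
   as the whole space. *)
Lemma induces_F_pow E (EP : rational_notion E) i n (f : F n) :
  @induces R E i _ _ (@F_pow n) f.
Proof.
have J m (g : F m) : @induces R E i _ _ (@to_based m) g.
  apply: (induces_bijective EP (cphi := @to_based_cont m)).
  apply: component_bij;
    [exact: to_based_inj|exact: to_based_initial|exact: to_based_path].
have cP := @precompose_pow_continuous R (analytic X) x0 d d0.
apply: (induces_cancell EP (@F_pow_cont n) (@to_based_cont _)); first exact: J.
rewrite (_ : _ \o _ = (fun g : Y => precompose g (pow_map d0)) \o @to_based n).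
  apply: (induces_comp EP (@to_based_cont _) cP); first exact: J.
  exact: induces_precompose_pow.
by apply/funext => g; exact: val_inj.
Qed.

(** ** Holomorphic maps *)

Lemma derivable_comp_pow (f : C^o -> C^o) (z : C) :
  derivable f (z ^+ d : C^o) 1 -> derivable (fun w : C^o => f ((w : C) ^+ d)) z 1.
Proof.
move=> /derivable1_diffP df; apply/derivable1_diffP.
have dX : differentiable (fun w : C^o => (w : C) ^+ d : C^o) (z : C^o).
  by apply/derivable1_diffP; exact: (@exprn_derivable C d z 1).
exact: (differentiable_comp dX df).
Qed.

Lemma CP1_pow_at_infinity (w : C^o) :
  CP1_pow d (CP1_at_infinity w) = CP1_at_infinity ((w : C) ^+ d : C^o).
Proof.
rewrite /CP1_at_infinity expf_eq0 d0 /=; case: ifP => // _.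
by rewrite /= exprVn.
Qed.

Lemma holomorphic_pow (f : CP1 -> analytic X) :
  holomorphic f -> holomorphic (f \o @CP1_pow R d).
Proof.
move=> [fc fz finf]; split.
- exact: (comp_cont (CP1_pow_continuous d0) fc).
- move=> i z zi l; apply: (derivable_comp_pow (f := fun w => chart i (f (Some w))
  0 l)).
  exact: fz.
- move=> i zi l.
  rewrite (_ : (fun w : C^o => _) = (fun w : C^o =>
    (fun v : C^o => chart i (f (CP1_at_infinity v)) 0 l : C^o) ((w : C) ^+ d))).
    apply: (@derivable_comp_pow (fun v : C^o => chart i (f (CP1_at_infinity v)) 0
      l) 0).
    by rewrite expr0n gtn_eqF //; exact: finf.
  by apply/funext => w; rewrite /= CP1_pow_at_infinity.
Qed.

Fact Hol_pow_subproof n (f : Hol deg n) : Hol deg (n *+ d) (val f \o @CP1_pow R d).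
Proof.
have [Ff hf] := set_valP f; split; last exact: holomorphic_pow.
exact: (F_pow_degree (Hol_inclusion f)).
Qed.

Definition Hol_pow n (f : Hol deg n) : Hol deg (n *+ d) :=
  exist _ (val f \o @CP1_pow R d : CP1 -> analytic X) (mem_set (Hol_pow_subproof
    f)).

Lemma Hol_pow_cont n : continuous (@Hol_pow n).
Proof.
apply: (precompose_continuous (CP1_pow_continuous d0)) => //.
by move=> f [/F_based[]].
Qed.

Lemma induces_Hol_pow E (EP : rational_notion E) i n (f : Hol deg n) :
  continuous (@Hol_inclusion R X x0 r deg n) ->
  continuous (@Hol_inclusion R X x0 r deg (n *+ d)) ->
  @induces R E i _ _ (@Hol_inclusion R X x0 r deg n) f ->
  @induces R E i _ _ (@Hol_inclusion R X x0 r deg (n *+ d)) (Hol_pow f) ->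
  @induces R E i _ _ (@Hol_pow n) f.
Proof.
move=> c cd indn inddn.
apply: (induces_cancell EP (@Hol_pow_cont n) cd inddn).
rewrite (_ : _ \o _ = @F_pow n \o @Hol_inclusion R X x0 r deg n).
  apply: (induces_comp EP c (@F_pow_cont n) indn); exact: induces_F_pow.
by apply/funext => g; exact: val_inj.
Qed.

End Power.
End Degree.

Theorem theorem1p4 (R : realType) (X : variety R) (x0 : analytic X)
  (r : nat) (deg : homotopy_group R 2 x0 -> 'rV[int]_r)
  (C : set 'rV[int]_r) (k : 'rV[int]_r -> nat) :
  nilpotent_space R (analytic X) ->
  bijective deg ->
  (forall a b : homotopy_group R 2 x0, deg (a * b)%g = deg a + deg b) ->
  positive_cone C ->
  (forall n : 'rV[int]_r, C n ->
     rational_equivalence_upto R (k n)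
       (Hol_inclusion (deg := deg) (n := n))) ->
  tends_to_infinity_in C k ->
  forall (n : 'rV[int]_r) (d : nat), C n -> (1 <= d)%N ->
  exists g : Hol deg n -> Hol deg (n *+ d),
    (forall (f : Hol deg n) (z : CP1 R), val (g f) z = val f (CP1_pow d z)) /\
    rational_equivalence_upto R (minn (k n) (k (n *+ d))) g.
Proof.
move=> _ deg_bij degM [_ cone] inc _ n d Cn d0.
have [cn [[_ pn sn] En]] := inc n Cn.
have [cdn [[_ pdn sdn] Edn]] := inc _ (cone n d Cn d0).
exists (@Hol_pow R X x0 r deg degM d d0 n); split=> //.
exists (@Hol_pow_cont R X x0 r deg degM d d0 n); split.
  split=> // [f g _ _|h _].
    by split=> _; [apply/pdn|apply/pn] => //; exact: F_connected.
  have [f0 _] := F_nonempty deg_bij n.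
  by have [f _ _] := sn f0 I; exists f => //; apply/pdn => //; exact: F_connected.
have ind_of (E : forall G H : groupType, (G -> H) -> Prop) i m (f : Hol deg m) (c
  : continuous (@Hol_inclusion R X x0 r deg m)) :
    E _ _ (@homotopy_group_map R _ _ _ c i.+1 f) ->
    @induces R E i _ _ (@Hol_inclusion R X x0 r deg m) f.
  by move=> Ec c'; rewrite (_ : c' = c) //; exact: Prop_irrelevance.
move=> f; split=> [k1|i /andP[i2 ik]].
  move: k1; rewrite leq_min => /andP[k1 k1'].
  apply: (induces_Hol_pow malcev_notion cn cdn); apply: ind_of.
    exact: (En f).1.
  exact: (Edn _).1.
move: ik; rewrite leq_min => /andP[ik ik'].
apply: (induces_Hol_pow tensorQ_notion cn cdn); apply: ind_of.
  by apply: (En f).2; rewrite i2.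
by apply: (Edn _).2; rewrite i2.
Qed.
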